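(* Let $d\ge 3$ be an odd integer, $1\le p\le\infty$ and $(d-1)/2\le\alpha\le\beta$. There is a constant $C>0$, independent of $f$, such that for every $f\in L_p$ whose fractional derivatives $f^{(\alpha)}$ and $f^{(\beta)}$ exist in $L_p$, $$\|f^{(\alpha)}\|_p\le C\,\|f^{(\beta)}\|_p^{\alpha/\beta}\,\|f\|_p^{1-\alpha/\beta}.$$
   Context: $\mathbb{S}^d(\mathbb{C})=\{\mathbf{z}\in\mathbb{C}^{n}: |\mathbf{z}|=1\}$ is the unit sphere of $\mathbb{C}^n$, where $d=2n-1$ is its real dimension ($d=3,5,\dots$), considered as a compact Riemannian manifold with normalized volume element $\nu$. $L_p=L_p(\mathbb{S}^d(\mathbb{C}),\nu)$, $1\le p\le\infty$, has its usual norm $\|\cdot\|_p$. The Laplace–Beltrami operator (with nonnegative sign convention) has eigenvalues $\theta_k=k(k+d-1)$, $k=0,1,2,\dots$, with finite-dimensional, mutually $L_2$-orthogonal eigenspaces $\mathrm{H}_k$; $d_k=\dim \mathrm{H}_k$, and $\{Y_m^k\}_{m=1}^{d_k}$ is a fixed orthonormal basis of $\mathrm{H}_k$ with respect to $\langle f,g\rangle=\int f\,\overline{g}\,d\nu$. For $\phi\in L_p$ put $c_{k,m}(\phi)=\int \phi\,\overline{Y_m^k}\,d\nu$. For $\gamma>0$, one says $\phi^{(\gamma)}\in L_p$ (the $\gamma$-th fractional derivative of $\phi$) if there is a function $\phi^{(\gamma)}\in L_p$ whose formal Fourier series is $\phi^{(\gamma)}\sim\sum_{k\in\mathbb{N}}\theta_k^{\gamma/2}\sum_{m=1}^{d_k}c_{k,m}(\phi)\,Y_m^k$,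 where $\mathbb{N}=\{1,2,\dots\}$. *)

(* Defs.v *)
From HB Require Import structures.
From mathcomp Require Import all_boot all_order all_algebra.
From mathcomp Require Import all_classical all_reals all_analysis.
From mathcomp Require Import measurable_realfun.
From mathcomp Require Import lra.
From mathcomp Require Export complex.

Set Implicit Arguments.
Unset Strict Implicit.
Unset Printing Implicit Defensive.

Import Order.TTheory GRing.Theory Num.Theory.
Import numFieldNormedType.Exports.

Local Open Scope classical_set_scope.
Local Open Scope ring_scope.
Local Open Scope complex_scope.

Section real_coordinates.
Context {R : realType} {m : nat}.

(* C^m is identified with R^(m + m) by z |-> (Re z, Im z). *)
Definition rvec (z : 'rV[R[i]]_m) : 'rV[R]_(m + m) :=
  row_mx (map_mx (@complex.Re R) z) (map_mx (@complex.Im R) z).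

Definition cvec (x : 'I_(m + m) -> R) : 'rV[R[i]]_m :=
  \row_j (x (lshift m j) +i* x (rshift m j)).

Definition cnorm (z : 'rV[R[i]]_m) : R :=
  Num.sqrt (\sum_j (complex.Re (z 0 j) ^+ 2 + complex.Im (z 0 j) ^+ 2)).

End real_coordinates.

(* The unit sphere of C^(n+1); its real dimension is 2 (n+1) - 1. *)
Record csphere (R : realType) (n : nat) := CSphere {
  cval :> 'rV[R[i]]_n.+1 ;
  _ : cnorm cval == 1 }.

HB.instance Definition _ R n := [isSub for @cval R n].
HB.instance Definition _ R n := [Choice of csphere R n by <:].

Section sphere.
Context {R : realType} {n : nat}.
Notation N := (n.+1 + n.+1)%N.

Lemma cnorm_e0 : cnorm (delta_mx 0 0 : 'rV[R[i]]_n.+1) == 1.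
Proof.
rewrite /cnorm (bigD1 ord0) //= mxE /= big1 ?addr0.
  by rewrite expr1n expr0n /= addr0 sqrtr1.
by move=> j j0; rewrite mxE (negPf j0) /= expr0n /= addr0.
Qed.

HB.instance Definition _ := isPointed.Build (csphere R n) (CSphere cnorm_e0).

Definition rcoord (z : csphere R n) : N.-tuple R :=
  [tuple rvec (cval z) 0 i | i < N].

(* The Borel sigma-algebra of the sphere is the trace of that of R^(2n+2). *)
HB.instance Definition _ :=
  Measurable.copy (csphere R n) (g_sigma_algebra_preimageType rcoord).

(* z |-> z / |z|, with a dummy value at z = 0. *)
Definition sproj (z : 'rV[R[i]]_n.+1) : csphere R n :=
  insubd (point : csphere R n) ((cnorm z)^-1%:C *: z).

Definition tsproj (t : N.-tuple R) : csphere R n := sproj (cvec (tnth t)).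

Lemma cnorm_ge0 m (z : 'rV[R[i]]_m) : 0 <= cnorm z.
Proof. exact: sqrtr_ge0. Qed.

Lemma cnormZ m (a : R) (z : 'rV[R[i]]_m) :
  0 <= a -> cnorm (a%:C *: z) = a * cnorm z.
Proof.
move=> a0; rewrite /cnorm.
transitivity (Num.sqrt (a ^+ 2 *
    \sum_j (complex.Re (z 0 j) ^+ 2 + complex.Im (z 0 j) ^+ 2))).
  congr Num.sqrt; rewrite mulr_sumr; apply: eq_bigr => j _; rewrite mxE.
  case: (z 0 j) => x y /=.
  by rewrite !mul0r subr0 addr0 mulrDr !exprMn.
by rewrite sqrtrM ?sqr_ge0// sqrtr_sqr ger0_norm.
Qed.

Lemma cval_sproj (z : 'rV[R[i]]_n.+1) :
  cval (sproj z) = if cnorm z == 0 then delta_mx 0 0 else (cnorm z)^-1%:C *: z.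
Proof.
rewrite /sproj -[cval _]/(val _) val_insubd cnormZ ?invr_ge0 ?cnorm_ge0//.
have [->|z0] := eqVneq (cnorm z) 0; last by rewrite mulVf// eqxx.
by rewrite mulr0 eq_sym oner_eq0.
Qed.

Lemma measurable_cnorm_cvec :
  measurable_fun [set: N.-tuple R]
    (fun t => cnorm (cvec (tnth t) : 'rV[R[i]]_n.+1)).
Proof.
apply: (@measurableT_comp _ _ _ _ _ _ (@Num.sqrt R)).
  exact: (continuous_measurable_fun (@sqrt_continuous R)).
under eq_fun do under eq_bigr do rewrite !mxE /=.
apply: measurable_sum => j; apply: measurable_funD => /=.
  by apply: measurable_funX; exact: measurable_tnth.
by apply: measurable_funX; exact: measurable_tnth.
Qed.

Lemma measurable_tsproj : measurable_fun [set: N.-tuple R] tsproj.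
Proof.
have mrc : measurable_fun [set: N.-tuple R] (rcoord \o tsproj).
  apply/measurable_fun_tnthP => i.
  pose e := rvec (delta_mx 0 0 : 'rV[R[i]]_n.+1) 0 i.
  rewrite (_ : _ \o _ = fun t => if cnorm (cvec (tnth t) : 'rV[R[i]]_n.+1) == 0
      then e else (cnorm (cvec (tnth t) : 'rV[R[i]]_n.+1))^-1 * tnth t i).
    apply: measurable_fun_ifT => //=.
      apply: (@measurable_fun_eqr _ _ _ _ _ (fun=> 0)) => //.
      exact: measurable_cnorm_cvec.
    apply: measurable_funM; last exact: measurable_tnth.
    under eq_fun do rewrite -powR_inv1 ?cnorm_ge0//.
    apply: (measurableT_comp (measurable_powR _)).
    exact: measurable_cnorm_cvec.
  apply/funext => t /=; rewrite tnth_mktuple /tsproj cval_sproj.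
  case: ifPn => // _.
  rewrite /rvec; case: (split_ordP i) => j ->.
    by rewrite row_mxEl !mxE /= mul0r subr0.
  by rewrite row_mxEr !mxE /= mul0r addr0.
move=> _ _ [B mB <-]; rewrite setTI setTI.
by have := mrc measurableT _ mB; rewrite setTI comp_preimage.
Qed.

End sphere.

Section sphere_measure.
Context {R : realType}.

Lemma measurable_tcons k :
  measurable_fun [set: k.-tuple R * R]
    (fun p => [the k.+1.-tuple R of p.2 :: p.1]).
Proof. exact: measurable_cons. Qed.

Definition mpush d1 d2 (T1 : measurableType d1) (T2 : measurableType d2)
    (m : {measure set T1 -> \bar R}) (f : T1 -> T2)
    (mf : measurable_fun [set: T1] f) : {measure set T2 -> \bar R} :=
  measure_function_pushforward__canonical__measure_function_Measure m mf.

(* Lebesgue measure on R^k *)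
Fixpoint lebesgue_tuple k : {measure set (k.-tuple R) -> \bar R} :=
  if k is k'.+1 return {measure set (k.-tuple R) -> \bar R} then
    mpush (lebesgue_tuple k' \x (@lebesgue_measure R))%E (@measurable_tcons k')
  else dirac [tuple].

Definition box k (r : R) : set (k.-tuple R) :=
  [set t | forall i, `[- r, r]%classic (tnth t i)].

Lemma boxS k r : (fun p : k.-tuple R * R => [the k.+1.-tuple R of p.2 :: p.1])
  @^-1` box r = (@box k r) `*` `[- r, r].
Proof.
apply/seteqP; split => [[t x] /= h|[t x] /= [ht hx] i].
  split=> [i|]; last by have := h ord0; rewrite (tnth_nth 0).
  by have := h (lift ord0 i); rewrite tnthS.
case: (unliftP ord0 i) => [j ->|->]; first by rewrite tnthS; exact: ht.
by rewrite (tnth_nth 0).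
Qed.

Lemma measurable_box k r : measurable (@box k r).
Proof.
have -> : @box k r = \bigcap_(i in [set: 'I_k])
    (fun t : k.-tuple R => tnth t i) @^-1` `[- r, r].
  by apply/seteqP; split => [t h i _|t h i]; [exact: h|exact: (h i I)].
apply: fin_bigcap_measurable => // i _; rewrite -[_ @^-1` _]setTI.
exact: measurable_tnth.
Qed.

Lemma lebesgue_tuple_box k r : 0 <= r ->
  lebesgue_tuple k (@box k r) = ((r *+ 2) ^+ k)%:E.
Proof.
move=> r0; elim: k => [|k IH] /=.
  by rewrite expr0 diracE mem_set// => -[].
rewrite /pushforward boxS product_measure1E//; last exact: measurable_box.
rewrite IH /= lebesgue_measure_itv /= lte_fin.
case: ltP => [_|h]; first by rewrite -EFinD -EFinM exprSr opprK mulr2n.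
by rewrite (_ : r = 0) ?mul0rn ?expr0n ?mule0//; lra.
Qed.

Context {n : nat}.
Notation N := (n.+1 + n.+1)%N.

Definition unit_ball : set (N.-tuple R) :=
  [set t | cnorm (cvec (tnth t) : 'rV[R[i]]_n.+1) <= 1].

Lemma measurable_unit_ball : measurable unit_ball.
Proof.
rewrite -[unit_ball]setTI /unit_ball.
by apply: measurable_fun_le => //; exact: measurable_cnorm_cvec.
Qed.

(* The surface measure of the sphere, up to a constant factor: the volume of
   the part of the unit ball lying over A. *)
Definition cone_measure : {measure set csphere R n -> \bar R} :=
  mpush (mrestr (lebesgue_tuple N) measurable_unit_ball) measurable_tsproj.

Lemma cone_measureE (A : set (csphere R n)) :
  cone_measure A = lebesgue_tuple (n.+1 + n.+1) (tsproj @^-1` A `&` unit_ball).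
Proof. by []. Qed.

Lemma cone_measureT_gt0 : (0 < cone_measure [set: csphere R n])%E.
Proof.
rewrite cone_measureE preimage_setT setTI.
pose r : R := (n.+1 + n.+1)%:R^-1.
have r0 : 0 < r by rewrite invr_gt0 ltr0n.
have r1 : r <= 1 by rewrite invf_le1 ?ltr0n// ler1n.
apply: (@lt_le_trans _ _ (lebesgue_tuple (n.+1 + n.+1) (box r))).
  by rewrite lebesgue_tuple_box ?ltW// lte_fin exprn_gt0// pmulrn_rgt0.
apply: le_measure; rewrite ?inE; [exact: measurable_box|exact: measurable_unit_ball|].
move=> t h; rewrite /unit_ball /= -sqrtr1 ler_wsqrtr//.
have sq i : tnth t i ^+ 2 <= r.
  have /= := h i; rewrite in_itv /= => /andP[? ?].
  by rewrite (@le_trans _ _ (r ^+ 2))// ?expr2; nra.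
apply: (@le_trans _ _ (\sum_(j < n.+1) (r + r))).
  by apply: ler_sum => j _; rewrite !mxE /= lerD.
by rewrite sumr_const card_ord -mulr2n -mulrnA mul2n -addnn -mulr_natr mulVf// pnatr_eq0.
Qed.

Lemma cone_measureT_lty : (cone_measure [set: csphere R n] < +oo)%E.
Proof.
rewrite cone_measureE preimage_setT setTI.
apply: (@le_lt_trans _ _ (lebesgue_tuple (n.+1 + n.+1) (box 1))); last first.
  by rewrite lebesgue_tuple_box// ltry.
apply: le_measure; rewrite ?inE; [exact: measurable_unit_ball|exact: measurable_box|].
move=> t; rewrite /unit_ball /= -[leRHS]sqrtr1 ler_sqrt// => h i.
suff: `|tnth t i| <= 1 by rewrite ler_norml /= in_itv.
rewrite -(@ler_pXn2r _ 2)// ?nnegrE// expr1n real_normK ?num_real//.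
have S (j : 'I_n.+1) : complex.Re (cvec (tnth t) 0 j) ^+ 2 + complex.Im (cvec (tnth t) 0 j) ^+ 2 <= 1.
  apply: le_trans h; rewrite (bigD1 j) //= lerDl sumr_ge0// => l _.
  by rewrite addr_ge0 ?sqr_ge0.
case: (split_ordP i) => j ->; have := S j; rewrite !mxE /=; apply: le_trans.
  by rewrite lerDl sqr_ge0.
by rewrite lerDr sqr_ge0.
Qed.

(* The normalized volume element of the sphere. The measure dirac point is the
   fallback of mnormalize for a null or infinite measure; it is never used, see
   sphere_measureE. *)
Definition sphere_measure : probability (csphere R n) R :=
  mnormalize cone_measure (dirac point).

Lemma sphere_measureE (A : set (csphere R n)) :
  sphere_measure A =
  (cone_measure A * (fine (cone_measure [set: csphere R n]))^-1%:E)%E.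
Proof.
rewrite /sphere_measure /= /mnormalize.
by rewrite gt_eqF ?cone_measureT_gt0// lt_eqF ?cone_measureT_lty.
Qed.

End sphere_measure.

Section Lp.
Context {R : realType} {n : nat}.
Implicit Types f g : csphere R n -> R[i].

Definition cintegral f : R[i] :=
  (\int[sphere_measure]_z complex.Re (f z)) +i*
  (\int[sphere_measure]_z complex.Im (f z)).

Definition inner f g : R[i] := cintegral (fun z => f z * conjc (g z)).

Definition Lpnorm (p : \bar R) f : \bar R :=
  ('N[sphere_measure]_p[(EFin \o (fun z => Normc.normc (f z)))])%E.

Definition in_Lp (p : \bar R) f : Prop :=
  [/\ measurable_fun setT (fun z => complex.Re (f z)),
      measurable_fun setT (fun z => complex.Im (f z)) &
      (Lpnorm p f < +oo)%E].

End Lp.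

Section laplace_beltrami.
Context {R : realType}.

Fixpoint is_Ck {N : nat} (k : nat) (U : set 'rV[R]_N) (F : 'rV[R]_N -> R) :
    Prop :=
  (forall x, U x -> {for x, continuous F}) /\
  if k is k'.+1 then
    forall i : 'I_N, (forall x, U x -> derivable F x (delta_mx 0 i)) /\
      is_Ck k' U (fun x => 'D_(delta_mx 0 i) F x)
  else True.

Definition laplacian {N : nat} (F : 'rV[R]_N -> R) (x : 'rV[R]_N) : R :=
  \sum_(i < N) 'D_(delta_mx 0 i) (fun y => 'D_(delta_mx 0 i) F y) x.

Context {n : nat}.
Notation N := (n.+1 + n.+1)%N.
Implicit Types f : csphere R n -> R[i].

(* The extension of f to R^(2n+2) minus 0, homogeneous of degree 0. *)
Definition homog_ext f (x : 'rV[R]_N) : R[i] := f (sproj (cvec (x 0))).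

(* Smoothness on the sphere is smoothness of the homogeneous extension. *)
Definition smooth f : Prop := forall k : nat,
  is_Ck k [set x : 'rV[R]_N | x != 0] (fun x => complex.Re (homog_ext f x)) /\
  is_Ck k [set x : 'rV[R]_N | x != 0] (fun x => complex.Im (homog_ext f x)).

(* The Laplace-Beltrami operator (div grad) of the round sphere: the Euclidean
   Laplacian of the homogeneous extension of degree 0, restricted to the
   sphere. *)
Definition laplace_beltrami f (z : csphere R n) : R[i] :=
  laplacian (fun x => complex.Re (homog_ext f x)) (rvec (cval z)) +i*
  laplacian (fun x => complex.Im (homog_ext f x)) (rvec (cval z)).

Definition LB_eigenspace (lambda : R) : set (csphere R n -> R[i]) :=
  [set f | smooth f /\ forall z, - laplace_beltrami f z = lambda%:C * f z].

End laplace_beltrami.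

Section fractional_derivative.
Context {R : realType} {n : nat}.
Implicit Types f g : csphere R n -> R[i].

Definition orthonormal_basis (V : set (csphere R n -> R[i])) (m : nat)
    (Y : 'I_m -> csphere R n -> R[i]) : Prop :=
  [/\ forall i, V (Y i),
      forall i j, inner (Y i) (Y j) = (i == j)%:R &
      forall g, V g -> exists c : 'I_m -> R[i],
        forall z, g z = \sum_(i < m) c i * Y i z].

Definition theta (d k : nat) : R := (k * (k + d - 1))%N%:R.

(* g has the formal Fourier series of the gamma-th derivative of f; the series
   starts at k = 1. *)
Definition is_fracderiv (d : nat) (dk : nat -> nat)
    (Y : forall k, 'I_(dk k) -> csphere R n -> R[i]) (gamma : R) f g : Prop :=
  forall k (m : 'I_(dk k)), inner g (Y k m) =
    if k == 0%N then 0 else (theta d k `^ (gamma / 2))%:C * inner f (Y k m).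

End fractional_derivative.

(* Main.v *)
Require Import Defs.
From HB Require Import structures.
From mathcomp Require Import all_boot all_order all_algebra.
From mathcomp Require Import all_classical all_reals all_analysis.
From mathcomp Require Import measurable_realfun ess_sup_inf hoelder.
From mathcomp Require Import complex.
From mathcomp Require Import ring lra zify.

Set Implicit Arguments.
Unset Strict Implicit.
Unset Printing Implicit Defensive.

Import Order.TTheory GRing.Theory Num.Theory.
Import numFieldNormedType.Exports.

Local Open Scope classical_set_scope.
Local Open Scope ring_scope.

(* Let A be the nonnegative Laplacian. On spherical polynomials, u minus the average
   of u over the rotations by a small angle in the coordinate planes is a multiple
   of A u up to higher order terms; rotations preserve every L^q norm, so
   ||u||_q <= ||u + t A u||_q for t >= 0 and the resolvents (1 + t A)^-1 are
   contractions of L^q. For 0 < s < m the multiplier x^s / (1 + x)^m is an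
   absolutely convergent integral over t of products of m resolvents (1 + A)^-1 and
   m factors 1 - (1 + t A)^-1, hence bounded as well, and the expansion of
   1 = ((1 + x) / (1 + x))^m turns this into
     |<A^a F, u>| <= C (t^(b-a) ||A^b F||_p + t^(-a) ||F||_p) ||u||_q
   for the conjugate exponent q. Spherical polynomials are sums of eigenfunctions
   and are dense enough to recover L^p norms by duality. Optimizing over t gives
   the multiplicative inequality for real functions, with a = alpha / 2 and
   b = beta / 2; real and imaginary parts are treated separately. *)

(** * Rotation invariance of the sphere measure *)

(** The hypotheses only relate Fourier coefficients, and the Fourier series of an L^p function need
    not converge in L^p. This is why every operator is applied to the test function, where the
    functional calculus is finite algebra on finitely many eigenfunctions, with bounds uniform in
    their number. The Laplacian of the statement is defined by homogeneous extension, whereas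
    contractivity is visible only through rotations; the two are computed separately on monomials
    and found to agree. A single rotation differs from the identity at first order in its angle, but
    the average contains each rotation together with its inverse, so a second-order operator
    remains. The multiplier x^a is unbounded, which forces the detour through x^s / (1 + x)^m. A
    difference of the identity and a contraction has norm at most 2, the origin of the powers of 2.
    The constants come from a and b alone and are the same for all p, since each resolvent is a
    contraction for every exponent. *)

Section product_measure12.
Context d1 d2 (T1 : measurableType d1) (T2 : measurableType d2) (R : realType).
Context (m1 : {measure set T1 -> \bar R}).
Context (m2 : {sigma_finite_measure set T2 -> \bar R}).
Context (sf1 : sigma_finite setT m1).

(* product_measure_unique takes its first measure with a canonical sigma-finite
   structure. *)
Definition sf_measure of phant_id sf1 sf1 : set T1 -> \bar R := m1.

Let m1' := sf_measure idfun.

HB.instance Definition _ := Measure.on m1'.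
HB.instance Definition _ := Measure_isSigmaFinite.Build _ _ _ m1' sf1.

Lemma product_measure12 B : measurable B -> (m1 \x m2)%E B = (m1 \x^ m2)%E B.
Proof.
apply: (@product_measure_unique _ _ _ _ _ m1' m2 (m1' \x^ m2)%E) => A1 A2 mA1 mA2.
exact: product_measure2E.
Qed.

End product_measure12.

(** * Lebesgue measure on R^k under translations and shears *)

Section lebesgue_invariance.
Context {R : realType}.

Let leb := @lebesgue_measure R.

Lemma measurable_shift (a : R) : measurable_fun [set: R] (fun x => x + a).
Proof. by apply: measurable_funD. Qed.

Lemma lebesgue_measure_shift (a : R) (A : set R) : measurable A ->
  leb ((fun x => x + a) @^-1` A) = leb A.
Proof.
move=> mA; apply/esym.
apply: (@lebesgue_measure_unique R
  (@mpush R _ _ (measurableTypeR R) (measurableTypeR R) leb _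
     (measurable_shift a))) => // X [[x y] /= _ <-] /=.
rewrite /pushforward /=.
have -> : (fun z => z + a) @^-1` `]x, y] = `](x - a), (y - a)]%classic.
  by apply/seteqP; split => z /=; rewrite !in_itv /= ltrBlDr lerBrDr.
rewrite /leb !lebesgue_measure_itv /= !lte_fin ltrD2r.
by case: ifP => // _; rewrite -!EFinB; congr EFin; lra.
Qed.

Lemma sigma_finite_lebesgue_tuple k : sigma_finite setT (@lebesgue_tuple R k).
Proof.
exists (fun j => @box R k j%:R).
  apply/seteqP; split => // t _.
  have [M hM] : exists M : nat, forall i, `|tnth t i| <= M%:R.
    exists (Num.bound (\sum_i `|tnth t i|)) => i.
    rewrite (@le_trans _ _ (\sum_i `|tnth t i|))//.
      by rewrite (bigD1 i) //= lerDl sumr_ge0.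
    apply: ltW; rewrite archi_boundP// sumr_ge0//.
  exists M => // i /=; rewrite in_itv /= -ler_norml; exact: hM.
move=> i; split; first exact: measurable_box.
by rewrite lebesgue_tuple_box// ltry.
Qed.

(** The offset [a] serves the induction on [k]: once the head coordinate is frozen, its term in the
    sum becomes part of the constant. *)
Definition shear k (i : 'I_k) (c : 'I_k -> R) (a : R) (t : k.-tuple R) :
    k.-tuple R :=
  [tuple if j == i then tnth t j + (a + \sum_l c l * tnth t l) else tnth t j
  | j < k].

Lemma measurable_shear k (i : 'I_k) c a :
  measurable_fun setT (@shear k i c a).
Proof.
apply/measurable_fun_tnthP => j.
rewrite [X in measurable_fun _ X](_ : _ = fun t : k.-tuple R => if j == i
  then tnth t j + (a + \sum_l c l * tnth t l) else tnth t j); last first.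
  by apply/funext => t /=; rewrite tnth_mktuple.
case: (j == i); last exact: measurable_tnth.
apply: measurable_funD; first exact: measurable_tnth.
apply: measurable_funD => //.
apply: measurable_sum => l; apply: measurable_funM => //.
exact: measurable_tnth.
Qed.

(** Since [c i = 0], coordinate [i] is translated by an amount independent of it. If [i] is the
    head, its sections are translated; otherwise Fubini allows the head to be frozen first, and the
    induction hypothesis applies to the tail. *)
Lemma lebesgue_tuple_shear k (i : 'I_k) c a (A : set (k.-tuple R)) :
  c i = 0 -> measurable A ->
  lebesgue_tuple k (shear i c a @^-1` A) = lebesgue_tuple k A.
Proof.
elim: k i c a A => [[]//|k IH] i c a A ci mA /=.
rewrite /pushforward /=.
pose mc := fun p : k.-tuple R * R => cons_tuple p.2 p.1; rewrite -/mc.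
have mcA B : measurable B -> measurable (mc @^-1` B).
  by move=> mB; rewrite -[X in measurable X]setTI; exact: (@measurable_tcons R k measurableT).
have msA : measurable (shear i c a @^-1` A).
  by rewrite -[X in measurable X]setTI; exact: (@measurable_shear _ i c a measurableT).
case: (unliftP ord0 i) => [i'|] ei; last first.
  subst i; rewrite /product_measure1; apply: eq_integral => t _ /=.
  pose s := a + \sum_(l < k) c (lift ord0 l) * tnth t l.
  have mX : measurable (xsection (mc @^-1` A) t).
    by apply: measurable_xsection; exact: mcA.
  rewrite -[RHS](lebesgue_measure_shift s mX).
  congr (lebesgue_measure _); apply/seteqP.
  have E x : mc (t, x + s) = shear ord0 c a (mc (t, x)).
    apply: eq_from_tnth => j; rewrite tnth_mktuple.
    case: (unliftP ord0 j) => [j' ->|->].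
      by rewrite (negPf (_ : lift ord0 j' != ord0))// !tnthS.
    rewrite eqxx /mc /= !(tnth_nth 0) /=; congr (_ + (_ + _)).
    rewrite big_ord_recl ci mul0r add0r; apply: eq_bigr => l _.
    by rewrite tnthS.
  by split => x /=; rewrite /xsection /= !inE /= E.
have F B : measurable B ->
    (@lebesgue_tuple R k \x leb)%E B = (@lebesgue_tuple R k \x^ leb)%E B.
  exact/product_measure12/sigma_finite_lebesgue_tuple.
rewrite [LHS]F ?[RHS]F; [|exact: mcA|exact: mcA].
rewrite /product_measure2; apply: eq_integral => x _ /=.
pose a' := a + c ord0 * x.
pose c' := fun l => c (lift ord0 l).
rewrite -[RHS](IH i' c' a'); last 2 first.
  by rewrite /c' -ei.
  by apply: measurable_ysection; exact: mcA.
congr (lebesgue_tuple k _).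
have E t : mc (shear i' c' a' t, x) = shear i c a (mc (t, x)).
  apply: eq_from_tnth => j; rewrite tnth_mktuple.
  case: (unliftP ord0 j) => [j' ->|->].
    rewrite ei !tnthS tnth_mktuple (inj_eq lift_inj); case: ifP => // _.
    rewrite /a' -!addrA; congr (_ + (_ + _)).
    rewrite big_ord_recl; congr (_ * _ + _).
    by apply: eq_bigr => l _; rewrite tnthS.
  by rewrite ei [_ == _](_ : _ = false) // /mc /= !(tnth_nth 0).
by apply/seteqP; split => t /=; rewrite /ysection /= !inE /= E.
Qed.

End lebesgue_invariance.

(** * Real coordinates on the sphere and plane rotations *)

Section coordinates.
Context {R : realType} {n : nat}.
Local Notation N := (n.+1 + n.+1)%N.
Implicit Types (x : 'I_N -> R) (z : csphere R n).

Definition co z (l : 'I_N) : R := rvec (cval z) 0 l.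

Lemma rvec_cvec x l : rvec (cvec x : 'rV[R[i]]_n.+1) 0 l = x l.
Proof.
rewrite /rvec; case: (split_ordP l) => j ->.
  by rewrite row_mxEl !mxE.
by rewrite row_mxEr !mxE.
Qed.

Lemma cnorm_cvec x : cnorm (cvec x : 'rV[R[i]]_n.+1) = Num.sqrt (\sum_l x l ^+ 2).
Proof.
rewrite /cnorm; congr Num.sqrt; rewrite big_split_ord /= -big_split /=.
by apply: eq_bigr => j _; rewrite !mxE.
Qed.

Lemma cvec_co z : cvec (co z) = cval z.
Proof.
apply/rowP => j; rewrite !mxE /co /rvec row_mxEl row_mxEr !mxE.
by case: (cval z 0 j).
Qed.

Lemma co_inj z z' : co z =1 co z' -> z = z'.
Proof.
move=> e; apply: val_inj => /=; rewrite -!cvec_co; congr cvec.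
exact/funext.
Qed.

Lemma sum_co z : \sum_l co z l ^+ 2 = 1.
Proof.
have : cnorm (cval z) == 1 by case: z.
rewrite -cvec_co cnorm_cvec => /eqP h.
rewrite -(@sqr_sqrtr _ (\sum_l co z l ^+ 2)); first by rewrite h expr1n.
by apply: sumr_ge0 => l _; exact: sqr_ge0.
Qed.

Lemma co_sproj x l : \sum_l x l ^+ 2 != 0 ->
  co (sproj (cvec x)) l = (Num.sqrt (\sum_l x l ^+ 2))^-1 * x l.
Proof.
move=> x0; rewrite /co cval_sproj cnorm_cvec sqrtr_eq0.
have s0 : 0 <= \sum_l x l ^+ 2 by apply: sumr_ge0 => ? _; exact: sqr_ge0.
have {}s0 : 0 < \sum_l x l ^+ 2 by rewrite lt_neqAle eq_sym x0.
rewrite leNgt s0 /=.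
rewrite -[in RHS](rvec_cvec x l) /rvec; case: (split_ordP l) => j ->.
  by rewrite !row_mxEl !mxE /= mul0r subr0.
by rewrite !row_mxEr !mxE /= mul0r addr0.
Qed.

Lemma co_sproj1 x l : \sum_l x l ^+ 2 = 1 -> co (sproj (cvec x)) l = x l.
Proof. by move=> x1; rewrite co_sproj x1 ?oner_eq0// sqrtr1 invr1 mul1r. Qed.

Lemma norm_co_le1 z l : `|co z l| <= 1.
Proof.
rewrite -(@ler_pXn2r _ 2)// ?nnegrE// expr1n real_normK ?num_real//.
rewrite -(sum_co z) (bigD1 l) //= lerDl sumr_ge0// => *; exact: sqr_ge0.
Qed.

Lemma measurable_co l : measurable_fun [set: csphere R n] (fun z => co z l).
Proof.
rewrite (_ : (fun z => co z l) = (@tnth N R ^~ l) \o rcoord); last first.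
  by apply/funext => z /=; rewrite tnth_mktuple.
apply: measurableT_comp; first exact: measurable_tnth.
by move=> _ B mB; rewrite setTI; exists B => //; rewrite setTI.
Qed.

Lemma measurable_to_csphere d (T : measurableType d) (f : T -> csphere R n) :
  (forall l, measurable_fun setT (fun t => co (f t) l)) -> measurable_fun setT f.
Proof.
move=> mf.
have mrc : measurable_fun [set: T] (rcoord \o f).
  apply/measurable_fun_tnthP => i.
  rewrite [X in measurable_fun _ X](_ : _ = fun t => co (f t) i)//.
  by apply/funext => t /=; rewrite tnth_mktuple.
move=> _ _ [B mB <-]; rewrite setTI setTI.
by have := mrc measurableT _ mB; rewrite setTI comp_preimage.
Qed.

(** Rotation in a coordinate plane, parametrized by its sine [s] with nonnegative cosine; this keeps
    the expansion for small [s] algebraic. *)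
Definition rotf (i j : 'I_N) (s : R) x : 'I_N -> R := fun l =>
  if l == i then Num.sqrt (1 - s ^+ 2) * x i - s * x j
  else if l == j then s * x i + Num.sqrt (1 - s ^+ 2) * x j else x l.

Definition rotS i j s z : csphere R n := sproj (cvec (rotf i j s (co z))).

Lemma sum_rotf i j s x : i != j -> s ^+ 2 <= 1 ->
  \sum_l rotf i j s x l ^+ 2 = \sum_l x l ^+ 2.
Proof.
move=> ij s1; rewrite (bigD1 i) // (bigD1 j) 1?eq_sym//=.
rewrite [RHS](bigD1 i) // [in RHS](bigD1 j) 1?eq_sym//=.
rewrite !addrA; congr (_ + _).
  rewrite /rotf !eqxx [j == i]eq_sym (negPf ij).
  have := sqr_sqrtr (_ : 0 <= 1 - s ^+ 2); rewrite subr_ge0 => /(_ s1).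
  set c := Num.sqrt _ => c2.
  rewrite sqrrB sqrrD !exprMn c2.
  have : s * x i * (c * x j) = c * x i * (s * x j) by ring.
  move=> ->; ring.
by apply: eq_bigr => l /andP[li lj]; rewrite /rotf (negPf li) (negPf lj).
Qed.

Lemma co_rotS i j s z l : i != j -> s ^+ 2 <= 1 ->
  co (rotS i j s z) l = rotf i j s (co z) l.
Proof. by move=> ij s1; rewrite co_sproj1// sum_rotf// sum_co. Qed.

Lemma measurable_rotS i j s : i != j -> s ^+ 2 <= 1 ->
  measurable_fun setT (rotS i j s).
Proof.
move=> ij s1; apply: measurable_to_csphere => l.
under eq_fun do rewrite co_rotS// /rotf.
case: (l == i).
  by apply: measurable_funB; apply: measurable_funM => //; exact: measurable_co.
case: (l == j); last exact: measurable_co.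
by apply: measurable_funD; apply: measurable_funM => //; exact: measurable_co.
Qed.

Definition rott i j s (t : N.-tuple R) : N.-tuple R :=
  [tuple rotf i j s (tnth t) l | l < N].

Lemma sum_rott i j s (t : N.-tuple R) : i != j -> s ^+ 2 <= 1 ->
  \sum_l tnth (rott i j s t) l ^+ 2 = \sum_l tnth t l ^+ 2.
Proof.
move=> ij s1; rewrite -(sum_rotf (tnth t) ij s1); apply: eq_bigr => l _.
by rewrite tnth_mktuple.
Qed.

Lemma rotS_tsproj i j s (t : N.-tuple R) : i != j -> s ^+ 2 <= 1 ->
  \sum_l tnth t l ^+ 2 != 0 -> rotS i j s (tsproj t) = tsproj (rott i j s t).
Proof.
move=> ij s1 t0; apply: co_inj => l; rewrite [LHS](co_rotS _ _ ij s1).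
rewrite /tsproj [RHS]co_sproj; last by rewrite (sum_rott _ ij s1).
rewrite (sum_rott _ ij s1) tnth_mktuple /rotf.
by rewrite !(co_sproj _ t0); case: (l == i); [|case: (l == j)]; ring.
Qed.

(* A plane rotation is a product of three shears. *)
Lemma lebesgue_tuple_rott i j s (A : set (N.-tuple R)) :
  i != j -> s ^+ 2 <= 1 -> s != 0 -> measurable A ->
  lebesgue_tuple N (rott i j s @^-1` A) = lebesgue_tuple N A.
Proof.
move=> ij s1 s0 mA.
have := sqr_sqrtr (_ : 0 <= 1 - s ^+ 2); rewrite subr_ge0 => /(_ s1).
set c := Num.sqrt _ => c2.
(* Minus the tangent of half the angle: the rotation is a shear by [u], then by [s], then by [u]
   again. *)
pose u := (c - 1) / s.
pose S1 := shear i (fun l => if l == j then u else 0) 0.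
pose S2 := shear j (fun l => if l == i then s else 0) 0.
have sum1 (a : R) (l0 : 'I_N) (t : N.-tuple R) :
    \sum_l (if l == l0 then a else 0) * tnth t l = a * tnth t l0.
  rewrite (bigD1 l0) //= eqxx big1 ?addr0// => l /negPf ->.
  by rewrite mul0r.
have -> : rott i j s = S1 \o (S2 \o S1).
  apply/funext => t; apply: eq_from_tnth => l.
  rewrite !tnth_mktuple !sum1 !add0r !tnth_mktuple !sum1 !add0r !tnth_mktuple.
  rewrite /rotf -/c !sum1 !add0r !eqxx [j == i]eq_sym (negPf ij).
  case: (eqVneq l i) => [->|li].
    rewrite (negPf ij) mulrDr (mulrDr s).
    have us : u * s = c - 1 by rewrite /u divfK.
    have uc : u * (c + 1) = - s.
      apply: (mulIf s0); rewrite mulrAC us.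
      transitivity (c ^+ 2 - 1); first by ring.
      by rewrite c2; ring.
    transitivity (tnth t i + u * tnth t j + u * tnth t j + u * s * tnth t i
        + u * s * (u * tnth t j)); last by ring.
    transitivity (c * tnth t i + u * (c + 1) * tnth t j).
      by rewrite uc; ring.
    by rewrite us; ring.
  case: (eqVneq l j) => [->|lj //].
  have us : s * u = c - 1 by rewrite /u mulrC divfK.
  by rewrite mulrDr mulrA us; ring.
have m1 : measurable_fun setT S1 by exact: measurable_shear.
have m2 : measurable_fun setT S2 by exact: measurable_shear.
have mp (f : N.-tuple R -> N.-tuple R) B : measurable_fun setT f ->
    measurable B -> measurable (f @^-1` B).
  by move=> mf mB; rewrite -[X in measurable X]setTI; exact: mf.
have i1 B : measurable B -> lebesgue_tuple N (S1 @^-1` B) = lebesgue_tuple N B.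
  by move=> mB; apply: lebesgue_tuple_shear => //; rewrite (negPf ij).
have i2 B : measurable B -> lebesgue_tuple N (S2 @^-1` B) = lebesgue_tuple N B.
  by move=> mB; apply: lebesgue_tuple_shear => //; rewrite eq_sym (negPf ij).
rewrite !comp_preimage i1; last by apply: (mp) => //; exact: mp.
by rewrite i2 ?i1//; exact: mp.
Qed.

Lemma cone_measure_rotS i j s (A : set (csphere R n)) :
  i != j -> s ^+ 2 <= 1 -> s != 0 -> measurable A ->
  cone_measure (rotS i j s @^-1` A) = cone_measure A.
Proof.
move=> ij s1 s0 mA; rewrite !cone_measureE.
have mp (f : N.-tuple R -> csphere R n) B : measurable_fun setT f ->
    measurable B -> measurable (f @^-1` B).
  by move=> mf mB; rewrite -[X in measurable X]setTI; exact: mf.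
have mrA : measurable (rotS i j s @^-1` A).
  by rewrite -[X in measurable X]setTI; exact: measurable_rotS.
have mB := @measurable_unit_ball R n.
(* [Z] is the origin, a null set to be removed: there [tsproj] takes a dummy value, which does not
   commute with rotations. *)
pose Z := @box R N 0.
have mZ : measurable Z by exact: measurable_box.
have Z0 : lebesgue_tuple N Z = 0%E.
  by rewrite lebesgue_tuple_box// mul0rn expr0n.
have nZ t : ~ Z t -> \sum_l tnth t l ^+ 2 != 0.
  move=> nz; apply/negP; rewrite psumr_eq0; last by move=> *; exact: sqr_ge0.
  move=> /allP h; apply: nz => l /=; rewrite oppr0 in_itv /=.
  have := h l (mem_index_enum _); rewrite /= sqrf_eq0 => /eqP ->.
  by rewrite lexx.
have D (X : set (N.-tuple R)) : measurable X ->
    lebesgue_tuple N (X `\` Z) = lebesgue_tuple N X.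
  move=> mX; apply/eqP; rewrite eq_le; apply/andP; split.
    by apply: le_measure; rewrite ?inE; [exact: measurableD|exact: mX|exact: subDsetl].
  have := @measureU2 _ _ _ (@lebesgue_tuple R N) (X `\` Z) Z (measurableD mX mZ) mZ.
  rewrite [X in (_ + X)%E](_ : _ = 0%E); last exact: Z0.
  rewrite adde0; apply: le_trans.
  apply: le_measure; rewrite ?inE; first exact: mX.
    by apply: measurableU => //; exact: measurableD.
  by move=> t Xt; case: (pselect (Z t)) => ?; [right|left].
have m1 : measurable (tsproj @^-1` (rotS i j s @^-1` A) `&` unit_ball).
  exact: (measurableI _ _ (mp _ _ measurable_tsproj mrA) mB).
have m2 : measurable (tsproj @^-1` A `&` unit_ball).
  exact: (measurableI _ _ (mp _ _ measurable_tsproj mA) mB).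
pose L : set (N.-tuple R) -> \bar R := lebesgue_tuple N.
have RI X : measurable X -> L (rott i j s @^-1` X) = L X.
  exact: lebesgue_tuple_rott.
pose B1 := tsproj @^-1` (rotS i j s @^-1` A) `&` unit_ball.
pose B2 := tsproj @^-1` A `&` unit_ball.
suff E : B1 `\` Z = rott i j s @^-1` (B2 `\` Z).
  refine (etrans (esym (D B1 m1)) (etrans (congr1 L E) _)).
  exact: (etrans (RI (B2 `\` Z) (measurableD m2 mZ)) (D B2 m2)).
have sr t := sum_rott t ij s1.
have Zr t : Z t <-> Z (rott i j s t).
  have ZE t' : Z t' <-> \sum_l tnth t' l ^+ 2 = 0.
    split=> [h|/eqP h]; last by apply: contrapT => /nZ; rewrite h.
    apply: big1 => l _; have := h l; rewrite /= oppr0 in_itv /= => /le_anti <-.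
    by rewrite expr0n.
  by rewrite !ZE sr.
have Br t : unit_ball t <-> unit_ball (rott i j s t).
  by rewrite /unit_ball /= !cnorm_cvec sr.
have Cr t : ~ Z t -> rotS i j s (tsproj t) = tsproj (rott i j s t).
  by move=> /nZ; exact: rotS_tsproj.
apply/seteqP; split => t [[h1 h2] h3].
  split; last by move=> /(proj2 (Zr t)).
  split; last exact: (proj1 (Br t) h2).
  by have := h1; rewrite /preimage /mkset (Cr t h3).
have h3' : ~ Z t by move=> /(proj1 (Zr t)).
split; last exact: h3'.
split; last exact: (proj2 (Br t) h2).
by rewrite /preimage /mkset (Cr t h3').
Qed.

Lemma sphere_measure_rotS i j s (A : set (csphere R n)) :
  i != j -> s ^+ 2 <= 1 -> s != 0 -> measurable A ->
  sphere_measure (rotS i j s @^-1` A) = sphere_measure A.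
Proof. by move=> *; rewrite !sphere_measureE cone_measure_rotS. Qed.

End coordinates.

(** * Laplacian of spherical polynomials *)

Section directional_chain_rule.
Context {R : realType} {V : normedModType R}.

Lemma derive_line (f : V -> R) x v :
  'D_v f x = 'D_1 (fun h : R => f (h *: v + x)) 0.
Proof.
rewrite /derive; set g1 := fun h => h^-1 *: _; set g2 := fun h => h^-1 *: _.
suff -> : g1 = g2 by [].
by rewrite funeqE /g1 /g2 => h /=; rewrite addr0 scale0r add0r [_%:A]mulr1.
Qed.

(** Only the derivative of [f] along [v] is known, so the one-variable chain rule is applied on the
    line through [x]. *)
Lemma is_derive_comp1 (f : V -> R) (g : R -> R) x v df dg :
  is_derive x v f df -> is_derive (f x) 1 g dg ->
  is_derive x v (g \o f) (dg * df).
Proof.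
move=> [fd fE] [gd gE].
have /derivable1P fd' := fd.
pose F (h : R) := f (h *: v + x).
have f0 : F 0 = f x by rewrite /F scale0r add0r.
have gd' : derivable g (F 0) 1 := eq_ind_r (fun y => derivable g y 1) gd f0.
have dF := proj1 (derivable1_diffP F 0) fd'.
have dg' := proj1 (derivable1_diffP g (F 0)) gd'.
split.
  by apply/derivable1P/derivable1_diffP; exact: (differentiable_comp dF dg').
rewrite derive_line -derive1E.
transitivity (g^`()%classic (F 0) * F^`()%classic 0); first exact: (derive1_comp fd' gd').
by rewrite f0 !derive1E gE -fE [in RHS]derive_line.
Qed.

End directional_chain_rule.

(** * Functions generated by the coordinates and 1/|x|, off the origin *)

Section radial_algebra.
Context {R : realType} {N : nat}.
Local Notation E := 'rV[R]_N.
Implicit Types (F G : E -> R) (x : E) (i l : 'I_N).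

Definition sqn x : R := \sum_l x 0 l ^+ 2.

(** The reciprocal of the Euclidean norm, written as a real power so that the power rule applies. *)
Definition rho x : R := sqn x `^ (- 2^-1).

Lemma sqn_ge0 x : 0 <= sqn x.
Proof. by apply: sumr_ge0 => l _; exact: sqr_ge0. Qed.

Lemma sqn_gt0 x : x != 0 -> 0 < sqn x.
Proof.
move=> x0; rewrite lt_neqAle sqn_ge0 andbT eq_sym; apply: contra x0.
rewrite /sqn psumr_eq0 => [/allP h|l _]; last exact: sqr_ge0.
apply/eqP/rowP => l; rewrite mxE; apply/eqP.
by have := h l (mem_index_enum _); rewrite /= sqrf_eq0.
Qed.

Lemma rho_sqrt x : rho x = (Num.sqrt (sqn x))^-1.
Proof. by rewrite /rho powRN powR12_sqrt// sqn_ge0. Qed.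

Definition der i F G := forall x, x != 0 -> is_derive x (delta_mx 0 i : E) F (G x).

Lemma der_cst i (c : R) : der i (fun=> c) (fun=> 0).
Proof. by move=> x _; exact: is_derive_cst. Qed.

Lemma derD i F G F' G' : der i F F' -> der i G G' ->
  der i (fun x => F x + G x) (fun x => F' x + G' x).
Proof. by move=> dF dG x x0; apply: is_deriveD; [exact: dF|exact: dG]. Qed.

Lemma derM i F G F' G' : der i F F' -> der i G G' ->
  der i (fun x => F x * G x) (fun x => F' x * G x + F x * G' x).
Proof.
move=> dF dG x x0; have := is_deriveM (dF x x0) (dG x x0).
move=> h; apply: is_derive_eq h _ => /=.
by rewrite /GRing.scale /= addrC mulrC.
Qed.

Lemma der_eq i F G G' : der i F G -> (forall x, x != 0 -> G x = G' x) -> der i F G'.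
Proof. by move=> dF e x x0; rewrite -e//; exact: dF. Qed.

Lemma der_coord i l : der i (fun x => x 0 l) (fun=> (l == i)%:R).
Proof.
move=> x _; apply/(@is_derive_eq _ _ _ _ _ _ _ ((delta_mx 0 i : E) 0 l)); last first.
  by rewrite mxE eqxx eq_sym.
have e : (fun h : R => h^-1 *: (((fun x : E => x 0 l) \o shift x) (h *: (delta_mx 0 i : E)) - x 0 l))
   @ 0^' --> (delta_mx 0 i : E) 0 l.
  apply: cvg_near_cst; near=> h.
  have h0 : h != 0 by near: h; exact: nbhs_dnbhs_neq.
  by rewrite /= !mxE addrK /GRing.scale /= mulrA mulVf// mul1r.
split; first by apply/cvg_ex; eexists; exact: e.
by apply: cvg_lim.
Unshelve. all: by end_near. Qed.

Lemma der_sum i (I : Type) (r : seq I) (F G : I -> E -> R) :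
  (forall k, der i (F k) (G k)) ->
  der i (fun x => \sum_(k <- r) F k x) (fun x => \sum_(k <- r) G k x).
Proof.
move=> dF; elim: r => [|k r IH].
  rewrite [X in der i X](_ : _ = fun=> 0); last by apply/funext => x; rewrite big_nil.
  by apply: der_eq (der_cst _ _) _ => x _; rewrite big_nil.
rewrite [X in der i X](_ : _ = fun x => F k x + \sum_(k <- r) F k x); last first.
  by apply/funext => x; rewrite big_cons.
by apply: der_eq (derD (dF k) IH) _ => x _; rewrite big_cons.
Qed.

Lemma derX i F G m : der i F G ->
  der i (fun x => F x ^+ m) (fun x => m%:R * F x ^+ m.-1 * G x).
Proof.
move=> dF; elim: m => [|m IH].
  rewrite [X in der i X](_ : _ = fun=> 1); last by apply/funext => x; rewrite expr0.
  by apply: der_eq (der_cst _ _) _ => x _; rewrite !mul0r.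
rewrite [X in der i X](_ : _ = fun x => F x * F x ^+ m); last first.
  by apply/funext => x; rewrite exprS.
apply: der_eq (derM dF IH) _ => x _ /=.
case: m {IH} => [|m] /=; first by rewrite expr0; ring.
by rewrite !exprS -natr1; ring.
Qed.

Lemma der_sqn i : der i sqn (fun x => 2 * x 0 i).
Proof.
have h l := derX 2 (der_coord i l).
apply: der_eq (der_sum (index_enum _) h) _ => x _ /=.
rewrite (bigD1 i) //= eqxx big1 ?addr0 ?mulr1 ?expr1// => l /negPf ->.
by rewrite mulr0.
Qed.

Lemma der_rho i : der i rho (fun x => - x 0 i * rho x ^+ 3).
Proof.
move=> x x0; have s0 := sqn_gt0 x0.
have := is_derive_comp1 (der_sqn i x0) (is_derive1_powR (- 2^-1) s0).
move=> h; apply: is_derive_eq h _.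
have e : sqn x `^ (- 2^-1 - 1) = rho x ^+ 3.
  rewrite /rho -powR_mulrn ?powR_ge0// -powRrM; congr (_ `^ _).
  by field.
by rewrite e; field.
Qed.

(** This class is closed under partial derivatives because the derivative of [rho] in x_i is - x_i
    rho^3; its members are therefore smooth off the origin. It contains the homogeneous extensions
    of polynomials on the sphere, and [radial_ext] disregards the value at the origin. *)
Inductive radial : (E -> R) -> Prop :=
| radial_cst c : radial (fun=> c)
| radial_coord l : radial (fun x => x 0 l)
| radial_rho : radial rho
| radialD F G : radial F -> radial G -> radial (fun x => F x + G x)
| radialM F G : radial F -> radial G -> radial (fun x => F x * G x)
| radial_ext F G : (forall x, x != 0 -> F x = G x) -> radial F -> radial G.

Lemma near_neq0 x : x != 0 -> \near x, x != 0.
Proof. by move=> x0; exact: (@cvgr_neq0 _ _ _ (nbhs x) _ id x cvg_id x0). Qed.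

Lemma radial_der F i : radial F -> exists2 G, radial G & der i F G.
Proof.
elim => {F} [c|l||F G _ [F' rF dF] _ [G' rG dG]|F G rF0 [F' rF dF] rG0 [G' rG dG]|F G e _ [F' rF dF]].
- by exists (fun=> 0); [exact: radial_cst|exact: der_cst].
- by exists (fun=> (l == i)%:R); [exact: radial_cst|exact: der_coord].
- exists (fun x => - x 0 i * rho x ^+ 3); last exact: der_rho.
  apply: radialM.
    apply: (@radial_ext (fun x => (-1) * x 0 i)) => [x _|]; first by rewrite mulN1r.
    by apply: radialM; [exact: radial_cst|exact: radial_coord].
  apply: (@radial_ext (fun x => rho x * (rho x * rho x))) => [x _|]; first by rewrite !exprS expr0 mulr1.
  by do 2 (apply: radialM; first exact: radial_rho); exact: radial_rho.
- by eexists; last exact: (derD dF dG); exact: radialD.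
- eexists; last exact: (derM dF dG).
  by apply: radialD; exact: radialM.
- exists F' => // x x0; apply: near_eq_is_derive (dF x x0).
  by near=> y; apply: e; near: y; exact: near_neq0.
Unshelve. all: by end_near. Qed.

Lemma continuous_sqn : continuous sqn.
Proof.
move=> x; rewrite /sqn; elim: (index_enum _) => [|l r IH].
  by under [X in continuous_at _ X]eq_fun do rewrite big_nil; exact: cst_continuous.
under [X in continuous_at _ X]eq_fun do rewrite big_cons expr2.
have cl : {for x, continuous (fun y : E => y 0 l)} by exact: coord_continuous.
exact: (cvgD (cvgM cl cl) IH).
Qed.

Lemma radial_continuous F x : radial F -> x != 0 -> {for x, continuous F}.
Proof.
move=> rF; elim: rF x => {F} [c|l||F G _ cF _ cG|F G _ cF _ cG|F G e _ cF] x x0.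
- exact: cst_continuous.
- exact: coord_continuous.
- rewrite (_ : rho = (@powR R ^~ (- 2^-1)) \o sqn)//.
  apply: continuous_comp; first exact: continuous_sqn.
  apply/differentiable_continuous/derivable1_diffP.
  by apply: ex_derive; apply: is_derive1_powR; exact: sqn_gt0.
- by apply: continuousD; [exact: cF|exact: cG].
- by apply: continuousM; [exact: cF|exact: cG].
- have Fx : F y @[y --> x] --> G x by rewrite -e//; exact: cF.
  have h : \forall y \near nbhs x, F y = G y.
    by near=> y; apply: e; near: y; exact: near_neq0.
  exact: cvg_trans (near_eq_cvg h) Fx.
Unshelve. all: by end_near. Qed.

Lemma radial_is_Ck F k : radial F -> is_Ck k [set x : E | x != 0] F.
Proof.
elim: k F => [|k IH] F rF; (split; first by move=> x /= x0; exact: radial_continuous) => //.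
move=> i; have [G rG dG] := radial_der i rF; split=> [x /= x0|].
  exact: (@ex_derive _ _ _ _ _ _ _ (dG x x0)).
apply: IH; apply: radial_ext rG => x x0.
by rewrite (@derive_val _ _ _ _ _ _ _ (dG x x0)).
Qed.

Lemma der_derive i F G x : der i F G -> x != 0 -> 'D_(delta_mx 0 i) F x = G x.
Proof. by move=> dF x0; rewrite (@derive_val _ _ _ _ _ _ _ (dF x x0)). Qed.

Lemma near_derive i F G x : (forall y, y != 0 -> F y = G y) -> x != 0 ->
  'D_(delta_mx 0 i) F x = 'D_(delta_mx 0 i) G x.
Proof.
move=> e x0; apply: near_eq_derive; near=> y; apply: e; near: y.
exact: near_neq0.
Unshelve. all: by end_near. Qed.

Lemma der_derive2 i F G H x : der i F G -> der i G H -> x != 0 ->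
  'D_(delta_mx 0 i) (fun y => 'D_(delta_mx 0 i) F y) x = H x.
Proof.
move=> dF dG x0; rewrite (near_derive i (_ : forall y, y != 0 -> _ = G y))//.
  exact: der_derive.
by move=> y y0; exact: der_derive.
Qed.

Lemma laplacian_lin (a b : R) F G x : radial F -> radial G -> x != 0 ->
  laplacian (fun x => a * F x + b * G x) x = a * laplacian F x + b * laplacian G x.
Proof.
move=> rF rG x0; rewrite /laplacian !mulr_sumr -big_split /=.
apply: eq_bigr => i _.
have [F1 rF1 dF1] := radial_der i rF; have [F2 _ dF2] := radial_der i rF1.
have [G1 rG1 dG1] := radial_der i rG; have [G2 _ dG2] := radial_der i rG1.
have L H H' H1 H1' : der i H H1 -> der i H' H1' ->
    der i (fun x => a * H x + b * H' x) (fun x => a * H1 x + b * H1' x).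
  move=> d1 d2.
  apply: der_eq (derD (derM (der_cst i a) d1) (derM (der_cst i b) d2)) _ => y _.
  by rewrite !mul0r !add0r.
rewrite (der_derive2 dF1 dF2 x0) (der_derive2 dG1 dG2 x0).
by rewrite (der_derive2 (L _ _ _ _ dF1 dG1) (L _ _ _ _ dF2 dG2) x0).
Qed.

End radial_algebra.

(** * The Laplacian of monomials by homogeneous extension *)

Section monomials.
Context {R : realType} {n : nat}.
Local Notation N := (n.+1 + n.+1)%N.
Local Notation E := 'rV[R]_N.
Local Notation S := (csphere R n).
Implicit Types (mu : 'I_N -> nat) (z : S) (x : E).

Definition hext (u : S -> R) x : R := u (sproj (cvec (x 0))).

Definition mon mu z : R := \prod_l co z l ^+ mu l.

Definition mdeg mu : nat := (\sum_l mu l)%N.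

(** Where [mu i < 2] the truncated subtraction is harmless: the accompanying coefficient
    [mu i * (mu i).-1] is 0. *)
Definition msub2 mu (i : 'I_N) : 'I_N -> nat :=
  fun l => if l == i then (mu l - 2)%N else mu l.

Lemma hext_mon mu x : x != 0 ->
  hext (mon mu) x = \prod_l x 0 l ^+ mu l * rho x ^+ mdeg mu.
Proof.
move=> x0; rewrite /hext /mon /mdeg -prodrXr mulrC -big_split /=.
apply: eq_bigr => l _; rewrite co_sproj; last by rewrite gt_eqF// sqn_gt0.
by rewrite -rho_sqrt exprMn.
Qed.

Lemma radial_prod (I : Type) (r : seq I) (P : pred I) (F : I -> E -> R) :
  (forall i, P i -> radial (F i)) -> radial (fun x => \prod_(i <- r | P i) F i x).
Proof.
move=> rF; elim: r => [|i r IH].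
  by apply: (@radial_ext _ _ (fun=> 1)) => [x _|]; [rewrite big_nil|exact: radial_cst].
have [Pi|nPi] := boolP (P i).
  apply: (@radial_ext _ _ (fun x => F i x * \prod_(i <- r | P i) F i x)) => [x _|].
    by rewrite big_cons Pi.
  by apply: radialM => //; exact: rF.
by apply: radial_ext IH => x _; rewrite big_cons (negPf nPi).
Qed.

Lemma radialX F m : @radial R N F -> radial (fun x => F x ^+ m).
Proof.
move=> rF; elim: m => [|m IH].
  by apply: (@radial_ext _ _ (fun=> 1)) => [x _|]; [rewrite expr0|exact: radial_cst].
apply: (@radial_ext _ _ (fun x => F x * F x ^+ m)) => [x _|]; first by rewrite exprS.
exact: radialM.
Qed.

Lemma radial_mon mu : radial (hext (mon mu)).
Proof.
apply: (@radial_ext _ _ (fun x => \prod_l x 0 l ^+ mu l * rho x ^+ mdeg mu)).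
  by move=> x x0; rewrite hext_mon.
apply: radialM; last exact/radialX/radial_rho.
by apply: radial_prod => l _; exact/radialX/radial_coord.
Qed.

Lemma der_prod0 i (I : Type) (r : seq I) (P : pred I) (F : I -> E -> R) :
  (forall k, P k -> der i (F k) (fun=> 0)) ->
  der i (fun x => \prod_(k <- r | P k) F k x) (fun=> 0).
Proof.
move=> dF; elim: r => [|k r IH].
  rewrite [X in der i X](_ : _ = fun=> 1); last by apply/funext => x; rewrite big_nil.
  exact: der_cst.
have [Pk|nPk] := boolP (P k).
  rewrite [X in der i X](_ : _ = fun x => F k x * \prod_(k <- r | P k) F k x).
    by apply: der_eq (derM (dF _ Pk) IH) _ => x _; rewrite mul0r mulr0 addr0.
  by apply/funext => x; rewrite big_cons Pk.
rewrite [X in der i X](_ : _ = fun x => \prod_(k <- r | P k) F k x)//.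
by apply/funext => x; rewrite big_cons (negPf nPk).
Qed.

(** The only factor of [hext (mon mu)] that varies with x_i, so that its second derivatives are
    governed by two exponents. *)
Definition xrho (i : 'I_N) p m x : R := x 0 i ^+ p * rho x ^+ m.
Local Notation T := xrho.

Lemma der_T i p m : der i (T i p m)
  (fun x => p%:R * T i p.-1 m x - m%:R * T i p.+1 m.+2 x).
Proof.
have := derM (derX p (der_coord i i)) (derX m (@der_rho R N i)).
rewrite eqxx => h; apply: der_eq h _ => x _; rewrite /xrho mulr1.
case: m => [|m] /=; first by rewrite !mul0r mulr0 addr0 subr0 mulrA.
by rewrite !exprS; ring.
Qed.

Lemma der2_T i p m : exists G, der i (T i p m) G /\ der i G (fun x =>
  (p * p.-1)%:R * T i (p - 2) m x - (m * p.*2.+1)%:R * T i p m.+2 x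
  + (m * m.+2)%:R * T i p.+2 m.+4 x).
Proof.
eexists; split; first exact: der_T.
have h := derD (derM (der_cst i p%:R) (der_T i p.-1 m))
   (derM (der_cst i (- m%:R)) (der_T i p.+1 m.+2)).
rewrite [X in der i X](_ : _ = fun x =>
    p%:R * T i p.-1 m x + - m%:R * T i p.+1 m.+2 x); last first.
  by apply/funext => x; rewrite mulNr.
apply: der_eq h _ => x _ /=; rewrite !mul0r !add0r -!natr1.
have -> : p.-1.-1 = (p - 2)%N by rewrite -subn1 -subn1 -subnDA.
rewrite -addnn !natrM -!natr1 natrD.
have pE : p%:R * T i p.-1.+1 m.+2 x = p%:R * T i p m.+2 x.
  by case: (p) => [|q]; rewrite ?mul0r.
rewrite mulrBr [p%:R * (m%:R * _)]mulrCA pE.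
by ring.
Qed.

Lemma rvec_co z l : (rvec (cval z) : E) 0 l = co z l.
Proof. by []. Qed.

Lemma sqn_rvec z : sqn (rvec (cval z) : E) = 1.
Proof. by rewrite -(sum_co z). Qed.

Lemma rvec_neq0 z : (rvec (cval z) : E) != 0.
Proof.
apply/eqP => e; have := sqn_rvec z; rewrite e /sqn big1.
  by move/eqP; rewrite eq_sym oner_eq0.
by move=> l _; rewrite mxE expr0n.
Qed.

Lemma rho_rvec z : rho (rvec (cval z) : E) = 1.
Proof. by rewrite rho_sqrt sqn_rvec sqrtr1 invr1. Qed.

(** The classical formula: on the sphere of R^N, the nonnegative Laplacian of a homogeneous P of
    degree m is m(m + N - 2) P minus the Euclidean Laplacian of P, and the eigenvalue theta_m is m(m
    + N - 2). *)
Definition lb_mon mu z : R :=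
  theta (2 * n.+1 - 1) (mdeg mu) * mon mu z
  - \sum_i (mu i * (mu i).-1)%:R * mon (msub2 mu i) z.

Lemma mon_split mu i z : mon mu z =
  co z i ^+ mu i * \prod_(l | l != i) co z l ^+ mu l.
Proof. by rewrite /mon (bigD1 i). Qed.

Lemma mon_msub2 mu i z : mon (msub2 mu i) z =
  co z i ^+ (mu i - 2) * \prod_(l | l != i) co z l ^+ mu l.
Proof.
rewrite (mon_split _ i) /msub2 eqxx; congr (_ * _).
by apply: eq_bigr => l /negPf ->.
Qed.

(** At a unit vector [rho] is 1 and the squared coordinates sum to 1, so the second derivatives add
    up to the Euclidean Laplacian of the monomial, minus m(2m + N) times and plus m(m + 2) times the
    monomial. *)
Lemma laplacian_mon mu z : - laplacian (hext (mon mu)) (rvec (cval z)) = lb_mon mu z.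
Proof.
set m := mdeg mu; set x : E := rvec (cval z).
have x0 : x != 0 := rvec_neq0 z.
have step i : 'D_(delta_mx 0 i) (fun y => 'D_(delta_mx 0 i) (hext (mon mu)) y) x =
    (mu i * (mu i).-1)%:R * mon (msub2 mu i) z
    - (m * (mu i).*2.+1)%:R * mon mu z + (m * m.+2)%:R * (co z i ^+ 2 * mon mu z).
  have [G [dT dG]] := der2_T i (mu i) m.
  pose M' y := \prod_(l | l != i) (y : E) 0 l ^+ mu l.
  have dM' : der i M' (fun=> 0).
    apply: der_prod0 => l /negPf li; apply: der_eq (derX _ (der_coord i l)) _ => y _.
    by rewrite li mulr0.
  have e y : y != 0 -> T i (mu i) m y * M' y = hext (mon mu) y.
    by move=> y0; rewrite hext_mon// (bigD1 i) //= /xrho mulrAC.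
  have d1 : der i (hext (mon mu)) (fun y => G y * M' y).
    move=> y y0; apply: (@near_eq_is_derive _ _ _ (fun y => T i (mu i) m y * M' y)).
      by near=> w; apply: e; near: w; exact: near_neq0.
    have := derM dT dM' y0; rewrite mulr0 addr0; exact.
  have d2 : der i (fun y => G y * M' y) (fun y =>
      ((mu i * (mu i).-1)%:R * T i (mu i - 2) m y
      - (m * (mu i).*2.+1)%:R * T i (mu i) m.+2 y
      + (m * m.+2)%:R * T i (mu i).+2 m.+4 y) * M' y).
    by apply: der_eq (derM dG dM') _ => y _; rewrite mulr0 addr0.
  rewrite (der_derive2 d1 d2 x0) /xrho rho_rvec !expr1n !mulr1.
  rewrite mon_msub2 (mon_split mu i) -!rvec_co -/x -/(M' x) !exprS expr0.
  by ring.
have sB : \sum_i (m * (mu i).*2.+1)%:R * mon mu z = (m * (m + m + N))%:R * mon mu z.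
  rewrite -mulr_suml -natr_sum -big_distrr /=; congr (_ %:R * _).
  congr (_ * _)%N.
  under eq_bigr do rewrite -addn1 -addnn.
  by rewrite !big_split /= sum_nat_const card_ord muln1.
have sC : \sum_i (m * m.+2)%:R * (co z i ^+ 2 * mon mu z) = (m * m.+2)%:R * mon mu z.
  by rewrite -mulr_sumr -mulr_suml sum_co mul1r.
rewrite /laplacian (eq_bigr _ (fun i _ => step i)) big_split /= sC.
rewrite big_split /= sumrN sB /lb_mon /theta -/m.
have -> : (m * (m + (2 * n.+1 - 1) - 1))%N = (m * (m + n + n))%N.
  congr (_ * _)%N; rewrite mul2n -addnn; lia.
have -> : (m * (m + m + N))%:R = m%:R * (m%:R + m%:R + (n%:R + n%:R + 2)) :> R.
  by rewrite -[n.+1]addn1 !natrM !natrD; ring.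
rewrite -[m.+2]addn2 !natrM !natrD; set X := (X in - (X - _ + _)).
set Y := (Y in _ = _ - Y); rewrite (_ : X = Y)//.
by ring.
Unshelve. all: by end_near. Qed.

End monomials.

(** * Uniform Taylor expansions in the sine of the rotation angle *)

Section rotation_expansion.
Context {R : realType} {n : nat}.
Local Notation N := (n.+1 + n.+1)%N.
Local Notation S := (csphere R n).

Definition ubdd (h : S -> R -> R) : Prop :=
  exists C, forall z s, 0 < s <= 1 -> `|h z s| <= C.

Lemma ubdd_cst c : ubdd (fun _ _ => c).
Proof. by exists `|c|. Qed.

Lemma ubdd_co l : ubdd (fun z _ => co z l).
Proof. by exists 1 => z _ _; exact: norm_co_le1. Qed.

Lemma ubdd_s : ubdd (fun _ s => s).
Proof. by exists 1 => _ s /andP[/ltW s0 s1]; rewrite ger0_norm. Qed.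

Lemma ubddD g h : ubdd g -> ubdd h -> ubdd (fun z s => g z s + h z s).
Proof.
move=> [C gC] [D hD]; exists (C + D) => z s s01.
by rewrite (le_trans (ler_normD _ _))// lerD// ?gC ?hD.
Qed.

Lemma ubddM g h : ubdd g -> ubdd h -> ubdd (fun z s => g z s * h z s).
Proof.
move=> [C gC] [D hD]; exists (C * D) => z s s01.
by rewrite normrM ler_pM// ?gC ?hD.
Qed.

Lemma ubddN g : ubdd g -> ubdd (fun z s => - g z s).
Proof. by move=> [C gC]; exists C => z s s01; rewrite normrN gC. Qed.

Lemma ubddX g m : ubdd g -> ubdd (fun z s => g z s ^+ m).
Proof.
move=> [C gC]; exists (C ^+ m) => z s s01.
have := gC z s s01 => h; rewrite normrX lerXn2r// ?nnegrE//.
exact: le_trans h.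
Qed.

Lemma ubdd_prod (I : Type) (r : seq I) (P : pred I) (g : I -> S -> R -> R) :
  (forall i, P i -> ubdd (g i)) -> ubdd (fun z s => \prod_(i <- r | P i) g i z s).
Proof.
move=> bg; elim: r => [|i r [C IH]]; first by exists 1 => z s _; rewrite big_nil normr1.
have [Pi|nPi] := boolP (P i).
  have [D gD] := bg i Pi; exists (D * C) => z s s01; rewrite big_cons Pi.
  by rewrite normrM ler_pM// ?gD ?IH.
by exists C => z s s01; rewrite big_cons (negPf nPi) IH.
Qed.

(** Uniform on the sphere, with no condition on the remainder beyond boundedness: such expansions
    are stable under sums and products, so those of monomials come from those of coordinates without
    differentiation in [s]. *)
Definition taylor2 (f : S -> R -> R) (f0 f1 f2 : S -> R) : Prop :=
  [/\ ubdd (fun z _ => f0 z), ubdd (fun z _ => f1 z), ubdd (fun z _ => f2 z) &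
   exists2 r, ubdd r & forall z s, 0 < s <= 1 ->
     f z s = f0 z + s * f1 z + s ^+ 2 * f2 z + s ^+ 3 * r z s].

Lemma taylor2_eq f g f0 f1 f2 g0 g1 g2 : taylor2 f f0 f1 f2 ->
  (forall z s, 0 < s <= 1 -> f z s = g z s) ->
  f0 =1 g0 -> f1 =1 g1 -> f2 =1 g2 -> taylor2 g g0 g1 g2.
Proof.
move=> h e /funext e0 /funext e1 /funext e2; subst g0 g1 g2.
have [b0 b1 b2 [r br hr]] := h; split => //; exists r => // z s s01.
by rewrite -e// hr.
Qed.

Lemma taylor2_cst f0 : ubdd (fun z _ => f0 z) ->
  taylor2 (fun z _ => f0 z) f0 (fun=> 0) (fun=> 0).
Proof.
move=> b; split => //; try exact: ubdd_cst.
by exists (fun _ _ => 0); [exact: ubdd_cst|move=> z s _; rewrite !mulr0 !addr0].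
Qed.

Lemma taylor2D f g f0 f1 f2 g0 g1 g2 : taylor2 f f0 f1 f2 -> taylor2 g g0 g1 g2 ->
  taylor2 (fun z s => f z s + g z s) (fun z => f0 z + g0 z)
    (fun z => f1 z + g1 z) (fun z => f2 z + g2 z).
Proof.
move=> [a0 a1 a2 [r br hr]] [b0 b1 b2 [q bq hq]]; split; try exact: ubddD.
exists (fun z s => r z s + q z s); first exact: ubddD.
by move=> z s s01; rewrite hr// hq//; ring.
Qed.

Lemma taylor2M f g f0 f1 f2 g0 g1 g2 : taylor2 f f0 f1 f2 -> taylor2 g g0 g1 g2 ->
  taylor2 (fun z s => f z s * g z s) (fun z => f0 z * g0 z)
    (fun z => f0 z * g1 z + f1 z * g0 z)
    (fun z => f0 z * g2 z + f1 z * g1 z + f2 z * g0 z).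
Proof.
move=> [a0 a1 a2 [r br hr]] [b0 b1 b2 [q bq hq]].
have bs := ubdd_s; have bs2 := ubddX 2 bs; have bs3 := ubddX 3 bs.
split; try by do ?[exact: ubddM|apply: ubddD].
exists (fun z s => (f1 z * g2 z + f2 z * g1 z) + s * (f2 z * g2 z)
   + ((f0 z + s * f1 z) + s ^+ 2 * f2 z) * q z s
   + ((g0 z + s * g1 z) + s ^+ 2 * g2 z) * r z s + s ^+ 3 * (r z s * q z s)).
  do !apply: ubddD; do ?[exact: ubddM|apply: ubddM; do ?exact: ubddM; do ?apply: ubddD; do ?exact: ubddM] => //.
by move=> z s s01; rewrite hr// hq//; ring.
Qed.

Lemma taylor2_sum (I : Type) (r : seq I) (P : pred I)
    (f : I -> S -> R -> R) (f0 f1 f2 : I -> S -> R) :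
  (forall i, P i -> taylor2 (f i) (f0 i) (f1 i) (f2 i)) ->
  taylor2 (fun z s => \sum_(i <- r | P i) f i z s)
    (fun z => \sum_(i <- r | P i) f0 i z)
    (fun z => \sum_(i <- r | P i) f1 i z) (fun z => \sum_(i <- r | P i) f2 i z).
Proof.
move=> tf; elim: r => [|i r IH].
  apply: taylor2_eq (taylor2_cst (ubdd_cst 0)) _ _ _ _ => z *; by rewrite big_nil.
have [Pi|nPi] := boolP (P i).
  by apply: taylor2_eq (taylor2D (tf i Pi) IH) _ _ _ _ => z *; rewrite big_cons Pi.
by apply: taylor2_eq IH _ _ _ _ => z *; rewrite big_cons (negPf nPi).
Qed.

Lemma taylor2X f f0 f1 f2 m : taylor2 f f0 f1 f2 ->
  taylor2 (fun z s => f z s ^+ m) (fun z => f0 z ^+ m)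
    (fun z => m%:R * f0 z ^+ m.-1 * f1 z)
    (fun z => m%:R * f0 z ^+ m.-1 * f2 z
       + (m * m.-1)%:R / 2 * f0 z ^+ (m - 2) * f1 z ^+ 2).
Proof.
move=> tf; elim: m => [|m IH].
  apply: taylor2_eq (taylor2_cst (ubdd_cst 1)) _ _ _ _ => z *; rewrite ?expr0//.
    by rewrite !mul0r.
  by rewrite !mul0r addr0.
apply: taylor2_eq (taylor2M tf IH) _ _ _ _ => z *; rewrite ?exprS//=.
  case: m {IH} => [|m] /=; first by rewrite expr0; ring.
  by rewrite exprS -!natr1; ring.
case: m {IH} => [|[|m]] /=; rewrite ?expr0 ?expr1; try by field.
by rewrite !subSS !subn0 !exprS !natrM -!natr1; field.
Qed.

Lemma sqrt_taylor s : 0 < s <= 1 -> exists2 r : R, `|r| <= 2^-1 &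
  Num.sqrt (1 - s ^+ 2) = 1 - s ^+ 2 / 2 + s ^+ 3 * r.
Proof.
move=> /andP[s0 s1]; have s21 : 0 <= 1 - s ^+ 2 by rewrite subr_ge0 exprn_ile1// ltW.
have := sqr_sqrtr s21; have : 0 <= Num.sqrt (1 - s ^+ 2) := sqrtr_ge0 _.
set c := Num.sqrt _ => c0 c2.
have c1 : 0 < 1 + c by lra.
(* From c^2 = 1 - s^2 follow c = 1 - s^2/2 - (1 - c)^2/2 and 1 - c = s^2/(1 + c). The error is thus
   of order s^4, and one factor [s] goes into the remainder. *)
exists (- s / (2 * (1 + c) ^+ 2)).
  rewrite normrM normrN (ger0_norm (ltW s0)) ger0_norm; last first.
    by rewrite invr_ge0 mulr_ge0// exprn_ge0// ltW.
  rewrite ler_pdivrMr; last by rewrite mulr_gt0// exprn_gt0.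
  rewrite mulrA mulVf// mul1r (le_trans s1)// -[leLHS](expr1n _ 2).
  by rewrite lerXn2r// ?nnegrE//; lra.
have e : 1 - c = s ^+ 2 / (1 + c).
  apply: (mulIf (lt0r_neq0 c1)); rewrite divfK ?gt_eqF//.
  have -> : (1 - c) * (1 + c) = 1 - c ^+ 2 by ring.
  by rewrite c2; ring.
have -> : s ^+ 3 * (- s / (2 * (1 + c) ^+ 2)) = - (s ^+ 2 / (1 + c)) ^+ 2 / 2.
  by field; rewrite gt_eqF.
rewrite -e; have -> : s ^+ 2 = 1 - c ^+ 2 by rewrite c2; ring.
by field.
Qed.

End rotation_expansion.

(** * Sums of rotations and the Laplacian on monomials *)

Section eigenfunctions.
Context {R : realType} {n : nat}.
Local Notation N := (n.+1 + n.+1)%N.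
Local Notation S := (csphere R n).
Local Notation th := (theta (2 * n.+1 - 1) : nat -> R).
Implicit Types (mu : 'I_N -> nat) (z : S) (u w : S -> R).

Lemma taylor2_rot_i (i j : 'I_N) : i != j ->
  taylor2 (fun z s => co (rotS i j s z) i) (fun z => co z i)
    (fun z => - co z j) (fun z => - co z i / 2).
Proof.
move=> ij; have bi := @ubdd_co R n i; have bj := @ubdd_co R n j.
split => //; first exact: ubddN.
  by apply: ubddM; [exact: ubddN|exact: ubdd_cst].
pose r (s : R) := (Num.sqrt (1 - s ^+ 2) - (1 - s ^+ 2 / 2)) / s ^+ 3.
exists (fun z s => r s * co z i).
  apply: ubddM => //; exists (2^-1) => _ s s01.
  have [q hq e] := sqrt_taylor s01; rewrite /r e addrC addKr mulrC mulKf//.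
  by rewrite expf_neq0// gt_eqF//; case/andP: s01.
move=> z s s01; have [s0 s1] := andP s01.
rewrite co_rotS ?exprn_ile1 ?(ltW s0)// /rotf eqxx.
have e : s ^+ 3 * r s = Num.sqrt (1 - s ^+ 2) - (1 - s ^+ 2 / 2).
  by rewrite mulrC divfK// expf_neq0// gt_eqF.
by rewrite (mulrA (s ^+ 3)) e; field.
Qed.

Lemma taylor2_rot_j (i j : 'I_N) : i != j ->
  taylor2 (fun z s => co (rotS i j s z) j) (fun z => co z j)
    (fun z => co z i) (fun z => - co z j / 2).
Proof.
move=> ij; have bi := @ubdd_co R n i; have bj := @ubdd_co R n j.
split => //.
  by apply: ubddM; [exact: ubddN|exact: ubdd_cst].
pose r (s : R) := (Num.sqrt (1 - s ^+ 2) - (1 - s ^+ 2 / 2)) / s ^+ 3.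
exists (fun z s => r s * co z j).
  apply: ubddM => //; exists (2^-1) => _ s s01.
  have [q hq e] := sqrt_taylor s01; rewrite /r e addrC addKr mulrC mulKf//.
  by rewrite expf_neq0// gt_eqF//; case/andP: s01.
move=> z s s01; have [s0 s1] := andP s01.
rewrite co_rotS ?exprn_ile1 ?(ltW s0)// /rotf eqxx [j == i]eq_sym (negPf ij).
have e : s ^+ 3 * r s = Num.sqrt (1 - s ^+ 2) - (1 - s ^+ 2 / 2).
  by rewrite mulrC divfK// expf_neq0// gt_eqF.
by rewrite (mulrA (s ^+ 3)) e; field.
Qed.

Definition dmon mu i z : R :=
  (mu i)%:R * (co z i ^+ (mu i).-1 * \prod_(l | l != i) co z l ^+ mu l).

Definition d2mon mu i z : R := (mu i * (mu i).-1)%:R * mon (msub2 mu i) z.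

(** With L = x_i d_j - x_j d_i the generator of the rotation, the coefficients are L and L^2/2
    applied to the monomial; the sine differs from the angle only at third order. *)
Lemma taylor2_mon_rot mu (i j : 'I_N) : i != j ->
  taylor2 (fun z s => mon mu (rotS i j s z)) (mon mu)
    (fun z => dmon mu j z * co z i - dmon mu i z * co z j)
    (fun z => (co z j ^+ 2 * d2mon mu i z + co z i ^+ 2 * d2mon mu j z) / 2
       - (mu i * mu j)%:R * mon mu z - (mu i + mu j)%:R / 2 * mon mu z).
Proof.
move=> ij; have ji : j != i by rewrite eq_sym.
pose M z := \prod_(l | (l != i) && (l != j)) co z l ^+ mu l.
have bM : ubdd (fun z _ => M z).
  by apply: ubdd_prod => l _; apply: ubddX; exact: ubdd_co.
have ME z : mon mu z = co z i ^+ mu i * co z j ^+ mu j * M z.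
  by rewrite /mon (bigD1 i) //= (bigD1 j) //= mulrA.
have Pi z : \prod_(l | l != i) co z l ^+ mu l = co z j ^+ mu j * M z.
  by rewrite (bigD1 j).
have Pj z : \prod_(l | l != j) co z l ^+ mu l = co z i ^+ mu i * M z.
  rewrite (bigD1 i) //=; congr (_ * _); apply: eq_bigl => l.
  by rewrite andbC.
apply: taylor2_eq (taylor2M (taylor2M (taylor2X (mu i) (taylor2_rot_i ij))
  (taylor2X (mu j) (taylor2_rot_j ij))) (taylor2_cst bM)) _ _ _ _.
- move=> z s s01; rewrite /mon (bigD1 i) //= (bigD1 j) //= mulrA; congr (_ * _).
  have [s0 s1] := andP s01.
  apply: eq_bigr => l /andP[/negPf li /negPf lj].
  by rewrite co_rotS ?exprn_ile1 ?(ltW s0)// /rotf li lj.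
- by move=> z; rewrite ME.
- by move=> z; rewrite /dmon Pi Pj; ring.
- move=> z; rewrite /d2mon !mon_msub2 Pi Pj ME.
  have pE (x : R) p : p%:R * x ^+ p.-1 * (- x / 2) = - (p%:R / 2) * x ^+ p.
    by case: p => [|p]; rewrite /= ?mul0r ?oppr0 ?mul0r// exprS; field.
  have qE (x : R) p : p%:R * x ^+ p.-1 * x = p%:R * x ^+ p.
    by case: p => [|p]; rewrite /= ?mul0r// exprS; ring.
  rewrite !pE.
  set x := co z i; set y := co z j; set p := mu i; set q := mu j.
  have -> : p%:R * x ^+ p.-1 * - y * (q%:R * y ^+ q.-1 * x) =
      - (p%:R * x ^+ p.-1 * x) * (q%:R * y ^+ q.-1 * y) by ring.
  rewrite !qE natrM natrD; by field.
Qed.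

Lemma sum_offdiag (F : 'I_N -> 'I_N -> R) :
  \sum_i \sum_(j | j != i) F i j = \sum_i \sum_j F i j - \sum_i F i i.
Proof.
rewrite -sumrB; apply: eq_bigr => i _.
by rewrite [in RHS](bigD1 i) //= [F i i + _]addrC addrK.
Qed.

(** Over ordered pairs, the rotation for (j, i) inverts the one for (i, j): first-order terms
    cancel, and second-order ones add up to the sum of L_ij^2 over i < j, the Laplace-Beltrami
    operator. *)
Definition rotsum u z (s : R) : R :=
  \sum_i \sum_(j | j != i) (u (rotS i j s z) - u z).

Lemma taylor2_rotsum_mon mu :
  taylor2 (rotsum (mon mu)) (fun=> 0) (fun=> 0) (fun z => - lb_mon mu z).
Proof.
have bM : ubdd (fun z _ => - mon mu z).
  apply: ubddN; apply: ubdd_prod => l _; apply: ubddX; exact: ubdd_co.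
pose f1 i j z := dmon mu j z * co z i - dmon mu i z * co z j.
pose f2 i j z := (co z j ^+ 2 * d2mon mu i z + co z i ^+ 2 * d2mon mu j z) / 2
  - (mu i * mu j)%:R * mon mu z - (mu i + mu j)%:R / 2 * mon mu z.
have tD i j : j != i -> taylor2 (fun z s => mon mu (rotS i j s z) - mon mu z)
    (fun=> 0) (f1 i j) (f2 i j).
  rewrite eq_sym => ij.
  apply: taylor2_eq (taylor2D (taylor2_mon_rot mu ij) (taylor2_cst bM)) _ _ _ _ => z *.
  - by [].
  - exact: subrr.
  - exact: addr0.
  - exact: addr0.
have tS i : taylor2 (fun z s => \sum_(j | j != i) (mon mu (rotS i j s z) - mon mu z))
    (fun=> 0) (fun z => \sum_(j | j != i) f1 i j z) (fun z => \sum_(j | j != i) f2 i j z).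
  apply: taylor2_eq (taylor2_sum (index_enum _) (tD i)) _ _ _ _ => z * //.
  exact: big1.
apply: taylor2_eq (taylor2_sum (P := xpredT) (index_enum _) (fun i _ => tS i))
  _ _ _ _ => z * //.
- exact: big1.
- rewrite sum_offdiag /f1; under eq_bigr do rewrite sumrB.
  rewrite sumrB exchange_big /= subrr add0r big1 ?oppr0// => i _.
  exact: subrr.
rewrite sum_offdiag.
pose a i : R := (mu i)%:R; pose k i := d2mon mu i z; pose M := mon mu z.
have sa : \sum_i a i = (mdeg mu)%:R by rewrite /a -natr_sum.
have xk i : co z i ^+ 2 * k i = (a i ^+ 2 - a i) * M.
  rewrite /k /d2mon mon_msub2 /M (mon_split mu i) /a.
  case: (mu i) => [|[|p]]; rewrite ?mul0n ?muln0 ?mul0r ?mulr0 ?expr1n ?subrr ?mul0r//.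
    by rewrite expr0n subrr mul0r.
  by rewrite !subSS subn0 /= natrM -!natr1 !exprS; ring.
have s1 : \sum_i \sum_j f2 i j z =
    \sum_i k i - (mdeg mu)%:R ^+ 2 * M - N%:R * (mdeg mu)%:R * M.
  have e1 : \sum_i \sum_j co z j ^+ 2 * k i = \sum_i k i.
    by apply: eq_bigr => i _; rewrite -mulr_suml sum_co mul1r.
  have e2 : \sum_i \sum_j co z i ^+ 2 * k j = \sum_i k i.
    by rewrite exchange_big.
  have e3 : \sum_i \sum_j a i * a j = (mdeg mu)%:R ^+ 2.
    by rewrite expr2 -[in X in X * _]sa mulr_suml; apply: eq_bigr => i _; rewrite -sa mulr_sumr.
  have e4 : \sum_(i < N) \sum_(j < N) (a i + a j) = 2 * (N%:R * (mdeg mu)%:R).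
    transitivity (\sum_(i < N) \sum_(j < N) a i + \sum_(i < N) \sum_(j < N) a j).
      by rewrite -big_split; apply: eq_bigr => i _; rewrite big_split.
    have cE (x : R) : \sum_(j < N) x = N%:R * x.
      by rewrite sumr_const card_ord mulr_natl.
    under eq_bigr do rewrite cE.
    by rewrite cE -mulr_sumr sa; ring.
  transitivity (\sum_i \sum_j ((co z j ^+ 2 * k i + co z i ^+ 2 * k j) / 2
     - a i * a j * M - (a i + a j) * (M / 2))).
    apply: eq_bigr => i _; apply: eq_bigr => j _.
    by rewrite /f2 natrM natrD -/(a i) -/(a j) -/(k i) -/(k j) -/M; ring.
  under eq_bigr do rewrite !sumrB -!mulr_suml big_split.
  by rewrite !sumrB -!mulr_suml big_split /= e1 e2 e3 e4; field.
have s2 : \sum_i f2 i i z = - (mdeg mu)%:R * M - (mdeg mu)%:R * M.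
  rewrite -sa !mulNr -opprD mulr_suml -big_split -sumrN.
  apply: eq_bigr => i _ /=; rewrite /f2 -/(k i) -/M xk natrM natrD -/(a i).
  by field.
rewrite s1 s2 /lb_mon -/M /theta -/(\sum_i k i).
set m := mdeg mu.
have -> : (m * (m + (2 * n.+1 - 1) - 1))%N = (m * (m + n + n))%N.
  congr (_ * _)%N; rewrite mul2n -addnn; lia.
have -> : N%:R = n%:R + n%:R + 2 :> R by rewrite -[n.+1]addn1 !natrD; ring.
rewrite !natrM !natrD.
set X := (X in X - _ - _ - _); set Y := (Y in _ = - (_ - Y)); rewrite (_ : X = Y)//.
by ring.
Qed.

End eigenfunctions.

(** * Spherical polynomials as sums of eigenfunctions *)

Section harmonic_decomposition.
Context {R : realType} {n : nat}.
Local Notation N := (n.+1 + n.+1)%N.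
Local Notation S := (csphere R n).
Local Notation th := (theta (2 * n.+1 - 1) : nat -> R).
Implicit Types (mu : 'I_N -> nat) (z : S) (u w : S -> R).

(* w is the value at u of the nonnegative Laplacian, both for the definition by
   homogeneous extension and for the one by rotations. *)
Definition lap u w : Prop :=
  [/\ measurable_fun setT u, exists B, forall z, `|u z| <= B, radial (hext u),
   forall z, - laplacian (hext u) (rvec (cval z)) = w z &
   taylor2 (rotsum u) (fun=> 0) (fun=> 0) (fun z => - w z)].

Lemma lap_mon mu : lap (mon mu) (lb_mon mu).
Proof.
split.
- apply: measurable_prod => l _; apply: measurable_funX; exact: measurable_co.
- exists 1 => z; rewrite /mon normr_prod; apply: prodr_ile1 => l _.
  by rewrite normr_ge0 normrX exprn_ile1// norm_co_le1.
- exact: radial_mon.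
- exact: laplacian_mon.
- exact: taylor2_rotsum_mon.
Qed.

Lemma lap_lin (a b : R) u v w w' : lap u w -> lap v w' ->
  lap (fun z => a * u z + b * v z) (fun z => a * w z + b * w' z).
Proof.
move=> [mu [B hB] ru lu tu] [mv [D hD] rv lv tv].
split.
- by apply: measurable_funD; apply: measurable_funM.
- exists (`|a| * B + `|b| * D) => z.
  by rewrite (le_trans (ler_normD _ _))// !normrM lerD// ler_wpM2l.
- by apply: radialD; apply: radialM => //; exact: radial_cst.
- move=> z; rewrite (@laplacian_lin _ _ a b (hext u) (hext v))//; last exact: rvec_neq0.
  by rewrite -lu -lv !mulrN opprD.
- have ta := taylor2M (@taylor2_cst R n (fun=> a) (ubdd_cst a)) tu.
  have tb := taylor2M (@taylor2_cst R n (fun=> b) (ubdd_cst b)) tv.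
  apply: taylor2_eq (taylor2D ta tb) _ _ _ _.
  + move=> z s _; rewrite /rotsum !mulr_sumr -big_split /=; apply: eq_bigr => i _.
    rewrite !mulr_sumr -big_split /=; apply: eq_bigr => j _.
    by ring.
  + by move=> z /=; ring.
  + by move=> z /=; ring.
  + by move=> z /=; ring.
Qed.

Lemma lap_eq u w u' w' : lap u w -> u =1 u' -> w =1 w' -> lap u' w'.
Proof. by move=> h /funext <- /funext <-. Qed.

Lemma lap0 : lap (fun=> 0) (fun=> 0).
Proof.
have h := lap_mon (fun=> 0%N).
by apply: lap_eq (lap_lin 0 0 h h) _ _ => z; rewrite !mul0r addr0.
Qed.

Lemma lap_sum (I : Type) (r : seq I) (c : I -> R) (u w : I -> S -> R) :
  (forall i, lap (u i) (w i)) ->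
  lap (fun z => \sum_(i <- r) c i * u i z) (fun z => \sum_(i <- r) c i * w i z).
Proof.
move=> h; elim: r => [|i r IH].
  by apply: lap_eq lap0 _ _ => z; rewrite big_nil.
by apply: lap_eq (lap_lin (c i) 1 (h i) IH) _ _ => z; rewrite big_cons mul1r.
Qed.

Definition eigen (k : nat) u : Prop := lap u (fun z => th k * u z).

Lemma eigen_lin k a b u v : eigen k u -> eigen k v ->
  eigen k (fun z => a * u z + b * v z).
Proof.
move=> hu hv; apply: lap_eq (lap_lin a b hu hv) _ _ => // z.
by ring.
Qed.

Lemma eigen0 k : eigen k (fun=> 0).
Proof. by apply: lap_eq lap0 _ _ => // z; rewrite mulr0. Qed.

Definition decomp (K : nat) u : Prop := exists2 v : nat -> S -> R,
  forall k, eigen k (v k) & forall z, u z = \sum_(k < K) v k z.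

Lemma decompW K K' u : (K <= K')%N -> decomp K u -> decomp K' u.
Proof.
move=> KK' [v hv e]; exists (fun k => if (k < K)%N then v k else (fun=> 0)).
  by move=> k; case: ifP => _; [exact: hv|exact: eigen0].
move=> z; rewrite e (big_ord_widen K' (v^~ z))// big_mkcond /=.
by apply: eq_bigr => k _; case: ifP.
Qed.

Lemma decomp_lin K a b u v : decomp K u -> decomp K v ->
  decomp K (fun z => a * u z + b * v z).
Proof.
move=> [x hx ex] [y hy ey]; exists (fun k z => a * x k z + b * y k z).
  by move=> k; exact: eigen_lin.
by move=> z; rewrite ex ey !mulr_sumr -big_split.
Qed.

Lemma decomp0 K : decomp K (fun=> 0).
Proof. by exists (fun _ _ => 0) => [k|z]; [exact: eigen0|rewrite big1]. Qed.

Lemma theta_lt (k m : nat) : (k < m)%N -> th k < th m.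
Proof.
move=> km; rewrite /theta ltr_nat; apply: ltn_mul => //; lia.
Qed.

Lemma theta_ge0 k : 0 <= th k.
Proof. by rewrite /theta ler0n. Qed.

Lemma mdeg_msub2 mu i : (2 <= mu i)%N -> mdeg mu = (mdeg (msub2 mu i)).+2.
Proof.
move=> h; rewrite /mdeg (bigD1 i) //= [in RHS](bigD1 i) //= {1}/msub2 eqxx.
rewrite -!addSn; congr (_ + _)%N; first by lia.
by apply: eq_bigr => l /negPf li; rewrite /msub2 li.
Qed.

(* Since (A - theta_m) x^mu = - Delta x^mu has degree m - 2, the harmonic parts
   of Delta x^mu, divided by theta_m - theta_k, are those of x^mu for k < m. *)
Lemma decomp_mon mu : decomp (mdeg mu).+1 (mon mu).
Proof.
move: {2}(mdeg mu) (leqnn (mdeg mu)) => M; elim: M mu => [|M IH] mu hM.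
  exists (fun k => if k == 0%N then mon mu else (fun=> 0)).
    move=> k; case: eqP => [->|_]; last exact: eigen0.
    apply: lap_eq (lap_mon mu) _ _ => // z; rewrite /lb_mon.
    move: hM; rewrite leqn0 => /eqP m0; rewrite m0 big1 ?subr0// => i _.
    have : (mu i <= mdeg mu)%N by rewrite /mdeg (bigD1 i) //= leq_addr.
    by rewrite m0 leqn0 => /eqP ->; rewrite mul0n mul0r.
  move: hM; rewrite leqn0 => /eqP -> z.
  by rewrite big_ord_recl big_ord0 addr0.
pose m := mdeg mu.
pose Q z := \sum_i (mu i * (mu i).-1)%:R * mon (msub2 mu i) z.
have [v hv eQ] : decomp m Q.
  rewrite /Q; elim: (index_enum _) => [|i r IHr].
    by have [v h e] := decomp0 m; exists v => // z; rewrite big_nil.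
  have : decomp m (fun z => (mu i * (mu i).-1)%:R * mon (msub2 mu i) z + 1 *
      \sum_(i <- r) (mu i * (mu i).-1)%:R * mon (msub2 mu i) z).
    have [i2|i2] := leqP 2 (mu i).
      have mE := mdeg_msub2 i2.
      apply: decomp_lin => //; apply: (@decompW (mdeg (msub2 mu i)).+1).
        by rewrite /m mE.
      by apply: IH; move: hM; rewrite mE !ltnS; exact: ltnW.
    have -> : (mu i * (mu i).-1 = 0)%N.
      by case: (mu i) i2 => [|[|p]]//; rewrite muln0.
    have [v h e] := decomp_lin 0 1 (decomp0 m) IHr; exists v => // z.
    by rewrite -e !mul0r.
  by move=> [v h e]; exists v => // z; rewrite big_cons -e mul1r.
pose c k := (th m - th k)^-1.
pose w z := \sum_(k < m) c k * v k z.
(* The top component: A - theta_m kills what remains once the lower components are removed. *)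
pose e z := mon mu z - w z.
have he : eigen m e.
  have := lap_sum (index_enum 'I_m) (fun k => c k) (fun k : 'I_m => hv k) => hw.
  apply: lap_eq (lap_lin 1 (-1) (lap_mon mu) hw) _ _ => z.
    by rewrite mul1r mulN1r.
  rewrite mul1r mulN1r /e mulrBr /lb_mon -/m -addrA; congr (_ + _).
  rewrite -opprD; congr (- _).
  rewrite -/(Q z) eQ -big_split /w mulr_sumr; apply: eq_bigr => k _ /=.
  have : th m - th k != 0 by rewrite subr_eq0 gt_eqF// theta_lt.
  by rewrite /c; move: (theta _ m) (theta _ k) => a b h; field.
exists (fun k => if (k < m)%N then (fun z => c k * v k z) else
   if k == m then e else (fun=> 0)).
  move=> k; case: ifP => [_|_].
    by apply: lap_eq (eigen_lin (c k) 0 (hv k) (hv k)) _ _ => z; rewrite mul0r addr0.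
  by case: eqP => [->|_] //; exact: eigen0.
move=> z; rewrite big_ord_recr /= ltnn eqxx /e.
rewrite (eq_bigr (fun k : 'I_m => c k * v k z)); last by move=> k _; rewrite ltn_ord.
by rewrite addrC subrK.
Qed.

Inductive spoly : (S -> R) -> Prop :=
| spoly_mon mu : spoly (mon mu)
| spoly_lin a b u v : spoly u -> spoly v -> spoly (fun z => a * u z + b * v z).

Lemma spoly_decomp u : spoly u -> exists K, decomp K u.
Proof.
elim => [mu|a b {}u v _ [K hu] _ [L hv]].
  by exists (mdeg mu).+1; exact: decomp_mon.
exists (maxn K L); apply: decomp_lin; apply: decompW; try eassumption.
  exact: leq_maxl.
exact: leq_maxr.
Qed.

Lemma spoly_cst c : spoly (fun=> c).
Proof.
have := spoly_lin c 0 (spoly_mon (fun=> 0%N)) (spoly_mon (fun=> 0%N)).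
rewrite [X in spoly X](_ : _ = fun=> c)//; apply/funext => z.
by rewrite /mon big1 ?mulr1 ?mul0r ?addr0.
Qed.

Lemma spoly_co l : spoly (fun z => co z l).
Proof.
have := spoly_mon (fun i => (i == l) : nat).
rewrite [X in spoly X](_ : _ = fun z => co z l)//; apply/funext => z.
by rewrite /mon (bigD1 l) //= eqxx expr1 big1 ?mulr1// => i /negPf ->.
Qed.

Lemma spolyM u v : spoly u -> spoly v -> spoly (fun z => u z * v z).
Proof.
move=> hu hv; elim: hu => [mu|a b {}u u' _ IH _ IH'].
  elim: hv => [mu'|a b v' w _ IH _ IH'].
    have := spoly_mon (fun i => mu i + mu' i)%N.
    rewrite [X in spoly X](_ : _ = fun z => mon mu z * mon mu' z)//.
    apply/funext => z; rewrite /mon -big_split /=; apply: eq_bigr => i _.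
    by rewrite exprD.
  have := spoly_lin a b IH IH'.
  rewrite [X in spoly X](_ : _ = fun z => mon mu z * (a * v' z + b * w z))//.
  by apply/funext => z; ring.
have := spoly_lin a b IH IH'.
rewrite [X in spoly X](_ : _ = fun z => (a * u z + b * u' z) * v z)//.
by apply/funext => z; ring.
Qed.

Lemma spolyX u m : spoly u -> spoly (fun z => u z ^+ m).
Proof.
move=> hu; elim: m => [|m IH]; first exact: (spoly_cst 1).
have := spolyM hu IH.
rewrite [X in spoly X](_ : _ = fun z => u z ^+ m.+1)//.
by apply/funext => z; rewrite exprS.
Qed.

Lemma spoly_measurable u : spoly u -> measurable_fun setT u.
Proof.
elim => [mu|a b {}u v _ hu _ hv]; first by have [] := lap_mon mu.
by apply: measurable_funD; apply: measurable_funM.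
Qed.

Lemma spoly_bounded u : spoly u -> exists B, forall z, `|u z| <= B.
Proof.
elim => [mu|a b {}u v _ [B hB] _ [D hD]]; first by have [] := lap_mon mu.
exists (`|a| * B + `|b| * D) => z.
by rewrite (le_trans (ler_normD _ _))// !normrM lerD// ler_wpM2l.
Qed.

End harmonic_decomposition.


(** * Resolvent bounds *)

Section norms.
Context d (T : measurableType d) (R : realType) (P : probability T R).
Implicit Types (u v f g : T -> R) (q : \bar R).

Local Notation Ln q f := ('N[P]_q[EFin \o f])%E.

(** [fine] sends an infinite norm to 0, so this real number is meaningful only together with
    finiteness, which is automatic for the bounded measurable functions [bm]. *)
Definition nrm q f : R := fine (Ln q f).

Definition bm u : Prop := measurable_fun setT u /\ exists B, forall z, `|u z| <= B.

Lemma bm_cst c : bm (fun=> c).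
Proof. by split; [exact: measurable_cst|exists `|c|]. Qed.

Lemma bm_lin a b u v : bm u -> bm v -> bm (fun z => a * u z + b * v z).
Proof.
move=> [mu [B hB]] [mv [D hD]]; split.
  by apply: measurable_funD; apply: measurable_funM.
exists (`|a| * B + `|b| * D) => z.
by rewrite (le_trans (ler_normD _ _))// !normrM lerD// ler_wpM2l.
Qed.

Lemma bmM u v : bm u -> bm v -> bm (fun z => u z * v z).
Proof.
move=> [mu [B hB]] [mv [D hD]]; split; first exact: measurable_funM.
by exists (B * D) => z; rewrite normrM ler_pM.
Qed.

Lemma bm_sum (I : Type) (r : seq I) (c : I -> R) (u : I -> T -> R) :
  (forall i, bm (u i)) -> bm (fun z => \sum_(i <- r) c i * u i z).
Proof.
move=> h; elim: r => [|i r IH].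
  rewrite [X in bm X](_ : _ = fun=> 0); first exact: bm_cst.
  by apply/funext => z; rewrite big_nil.
rewrite [X in bm X](_ : _ = fun z => c i * u i z + 1 * \sum_(i <- r) c i * u i z).
  exact: bm_lin.
by apply/funext => z; rewrite big_cons mul1r.
Qed.

Lemma P_gt0 : (0 < P setT)%E.
Proof. by rewrite probability_setT. Qed.

Lemma LnormE q (r : R) f : q = r%:E ->
  Ln q f = ((\int[P]_x (`|f x| `^ r)%:E) `^ r^-1)%E.
Proof. by move=> ->; rewrite unlock. Qed.

Lemma Lnorm_yE f : Ln +oo%E f = ess_sup P (abse \o (EFin \o f)).
Proof. by rewrite unlock P_gt0. Qed.

Lemma measurable_normpowR f (r : R) : measurable_fun setT f ->
  measurable_fun setT (fun x => (`|f x| `^ r)%:E).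
Proof.
move=> mf; apply/measurable_EFinP.
apply: (measurableT_comp (f := fun y : R => y `^ r)); first exact: measurable_powR.
exact: measurableT_comp.
Qed.

Lemma Lnorm_le q f g : (1 <= q)%E -> measurable_fun setT f -> measurable_fun setT g ->
  (forall z, `|f z| <= `|g z|) -> (Ln q f <= Ln q g)%E.
Proof.
case: q => [r| |//] r1 mf mg fg.
  have r0 : 0 <= r by rewrite (le_trans ler01)// -lee_fin.
  rewrite (@LnormE _ r f erefl) (@LnormE _ r g erefl); apply: gt0_ler_poweR.
  - by rewrite invr_ge0.
  - by rewrite in_itv /= leey andbT; apply: integral_ge0 => x _; rewrite lee_fin powR_ge0.
  - by rewrite in_itv /= leey andbT; apply: integral_ge0 => x _; rewrite lee_fin powR_ge0.
  apply: ge0_le_integral => //.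
  - exact: measurable_normpowR.
  - exact: measurable_normpowR.
  - by move=> x _; rewrite lee_fin ge0_ler_powR// nnegrE.
rewrite !Lnorm_yE; apply: le_ess_sup; apply: aeW => z /=.
by rewrite lee_fin.
Qed.

Lemma Lnorm_cst q c : (1 <= q)%E -> Ln q (fun=> c) = `|c|%:E.
Proof.
case: q => [r| |//] r1; last by rewrite Lnorm_yE (ess_sup_cst _ P_gt0).
have r0 : 0 < r by rewrite (lt_le_trans ltr01)// -lee_fin.
rewrite (@LnormE _ r _ erefl) integral_cst//.
rewrite [X in (_ * X)%E](_ : _ = 1%E); last exact: probability_setT.
rewrite mule1 poweR_EFin -powRrM.
by rewrite mulfV ?gt_eqF// powRr1.
Qed.

Lemma Lnorm_bd q f B : (1 <= q)%E -> measurable_fun setT f ->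
  (forall z, `|f z| <= B) -> (Ln q f <= B%:E)%E.
Proof.
move=> q1 mf fB; rewrite (@le_trans _ _ (Ln q (fun=> B)))//.
  by apply: Lnorm_le => // z; rewrite (le_trans (fB z))// ler_norm.
rewrite Lnorm_cst// lee_fin ger0_norm// (le_trans _ (fB point))//.
Qed.

Lemma bm_Lfun q u : (1 <= q)%E -> bm u -> (Ln q u < +oo)%E.
Proof. by move=> q1 [mu [B hB]]; rewrite (le_lt_trans (Lnorm_bd q1 mu hB))// ltry. Qed.

Lemma nrmE q u : (Ln q u < +oo)%E -> Ln q u = (nrm q u)%:E.
Proof. by move=> h; rewrite fineK// ge0_fin_numE// Lnorm_ge0. Qed.

Lemma nrm_ge0 q u : 0 <= nrm q u.
Proof. by rewrite fine_ge0// Lnorm_ge0. Qed.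

Lemma nrm_bd q f B : (1 <= q)%E -> measurable_fun setT f ->
  (forall z, `|f z| <= B) -> nrm q f <= B.
Proof.
move=> q1 mf fB; rewrite -lee_fin -nrmE; first exact: Lnorm_bd.
by apply: bm_Lfun => //; split => //; exists B.
Qed.

Lemma nrmD q u v : (1 <= q)%E -> bm u -> bm v ->
  nrm q (fun z => u z + v z) <= nrm q u + nrm q v.
Proof.
move=> q1 bu bv; have buv := bm_lin 1 1 bu bv.
rewrite (_ : (fun z => 1 * u z + 1 * v z) = (fun z => u z + v z)) in buv; last first.
  by apply/funext => z; rewrite !mul1r.
rewrite -lee_fin EFinD -!nrmE ?bm_Lfun//.
by apply: eminkowski => //; [case: bu|case: bv].
Qed.

Lemma nrmZ q c u : (1 <= q)%E -> bm u -> nrm q (fun z => c * u z) = `|c| * nrm q u.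
Proof.
move=> q1 bu; have [mu _] := bu.
have uL : u \in Lfun P q.
  rewrite inE; apply/andP; split; rewrite inE; first exact: mu.
  exact: bm_Lfun.
have h : forall f : LfunType P q1, (f : T -> R) = u ->
    'N[P]_q[EFin \o (fun z => (c * u z)%R)]%E = (`|c|%:E * 'N[P]_q[EFin \o u])%E.
  by move=> f <-; exact: (LnormZ f c).
have {}h := h (Lfun_Sub q1 uL) (Lfun_valP q1 uL).
rewrite /nrm h fineM//; first by rewrite nrmE ?bm_Lfun.
Qed.

Lemma nrm_sum q (I : Type) (r : seq I) (A : pred I) (u : I -> T -> R) :
  (1 <= q)%E -> (forall i, A i -> bm (u i)) ->
  nrm q (fun z => \sum_(i <- r | A i) u i z) <= \sum_(i <- r | A i) nrm q (u i)
  /\ bm (fun z => \sum_(i <- r | A i) u i z).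
Proof.
move=> q1 h; elim: r => [|i r [IH IHb]].
  rewrite big_nil [X in nrm q X](_ : _ = fun=> 0); last first.
    by apply/funext => z; rewrite big_nil.
  rewrite /nrm Lnorm_cst// normr0; split => //.
  rewrite [X in bm X](_ : _ = fun=> 0); first exact: bm_cst.
  by apply/funext => z; rewrite big_nil.
have [Ai|nAi] := boolP (A i); last first.
  by rewrite big_cons (negPf nAi); under eq_fun do rewrite big_cons (negPf nAi).
rewrite big_cons Ai; under eq_fun do rewrite big_cons Ai.
split; first by rewrite (le_trans (nrmD q1 (h i Ai) IHb))// lerD2l.
have := bm_lin 1 1 (h i Ai) IHb.
by under eq_fun do rewrite !mul1r.
Qed.

Lemma nrm_comp q u (phi : T -> T) (mphi : measurable_fun setT phi) :
  (1 <= q)%E -> (forall A, measurable A -> P (phi @^-1` A) = P A) ->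
  measurable_fun setT u -> nrm q (u \o phi) = nrm q u.
Proof.
move=> q1 iphi mu; rewrite /nrm; congr fine; case: q q1 => [r| |//] q1.
- apply: (etrans (@LnormE _ r (u \o phi) erefl)); apply: (etrans _ (esym (@LnormE _ r u erefl))).
  apply: (congr1 (fun y => (y `^ r^-1)%E)).
  have -> : (\int[P]_x (`|u x| `^ r)%:E = \int[pushforward P phi]_x (`|u x| `^ r)%:E)%E.
    by apply: eq_measure_integral => A mA _; exact: (esym (iphi A mA)).
  rewrite ge0_integral_pushforward//.
    exact: measurable_normpowR.
- rewrite !Lnorm_yE.
  have mau : measurable_fun setT (abse \o (EFin \o u)).
    by apply/measurable_EFinP; exact: measurableT_comp.
  have mau2 : measurable_fun setT (abse \o (EFin \o (u \o phi))).
    exact: (measurableT_comp mau mphi).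
  (* The essential supremum depends only on the measures of superlevel sets, which [phi]
     preserves. *)
  rewrite (ess_supEmu0 _ mau2) (ess_supEmu0 _ mau).
  have E y : P ((abse \o (EFin \o (u \o phi))) @^-1` `]y, +oo[) =
      P ((abse \o (EFin \o u)) @^-1` `]y, +oo[).
    apply: (iphi ((abse \o (EFin \o u)) @^-1` `]y, +oo[)).
    by rewrite -[X in measurable X]setTI; exact/mau/emeasurable_itv.
  by congr (ereal_inf _); apply/seteqP; split => y /=; rewrite E.
Qed.

End norms.

(** * Conjugate exponents and the Hoelder inequality, endpoints included *)

Section hoelder_dual.
Context d (T : measurableType d) (R : realType) (P : probability T R).
Implicit Types (u v f g F : T -> R) (p q : \bar R).

Local Notation Ln q f := ('N[P]_q[EFin \o f])%E.

Definition dexp p : \bar R :=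
  if p is r%:E then if r == 1 then +oo%E else (r / (r - 1))%:E else 1%E.

Lemma dexp_ge1 p : (1 <= p)%E -> (1 <= dexp p)%E.
Proof.
case: p => [r| |]//=; rewrite lee_fin => r1; case: eqP => [_|/eqP n1]; first by rewrite leey.
have r10 : 0 < r - 1 by rewrite subr_gt0 lt_neqAle eq_sym n1.
by rewrite lee_fin ler_pdivlMr// mul1r gerBl.
Qed.

Lemma hoelder1y f g : measurable_fun setT f -> measurable_fun setT g ->
  (Ln +oo%E g < +oo -> 'N[P]_1[EFin \o (f \* g)%R] <= Ln 1%E f * Ln +oo%E g)%E.
Proof.
move=> mf mg gy; rewrite (nrmE gy).
rewrite !Lnorm1 muleC -ge0_integralZl//; last 2 first.
  by apply/measurable_EFinP; exact: measurableT_comp.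
  by rewrite lee_fin nrm_ge0.
apply: ae_ge0_le_integral => //.
- by apply/measurable_EFinP/measurableT_comp => //; exact: measurable_funM.
- by move=> x _; rewrite mule_ge0// lee_fin nrm_ge0.
- apply/measurable_EFinP; apply: measurable_funM => //.
  exact: measurableT_comp.
have := ess_sup_ge P (abse \o (EFin \o g)); rewrite -Lnorm_yE (nrmE gy).
apply: filterS => x /=; rewrite lee_fin => h _.
by rewrite -EFinM lee_fin normrM mulrC ler_wpM2r.
Qed.

Lemma hoelder_dexp p f g : (1 <= p)%E -> measurable_fun setT f -> measurable_fun setT g ->
  (Ln p f < +oo -> Ln (dexp p) g < +oo ->
   'N[P]_1[EFin \o (f \* g)%R] <= Ln p f * Ln (dexp p) g)%E.
Proof.
case: p => [r| |//] /=; last first.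
  move=> _ mf mg fy gy; rewrite muleC; have := hoelder1y mg mf fy.
  by rewrite [X in EFin \o X](_ : _ = (f \* g)%R)//; apply/funext => x /=; rewrite mulrC.
rewrite lee_fin => r1; case: eqP => [->|/eqP n1] mf mg fy gy; first exact: hoelder1y.
have r10 : 0 < r - 1 by rewrite subr_gt0 lt_neqAle eq_sym n1.
have r0 : 0 < r by rewrite (lt_le_trans ltr01).
apply: hoelder => //; first by rewrite divr_gt0.
by field; rewrite !gt_eqF.
Qed.

Lemma Lp_integrable p f : (1 <= p)%E -> measurable_fun setT f -> (Ln p f < +oo)%E ->
  P.-integrable setT (EFin \o f).
Proof.
move=> p1 mf fy; apply/Lfun1_integrable.
have fin : P setT \is a fin_num by exact: fin_num_measure.
apply: (Lfun_subset (le_refl 1%E) p1 fin p1).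
rewrite inE; apply/andP; split; rewrite inE; [exact: mf|exact: fy].
Qed.

Lemma bm_integrable u : bm u -> P.-integrable setT (EFin \o u).
Proof.
move=> bu; apply: (@Lp_integrable 1%E) => //; first by case: bu.
exact: bm_Lfun.
Qed.

Lemma integrable_bmM f u : P.-integrable setT (EFin \o f) -> bm u ->
  P.-integrable setT (EFin \o (fun z => f z * u z)).
Proof.
move=> fi [mu [B hB]]; have /measurable_EFinP mf := measurable_int P fi.
apply: (@le_integrable _ _ _ P setT _ _ (fun z => B%:E * (EFin \o f) z)%E) => //.
- by apply/measurable_EFinP; exact: measurable_funM.
- move=> z _ /=; rewrite lee_fin !normrM mulrC ler_wpM2r//.
  by rewrite (le_trans (hB z))// ler_norm.
- exact: integrableZl.
Qed.

Lemma Rint_bd p f u : (1 <= p)%E -> measurable_fun setT f -> (Ln p f < +oo)%E -> bm u ->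
  `|\int[P]_z (f z * u z)| <= nrm P p f * nrm P (dexp p) u.
Proof.
move=> p1 mf fy bu; have [mu _] := bu.
have uy := bm_Lfun P (dexp_ge1 p1) bu.
have fi := Lp_integrable p1 mf fy.
have fui := integrable_bmM fi bu.
rewrite (le_trans (le_normr_Rintegral measurableT fui))//.
rewrite -lee_fin EFinM -(nrmE fy) -(nrmE uy).
apply: le_trans (hoelder_dexp p1 mf mu fy uy).
rewrite Lnorm1 /Rintegral fineK//; apply: integrable_fin_num => //.
exact: (integrable_norm fui).
Qed.

End hoelder_dual.

(** * Contractivity of resolvents and bounded multipliers *)

Section multipliers.
Context {R : realType} {n : nat}.
Local Notation N := (n.+1 + n.+1)%N.
Local Notation S := (csphere R n).
Local Notation th := (theta (2 * n.+1 - 1) : nat -> R).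
Local Notation P := (@sphere_measure R n).
Implicit Types (q : \bar R) (z : S) (u w : S -> R) (v : nat -> S -> R) (m : nat -> R).

Lemma nrm_rotS q u (i j : 'I_N) s : (1 <= q)%E -> i != j -> 0 < s <= 1 ->
  measurable_fun setT u -> nrm P q (fun z => u (rotS i j s z)) = nrm P q u.
Proof.
move=> q1 ij /andP[s0 s1] mu.
have s21 : s ^+ 2 <= 1 by rewrite exprn_ile1// ltW.
apply: (nrm_comp (measurable_rotS ij s21) q1 _ mu) => A mA.
by apply: sphere_measure_rotS => //; rewrite gt_eqF.
Qed.

(* u - Q u, with Q the average over the rotations by s in all coordinate planes,
   is s^2 (A u) / K up to O(s^3), and Q contracts every L^q norm. *)
Lemma lap_accretive q t u w : (1 <= q)%E -> 0 <= t -> lap u w -> bm w ->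
  nrm P q u <= nrm P q (fun z => u z + t * w z).
Proof.
move=> q1 t0 [mu bu _ _ [_ _ _ [r [C hC] hr]]] bw.
have {}bu : bm u by [].
have C0 : 0 <= C by rewrite (le_trans _ (hC point 1 _))// ltr01 lexx.
pose K : R := \sum_(i < N) \sum_(j < N | j != i) 1.
have K0 : 0 <= K by apply: sumr_ge0 => i _; apply: sumr_ge0.
have main s : 0 < s <= 1 -> nrm P q u <= nrm P q (fun z => u z + t * w z) + t * s * C.
  move=> s01; have [s0 s1] := andP s01.
  (* This factor turns [rotsum], equal to - s^2 w up to s^3, into - t w up to t s. Hence (1 + tau K)
     u = (u + t w) + tau U + O(t s), and since U has norm at most K times that of u, the large terms
     in tau K cancel. *)
  pose tau := t / s ^+ 2.
  have tau0 : 0 <= tau by rewrite divr_ge0// exprn_ge0// ltW.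
  have ts : tau * s ^+ 2 = t by rewrite divfK// expf_neq0// gt_eqF.
  pose U z := \sum_(i < N) \sum_(j < N | j != i) u (rotS i j s z).
  have s21 : s ^+ 2 <= 1 by rewrite exprn_ile1// ltW.
  have brot i j : i != j -> bm (fun z => u (rotS i j s z)).
    move=> ij; have [_ [B hB]] := bu; split; last by exists B => z.
    exact: (measurableT_comp mu (measurable_rotS ij s21)).
  have rowb i := nrm_sum P (index_enum 'I_N) (A := fun j => j != i) q1
    (fun j ji => brot i j (etrans (congr1 negb (eq_sym i j)) ji)).
  have [nU bU'] := nrm_sum P (index_enum 'I_N) (A := xpredT) q1 (fun i _ => (rowb i).2).
  have bU : bm U := bU'.
  have {}nU : nrm P q U <= K * nrm P q u.
    rewrite (le_trans nU)// /K mulr_suml; apply: ler_sum => i _.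
    rewrite (le_trans (rowb i).1)// mulr_suml; apply: ler_sum => j ji.
    by rewrite mul1r nrm_rotS// eq_sym.
  have but : bm (fun z => u z + t * w z).
    by have := bm_lin 1 t bu bw; under eq_fun do rewrite mul1r.
  have bsum := bm_lin 1 tau but bU.
  have UE z : U z = K * u z + rotsum u z s.
    rewrite /K /rotsum mulr_suml -big_split /=; apply: eq_bigr => i _.
    rewrite mulr_suml -big_split /=; apply: eq_bigr => j _.
    by rewrite mul1r addrC subrK.
  have e1 z : (1 + tau * K) * u z =
      (1 * (u z + t * w z) + tau * U z) + - (t * s * r z s).
    rewrite UE hr// mulr0 addr0 add0r -ts.
    by ring.
  have be : bm (fun z => - (t * s * r z s)).
    have := bm_lin (1 + tau * K) (-1) bu bsum.
    rewrite [X in bm X](_ : _ = fun z => - (t * s * r z s))//.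
    by apply/funext => z; rewrite e1; ring.
  have h : (1 + tau * K) * nrm P q u <=
      nrm P q (fun z => u z + t * w z) + tau * (K * nrm P q u) + t * s * C.
    have -> : (1 + tau * K) * nrm P q u = nrm P q (fun z => (1 + tau * K) * u z).
      by rewrite nrmZ// ger0_norm// addr_ge0// mulr_ge0.
    under eq_fun do rewrite e1.
    rewrite (le_trans (nrmD P q1 bsum be))// lerD//.
      have b1 := bm_lin 1 0 but but; have b2 := bm_lin tau 0 bU bU.
      have e2 : (fun z => 1 * (u z + t * w z) + 0 * (u z + t * w z)) =
        (fun z => 1 * (u z + t * w z)) by apply/funext => z; ring.
      have e3 : (fun z => tau * U z + 0 * U z) = (fun z => tau * U z).
        by apply/funext => z; ring.
      rewrite e2 in b1; rewrite e3 in b2.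
      rewrite (le_trans (nrmD P q1 b1 b2))// !nrmZ// normr1 mul1r lerD2l.
      by rewrite ger0_norm// ler_wpM2l.
    apply: nrm_bd => //; first by case: be.
    move=> z; rewrite normrN !normrM (ger0_norm t0) (ger0_norm (ltW s0)).
    by rewrite ler_wpM2l ?mulr_ge0 ?(ltW s0)// hC.
  move: h; rewrite mulrDl mul1r -mulrA; set A := tau * _; lra.
apply/ler_addgt0Pr => e e0.
pose s := Num.min 1 (e / (t * C + 1)).
have tC : 0 < t * C + 1 by rewrite ltr_wpDl// mulr_ge0.
have s01 : 0 < s <= 1 by rewrite lt_min ltr01 divr_gt0//= ge_min lexx.
rewrite (le_trans (main s s01))// lerD2l mulrAC.
have : s <= e / (t * C + 1) by rewrite ge_min lexx orbT.
rewrite ler_pdivlMr// => h.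
rewrite (le_trans _ h)// mulrC ler_wpM2l//; last by rewrite lerDl.
by case/andP: s01 => /ltW.
Qed.

Lemma eigen_bm k u : eigen k u -> bm u.
Proof. by case. Qed.

Definition msum m K v z : R := \sum_(k < K) m k * v k z.

(** The symbol acts on a given family of components; the bound has to be uniform in their number
    [K]. *)
Definition mult q m c : Prop := forall K v, (forall k, eigen k (v k)) ->
  nrm P q (msum m K v) <= c * nrm P q (fun z => \sum_(k < K) v k z).

Lemma eigenZ k c u : eigen k u -> eigen k (fun z => c * u z).
Proof.
by move=> h; apply: lap_eq (eigen_lin c 0 h h) _ _ => z; rewrite mul0r addr0.
Qed.

Lemma msum_bm m K v : (forall k, eigen k (v k)) -> bm (msum m K v).
Proof. by move=> hv; apply: bm_sum => k; exact/eigen_bm/hv. Qed.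

Lemma mult_eq q m m' c : m =1 m' -> mult q m c -> mult q m' c.
Proof. by move=> /funext <-. Qed.

Lemma mult1 q : mult q (fun=> 1) 1.
Proof.
move=> K v hv; rewrite mul1r [X in nrm _ _ X](_ : _ = fun z => \sum_(k < K) v k z)//.
by apply/funext => z; apply: eq_bigr => k _; rewrite mul1r.
Qed.

Lemma multM q m m' c c' : 0 <= c -> mult q m c -> mult q m' c' ->
  mult q (fun k => m k * m' k) (c * c').
Proof.
move=> c0 hm hm' K v hv.
have := hm K (fun k z => m' k * v k z) (fun k => eigenZ (m' k) (hv k)).
rewrite (_ : msum m K _ = msum (fun k => m k * m' k) K v); last first.
  by apply/funext => z; apply: eq_bigr => k _; rewrite mulrA.
by move=> h; rewrite (le_trans h)// -mulrA ler_wpM2l// hm'.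
Qed.

Lemma multX q m c i : 0 <= c -> mult q m c -> mult q (fun k => m k ^+ i) (c ^+ i).
Proof.
move=> c0 hm; elim: i => [|i IH]; first exact: mult1.
by rewrite exprS; apply: mult_eq (multM c0 hm IH) => k; rewrite exprS.
Qed.

Lemma multB1 q m c : (1 <= q)%E -> mult q m c -> mult q (fun k => 1 - m k) (1 + c).
Proof.
move=> q1 hm K v hv; have b1 := msum_bm (fun=> 1) K hv.
have bm' : bm (fun z => - 1 * msum m K v z).
  have bb := msum_bm m K hv; have := bm_lin (-1) 0 bb bb.
  by under eq_fun do rewrite mul0r addr0.
rewrite (_ : msum _ K v = fun z => msum (fun=> 1) K v z + - 1 * msum m K v z); last first.
  apply/funext => z; rewrite /msum mulr_sumr -big_split /=; apply: eq_bigr => k _.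
  by ring.
rewrite (le_trans (nrmD P q1 b1 bm'))// mulrDl lerD//; first exact: mult1.
by rewrite nrmZ ?normrN1 ?mul1r//; [exact: hm|exact: msum_bm].
Qed.

(** For U = sum of v_k / (1 + t theta_k), the function U + t A U is the sum of the v_k, so this is
    [lap_accretive] applied to U. *)
Lemma mult_res q t : (1 <= q)%E -> 0 <= t -> mult q (fun k => (1 + t * th k)^-1) 1.
Proof.
move=> q1 t0 K v hv; rewrite mul1r.
pose m k := (1 + t * th k)^-1.
have := lap_sum (index_enum 'I_K) (fun k : 'I_K => m k) (fun k : 'I_K => hv k) => hU.
have bw : bm (fun z => \sum_(k < K) m k * (th k * v k z)).
  by apply: bm_sum => k; exact/eigen_bm/eigenZ/hv.
apply: le_trans (lap_accretive q1 t0 hU bw) _.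
rewrite le_eqVlt; apply/orP; left; apply/eqP; congr (nrm _ _ _).
apply/funext => z; rewrite mulr_sumr -big_split /=; apply: eq_bigr => k _.
have : 1 + t * th k != 0 by rewrite gt_eqF// ltr_pwDl// mulr_ge0// theta_ge0.
by rewrite /m; move: (th k) => x hx; field.
Qed.

End multipliers.

(** * Fractional multipliers *)

Section Rintegral_extra.
Context d (T : measurableType d) (R : realType) (mu : {measure set T -> \bar R}).

Lemma integrableZ_EFin c (h : T -> R) : mu.-integrable setT (EFin \o h) ->
  mu.-integrable setT (EFin \o (fun z => c * h z)).
Proof.
move=> ih; rewrite (_ : _ \o _ = fun z => c%:E * (EFin \o h) z)%E//.
exact: integrableZl.
Qed.

Lemma Rintegral_sum (I : Type) (r : seq I) (c : I -> R) (h : I -> T -> R) :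
  (forall i, mu.-integrable setT (EFin \o h i)) ->
  mu.-integrable setT (EFin \o (fun z => \sum_(i <- r) c i * h i z)) /\
  \int[mu]_z (\sum_(i <- r) c i * h i z) = \sum_(i <- r) c i * \int[mu]_z h i z.
Proof.
move=> ih; elim: r => [|i r [IH1 IH2]].
  rewrite big_nil (_ : (fun z => _) = fun=> 0); last first.
    by apply/funext => z; rewrite big_nil.
  split; first exact: integrable0.
  by rewrite /Rintegral integral0.
rewrite big_cons (_ : (fun z => \sum_(j <- i :: r) c j * h j z) =
    (fun z => c i * h i z + \sum_(j <- r) c j * h j z)); last first.
  by apply/funext => z; rewrite big_cons.
have ic : mu.-integrable setT (EFin \o (fun z => c i * h i z)).
  exact: integrableZ_EFin.
split; first exact: (integrableD measurableT ic IH1).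
by rewrite RintegralD// RintegralZl// IH2.
Qed.

End Rintegral_extra.

(** * Fractional powers of the eigenvalues from resolvents *)

Section fractional_multiplier.
Context {R : realType}.
Local Notation leb := (@lebesgue_measure R).
Implicit Types (x y s v : R).

Lemma integrable_expabs (de : R) : 0 < de ->
  leb.-integrable setT (EFin \o (fun y => expR (- de * `|y|))).
Proof.
move=> d0; have cf : continuous (fun y : R => expR (- de * `|y|)).
  move=> y; apply: (@continuous_comp _ _ _ (fun y : R => - de * `|y|) expR).
    by apply: cvgMr; exact: norm_continuous.
  exact: continuous_expR.
have mf : measurable_fun setT (fun y : R => expR (- de * `|y|)).
  exact: continuous_measurable_fun.
apply/integrableP; split; first exact/measurable_EFinP.
under eq_integral do rewrite /= ger0_norm ?expR_ge0//.
rewrite ge0_symfun_integralT//; last by move=> y /=; rewrite normrN.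
rewrite [X in (2 * X)%E](_ : _ = de^-1%:E) -?EFinM ?ltry//.
(* On the half line the integrand is [de^-1] times the density of the exponential law, of total mass
   1. *)
transitivity (\int[leb]_y (de^-1%:E * (exponential_pdf de y)%:E))%E.
  rewrite integral_mkcond; apply: eq_integral => y _.
  rewrite /patch /exponential_pdf /patch -set_itvcy.
  case: ifPn => [|] hy.
    rewrite -EFinM mulrA mulVf ?gt_eqF// mul1r ger0_norm//.
    by move: hy; rewrite inE /= in_itv /= andbT.
  by rewrite (_ : point = 0%E) // mule0.
rewrite ge0_integralZl//.
- by rewrite integral_exponential_pdf// mule1.
- by apply/measurable_EFinP; exact: (measurable_exponential_pdf de).
- by move=> y _; rewrite lee_fin exponential_pdf_ge0// ltW.
- by rewrite lee_fin invr_ge0 ltW.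
Qed.

Lemma integral_shift (f : R -> R) v : measurable_fun setT f -> (forall y, 0 <= f y) ->
  (\int[leb]_y (f (y + v)%R)%:E = \int[leb]_y (f y)%:E)%E.
Proof.
move=> mf f0; apply/esym.
pose PL := @mpush R _ _ (measurableTypeR R) (measurableTypeR R) leb _
  (measurable_shift v).
transitivity (\int[PL]_y (f y)%:E)%E.
  by apply: eq_measure_integral => A mA _; exact: (esym (lebesgue_measure_shift v mA)).
rewrite [LHS](@ge0_integral_pushforward _ _ (measurableTypeR R) (measurableTypeR R) R
  _ (measurable_shift v) leb setT (EFin \o f))//.
  exact/measurable_EFinP.
by move=> y _ /=; rewrite lee_fin.
Qed.

(** The integrand u^s / (1 + u)^m of the Beta integral for the measure du/u, with u = e^y: dilations
    of u become translations of y, under which Lebesgue measure is invariant. *)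
Definition mellin (m : nat) s y : R := expR (s * y) / (1 + expR y) ^+ m.

Lemma mellin_ge0 m s y : 0 <= mellin m s y.
Proof. by rewrite divr_ge0 ?exprn_ge0 ?addr_ge0 ?expR_ge0. Qed.

Lemma measurable_mellin m s : measurable_fun setT (mellin m s).
Proof.
apply: continuous_measurable_fun => y.
have c1 : {for y, continuous (fun y : R => expR (s * y))}.
  apply: (@continuous_comp _ _ _ (fun y : R => s * y) expR).
    by apply: cvgMr; exact: cvg_id.
  exact: continuous_expR.
apply: cvgM; first exact: c1.
apply: cvgV; first by rewrite expf_neq0// gt_eqF// ltr_pwDl// expR_ge0.
apply: (@continuous_comp _ _ _ (fun y : R => 1 + expR y) (fun y => y ^+ m)).
  by apply: cvgD; [exact: cvg_cst|exact: continuous_expR].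
exact: exprn_continuous.
Qed.

Lemma mellin_le m s de y : de <= s -> de <= m%:R - s -> mellin m s y <= expR (- de * `|y|).
Proof.
move=> d1 d2; have e0 := expR_ge0 y.
have p0 : 0 < 1 + expR y by rewrite ltr_pwDl.
rewrite ler_pdivrMr ?exprn_gt0//; have [y0|y0] := leP 0 y.
  rewrite ger0_norm//; apply: (@le_trans _ _ (expR (- de * y) * expR y ^+ m)).
    by rewrite -expRM_natl -expRD ler_expR; nra.
  by rewrite ler_wpM2l ?expR_ge0// lerXn2r ?nnegrE ?addr_ge0// lerDr.
rewrite ltr0_norm//; apply: (@le_trans _ _ (expR (- de * - y) * 1)).
  by rewrite mulr1 ler_expR; nra.
by rewrite ler_wpM2l ?expR_ge0// exprn_ege1// lerDl.
Qed.

Lemma mellin_integrable m s : 0 < s -> s < m%:R ->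
  leb.-integrable setT (EFin \o mellin m s).
Proof.
move=> s0 sm; pose de := Num.min s (m%:R - s).
have d0 : 0 < de by rewrite lt_min s0 subr_gt0.
apply: (le_integrable measurableT _ _ (integrable_expabs d0)) => /=.
  by apply/measurable_EFinP; exact: (measurable_mellin m s).
move=> y _; rewrite lee_fin (ger0_norm (mellin_ge0 _ _ _)) (ger0_norm (expR_ge0 _)).
  apply: mellin_le.
  by rewrite ge_min lexx.
by rewrite ge_min lexx orbT.
Qed.

Lemma mellin_shift_integrable m s v : 0 < s -> s < m%:R ->
  leb.-integrable setT (EFin \o (fun y => mellin m s (y + v))).
Proof.
move=> s0 sm; have mm := measurable_mellin m s.
have mv : measurable_fun setT (fun y => mellin m s (y + v)).
  by apply: (measurableT_comp mm); exact: measurable_shift.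
apply/integrableP; split; first exact/measurable_EFinP.
under eq_integral do rewrite /= ger0_norm ?mellin_ge0//.
rewrite integral_shift//; last by move=> y; exact: mellin_ge0.
have /integrableP[_] := mellin_integrable s0 sm.
by under eq_integral do rewrite /= ger0_norm ?mellin_ge0//.
Qed.

(** What matters about the Beta value is that one may divide by it; on [0, 1] the integrand is at
    least (1 + e)^-m. *)
Lemma mellin_gt0 m s : 0 < s -> s < m%:R -> 0 < \int[leb]_y mellin m s y.
Proof.
move=> s0 sm; have mi := mellin_integrable s0 sm.
pose c : R := ((1 + expR 1) ^+ m)^-1.
have c0 : 0 < c by rewrite invr_gt0 exprn_gt0// ltr_pwDl// expR_ge0.
apply: (lt_le_trans c0); rewrite -lee_fin /Rintegral fineK; last exact: integrable_fin_num.
have mm : measurable_fun setT (fun y => (mellin m s y)%:E).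
  by apply/measurable_EFinP; exact: (measurable_mellin m s).
apply: (@le_trans _ _ (\int[leb]_(y in `[0%R, 1%R]) (mellin m s y)%:E)%E); last first.
  apply: ge0_subset_integral => //; first by move=> y _; rewrite lee_fin mellin_ge0.
apply: (@le_trans _ _ (\int[leb]_(y in `[0%R, 1%R]) (cst c%:E y))%E).
  by rewrite integral_cst//= lebesgue_measure_itv /= lte_fin ltr01 oppr0 adde0 mule1.
apply: ge0_le_integral => //.
- by move=> y _; rewrite /cst lee_fin ltW.
- exact: measurable_funTS.
move=> y /=; rewrite in_itv /= => /andP[y0 y1]; rewrite lee_fin /c /mellin.
rewrite -[leLHS]mul1r ler_pM//.
- by rewrite -expR0 ler_expR mulr_ge0// ltW.
rewrite lef_pV2 ?posrE ?exprn_gt0 ?ltr_pwDl ?expR_ge0//.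
by rewrite lerXn2r ?nnegrE ?addr_ge0 ?expR_ge0// lerD2l ler_expR.
Qed.

Lemma mellin_scale m s x y : 0 < x -> x `^ s * mellin m s (y - ln x) =
  expR (s * y) * (x / (expR y + x)) ^+ m.
Proof.
move=> x0; rewrite /mellin expRB lnK ?posrE// mulrBr expRB.
have -> : expR (s * ln x) = x `^ s by rewrite /powR gt_eqF.
have e0 := expR_gt0 y; have xs : x `^ s != 0 by rewrite gt_eqF// powR_gt0.
rewrite -exprVn; have -> : (1 + expR y / x)^-1 = x / (expR y + x).
  by field; rewrite !gt_eqF ?addr_gt0.
by rewrite mulrA mulrCA mulfV// mulr1.
Qed.

(* With x k the k-th eigenvalue of an operator A and l k the pairing of a fixed
   function with the k-th component of u, the sum is the pairing with
   (1 - (1 + aA)^-1)^i (1 + bA)^-j u. *)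
Definition resb K (x l : nat -> R) A : Prop := forall a b i j, 0 < a -> 0 < b ->
  `|\sum_(k < K) (1 - (1 + a * x k)^-1) ^+ i * ((1 + b * x k)^-1) ^+ j * l k|
    <= 2 ^+ i * A.

Lemma resb_scale K (x l : nat -> R) A t : 0 < t -> resb K x l A -> resb K (fun k => t * x k) l A.
Proof.
move=> t0 H a b i j a0 b0.
by under eq_bigr do rewrite !mulrA; apply: H; rewrite mulr_gt0.
Qed.

(* mellin_scale expresses x^s / (1 + x)^m as an integral over y, since
   x / (e^y + x) = 1 - (1 + e^(-y) x)^-1. *)
Lemma frac_bound_open (m : nat) s : 0 < s -> s < m%:R ->
  exists2 C, 0 <= C & forall K (x l : nat -> R) A, 0 <= A -> (forall k, 0 <= x k) ->
    resb K x l A ->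
    `|\sum_(k < K) x k `^ s * ((1 + x k)^-1) ^+ m * l k| <= C * A.
Proof.
move=> s0 sm; have c0 := mellin_gt0 s0 sm; set c := Rintegral _ _ _ in c0.
pose de := Num.min s (m%:R - s).
have d0 : 0 < de by rewrite lt_min s0 subr_gt0.
have ds : de <= s by rewrite ge_min lexx.
have dm : de <= m%:R - s by rewrite ge_min lexx orbT.
have m0 : (0 < m)%N by rewrite -(ltr0n R) (lt_trans s0).
have Ei := integrable_expabs d0.
pose J := \int[leb]_y expR (- de * `|y|).
have J0 : 0 <= J by apply: Rintegral_ge0 => y _; exact: expR_ge0.
exists (c^-1 * (2 ^+ m * J)).
  by rewrite mulr_ge0 ?invr_ge0 ?(ltW c0)// mulr_ge0 ?exprn_ge0.
move=> K x l A A0 x0 H.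
pose g k y := expR (s * y) * (x k / (expR y + x k)) ^+ m.
have gE k y : 0 < x k -> g k y = x k `^ s * mellin m s (y + - ln (x k)).
  by move=> xk; rewrite /g -mellin_scale.
(* The eigenvalue 0 has no logarithm to translate by; there [g] vanishes because [m] is positive. *)
have gz k : x k = 0 -> g k = fun=> 0.
  by move=> xk; apply/funext => y; rewrite /g xk mul0r expr0n gtn_eqF// mulr0.
have gE' k : 0 < x k -> g k = fun y => x k `^ s * mellin m s (y + - ln (x k)).
  by move=> xk; apply/funext => y; exact: gE.
have gi k : leb.-integrable setT (EFin \o g k).
  have := x0 k; rewrite le_eqVlt => /predU1P[/esym xk|xk].
    by rewrite gz//; exact: integrable0.
  rewrite gE'//.
  have mi := mellin_shift_integrable (- ln (x k)) s0 sm.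
  exact: integrableZ_EFin.
have gI k : \int[leb]_y g k y = c * x k `^ s.
  have := x0 k; rewrite le_eqVlt => /predU1P[/esym xk|xk].
    by rewrite gz// xk powR0 ?gt_eqF// mulr0 /Rintegral integral0.
  rewrite gE'// RintegralZl//; last exact: mellin_shift_integrable.
  rewrite mulrC; apply: (congr1 (fun y => y * x k `^ s)).
  apply: (congr1 fine); apply: integral_shift; first exact: measurable_mellin.
  exact: mellin_ge0.
(* Exponential decay at both ends. For y <= 0 the factor e^(s y) is enough. For y > 0 the m-th power
   is exchanged between the two fractions: (1/(1 + x)) (x/(e^y + x)) = e^(-y) (x/(1 + x)) (e^y/(e^y
   + x)), which gains e^(-m y). *)
have key y : `|\sum_(k < K) ((1 + x k)^-1) ^+ m * l k * g k y| <=
    2 ^+ m * A * expR (- de * `|y|).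
  have ey : 0 < expR y by exact: expR_gt0.
  have x1 k : 1 + x k != 0 by rewrite gt_eqF// ltr_pwDl.
  have xe k : expR y + x k != 0 by rewrite gt_eqF// ltr_pwDl.
  have E1 k : 1 - (1 + (expR y)^-1 * x k)^-1 = x k / (expR y + x k).
    by move: (xe k) ey; set e := expR y => h1 h2; field; rewrite h1 gt_eqF.
  have E2 k : (1 + (expR y)^-1 * x k)^-1 = expR y / (expR y + x k).
    by move: (xe k) ey; set e := expR y => h1 h2; field; rewrite h1 gt_eqF.
  have E3 k : 1 - (1 + x k)^-1 = x k / (1 + x k).
    by move: (x1 k) => h1; field.
  have [y0|y0] := leP y 0.
    have h := H (expR y)^-1 1 m m _ ltr01; rewrite invr_gt0 in h; have {}h := h ey.
    rewrite (_ : \sum_(k < K) _ = expR (s * y) * (\sum_(k < K)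
       (1 - (1 + (expR y)^-1 * x k)^-1) ^+ m * (1 + 1 * x k)^-1 ^+ m * l k)); last first.
      by rewrite mulr_sumr; apply: eq_bigr => k _; rewrite E1 mul1r /g; ring.
    rewrite normrM (ger0_norm (expR_ge0 _)) mulrC ler_pM ?expR_ge0//.
    by rewrite ler_expR ler0_norm//; nra.
  have h := H 1 (expR y)^-1 m m ltr01 _; rewrite invr_gt0 in h; have {}h := h ey.
  rewrite (_ : \sum_(k < K) _ = expR (s * y) * expR (- (m%:R * y)) * (\sum_(k < K)
       (1 - (1 + 1 * x k)^-1) ^+ m * (1 + (expR y)^-1 * x k)^-1 ^+ m * l k)); last first.
    rewrite mulr_sumr; apply: eq_bigr => k _; rewrite E2 mul1r E3 /g.
    have em : expR (- (m%:R * y)) * (expR y) ^+ m = 1.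
      by rewrite expRN expRM_natl mulVf// expf_neq0// gt_eqF.
    rewrite !exprMn; transitivity (expR (s * y) * (expR (- (m%:R * y)) * expR y ^+ m)
      * (x k ^+ m * (1 + x k)^-1 ^+ m * (expR y + x k)^-1 ^+ m * l k)); last by ring.
    by rewrite em; ring.
  rewrite -expRD normrM (ger0_norm (expR_ge0 _)) mulrC ler_pM ?expR_ge0//.
  by rewrite ler_expR gtr0_norm//; nra.
have [i1 i2] := Rintegral_sum (index_enum 'I_K)
  (fun k : 'I_K => ((1 + x k)^-1) ^+ m * l k) (fun k : 'I_K => gi k).
have e : \sum_(k < K) x k `^ s * (1 + x k)^-1 ^+ m * l k = c^-1 *
    \int[leb]_y (\sum_(k < K) (1 + x k)^-1 ^+ m * l k * g k y).
  rewrite i2 mulr_sumr; apply: eq_bigr => k _; rewrite gI.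
  by field; rewrite gt_eqF.
rewrite e normrM ger0_norm ?invr_ge0 ?(ltW c0)// -!mulrA ler_wpM2l ?invr_ge0 ?(ltW c0)//.
rewrite (le_trans (le_normr_Rintegral measurableT i1))//.
apply: (@le_trans _ _ (\int[leb]_y (2 ^+ m * A * expR (- de * `|y|)))).
  apply: le_Rintegral => //.
    exact: (integrable_norm i1).
  exact: integrableZ_EFin.
by rewrite RintegralZl// -/J; lra.
Qed.

(** At the endpoints the Beta integral diverges, but the multiplier is already a power: (1 + x)^-m
    for s = 0, and (1 - (1 + x)^-1)^m for s = m. *)
Lemma frac_bound (m : nat) s : 0 <= s -> s <= m%:R ->
  exists2 C, 0 <= C & forall K (x l : nat -> R) A, 0 <= A -> (forall k, 0 <= x k) ->
    resb K x l A -> `|\sum_(k < K) x k `^ s * ((1 + x k)^-1) ^+ m * l k| <= C * A.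
Proof.
rewrite le_eqVlt => /predU1P[<- _|s0].
  exists 1 => // K x l A A0 x0 H; have := H 1 1 0%N m ltr01 ltr01.
  rewrite expr0; apply: le_trans; rewrite le_eqVlt; apply/orP; left; apply/eqP.
  by congr (`|_|); apply: eq_bigr => k _; rewrite powRr0 expr0 !mul1r.
rewrite le_eqVlt => /predU1P[->|]; last exact: frac_bound_open.
exists (2 ^+ m); first by rewrite exprn_ge0.
move=> K x l A A0 x0 H; have := H 1 1 m 0%N ltr01 ltr01.
apply: le_trans; rewrite le_eqVlt; apply/orP; left; apply/eqP.
congr (`|_|); apply: eq_bigr => k _; rewrite expr0 mulr1 mul1r powR_mulrn//.
rewrite -exprMn; congr (_ ^+ _ * _).
have : 1 + x k != 0 by rewrite gt_eqF// ltr_pwDl.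
by move=> h; field.
Qed.

(* Multiply x^a by 1 = sum_j C(m,j) x^j / (1+x)^m; the terms with j + a < b are
   bounded on l, the others are bounded multiples of x^b. *)
Lemma moment_bound a b : 0 < a -> a <= b ->
  exists2 C, 0 <= C & forall K (x l : nat -> R) A B t,
    0 <= A -> 0 <= B -> 0 < t -> (forall k, 0 <= x k) ->
    resb K x l A -> resb K x (fun k => x k `^ b * l k) B ->
    `|\sum_(k < K) x k `^ a * l k| <= C * (t `^ (b - a) * B + t `^ (- a) * A).
Proof.
move=> a0 ab; have b0 : 0 < b := lt_le_trans a0 ab.
pose m := Num.bound b.
have bm : b <= m%:R by apply/ltW/archi_boundP/ltW.
(* The exponent left after x^b has been split off whenever possible. It lies in [0, m]: either j + a
   < b <= m, or 0 <= j + a - b <= j <= m since a <= b. *)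
pose s (j : nat) : R := if j%:R + a < b then j%:R + a else j%:R + a - b.
have sb (j : 'I_m.+1) : 0 <= s j /\ s j <= m%:R.
  have jm : j%:R <= m%:R :> R by rewrite ler_nat -ltnS.
  have j0 : 0 <= j%:R :> R by [].
  by rewrite /s; case: ltP => h; split; lra.
have [Cf hCf] := choice (fun j : 'I_m.+1 =>
  let: ex_intro2 C p q := frac_bound (sb j).1 (sb j).2 in ex_intro _ C (conj p q)).
pose C := \sum_(j < m.+1) 'C(m, j)%:R * Cf j.
exists C; first by apply: sumr_ge0 => j _; rewrite mulr_ge0// (hCf j).1.
move=> K x l A B t A0 B0 t0 x0 HA HB.
(* Resolvent bounds hold for all parameters, hence survive scaling; converting y^a and y^b back to
   x^a and x^b produces the powers of [t]. *)
pose y k := t * x k.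
have y0 k : 0 <= y k by rewrite mulr_ge0// ltW.
have HyA := resb_scale t0 HA; have HyB := resb_scale t0 HB.
have tb0 := powR_ge0 t b.
have term (j : 'I_m.+1) :
    `|\sum_(k < K) y k `^ (j%:R + a) * ((1 + y k)^-1) ^+ m * l k| <=
    Cf j * (t `^ b * B + A).
  have [C0 hj] := hCf j; rewrite /s in hj; move: hj.
  case: ltP => hlt hj.
    by rewrite (le_trans (hj _ _ _ _ A0 y0 HyA))// ler_wpM2l// lerDr mulr_ge0.
  rewrite (_ : \sum_(k < K) _ = t `^ b * \sum_(k < K)
      y k `^ (j%:R + a - b) * ((1 + y k)^-1) ^+ m * (x k `^ b * l k)); last first.
    rewrite mulr_sumr; apply: eq_bigr => k _.
    have -> : y k `^ (j%:R + a) = y k `^ (j%:R + a - b) * (t `^ b * x k `^ b).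
      rewrite -powRM ?(ltW t0)// -powRD ?subrK//.
      by apply/implyP; rewrite gt_eqF// ltr_wpDl.
    by ring.
  rewrite normrM ger0_norm// (le_trans (ler_wpM2l tb0 (hj _ _ _ _ B0 y0 HyB)))//.
  by rewrite mulrCA ler_wpM2l// lerDl.
have e : \sum_(k < K) x k `^ a * l k = t `^ (- a) * \sum_(j < m.+1) 'C(m, j)%:R *
    \sum_(k < K) y k `^ (j%:R + a) * ((1 + y k)^-1) ^+ m * l k.
  under [in RHS]eq_bigr do rewrite mulr_sumr.
  rewrite exchange_big mulr_sumr; apply: eq_bigr => k _ /=.
  have y1 : 1 + y k != 0 by rewrite gt_eqF// ltr_pwDl.
  have xa : x k `^ a = t `^ (- a) * y k `^ a.
    rewrite powRM ?(ltW t0)// mulrA -powRD ?addNr ?powRr0 ?mul1r//.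
    by apply/implyP => _; rewrite gt_eqF.
  rewrite xa -!mulrA; congr (_ * _).
  have := exprDn 1 (y k) m; move/(congr1 (fun w => y k `^ a * ((1 + y k)^-1) ^+ m * l k * w)).
  rewrite mulr_sumr => h.
  transitivity (y k `^ a * (1 + y k)^-1 ^+ m * l k * (1 + y k) ^+ m).
    have : (1 + y k)^-1 ^+ m * (1 + y k) ^+ m = 1 by rewrite -exprMn mulVf// expr1n.
    move: (_ ^-1 ^+ m) ((1 + y k) ^+ m) => p q h1.
    transitivity (y k `^ a * l k * (p * q)); first by rewrite h1 mulr1.
    by ring.
  rewrite h; apply: eq_bigr => j _.
  rewrite expr1n mul1r powRD; last by apply/implyP; rewrite gt_eqF// ltr_wpDl.
  by rewrite powR_mulrn// -mulr_natl; ring.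
rewrite e normrM (ger0_norm (powR_ge0 _ _)).
have -> : C * (t `^ (b - a) * B + t `^ (- a) * A) = t `^ (- a) * (C * (t `^ b * B + A)).
  rewrite powRD; last by apply/implyP => _; rewrite gt_eqF.
  by ring.
rewrite ler_wpM2l ?powR_ge0// (le_trans (ler_norm_sum _ _ _))// /C mulr_suml.
apply: ler_sum => j _; rewrite normrM ger0_norm// -mulrA ler_wpM2l//.
Qed.

End fractional_multiplier.

(** * Density and duality *)

Section bounded_convergence.
Context d (T : measurableType d) (R : realType) (P : probability T R).
Implicit Types (f g h u : T -> R).

Lemma bm_abs f : bm f -> bm (fun z => `|f z|).
Proof.
move=> [mf [B hB]]; split; first exact: measurableT_comp.
by exists B => z; rewrite normr_id.
Qed.

Lemma bmB f g : bm f -> bm g -> bm (fun z => f z - g z).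
Proof.
move=> bf bg; have := bm_lin 1 (-1) bf bg.
by under eq_fun do rewrite mul1r mulN1r.
Qed.

Lemma bmD f g : bm f -> bm g -> bm (fun z => f z + g z).
Proof.
move=> bf bg; have := bm_lin 1 1 bf bg.
by under eq_fun do rewrite !mul1r.
Qed.

Definition dst f g : R := \int[P]_z `|f z - g z|.

Lemma bm_le_Rint f g : bm f -> bm g -> (forall z, f z <= g z) ->
  \int[P]_z f z <= \int[P]_z g z.
Proof. by move=> bf bg fg; apply: le_Rintegral => //; exact: bm_integrable. Qed.

Lemma Rint_cst c : \int[P]_z c = c.
Proof.
rewrite Rintegral_cst// (_ : fine _ = 1) ?mulr1//.
exact: (congr1 fine (@probability_setT _ _ _ P)).
Qed.

Lemma dst_triangle f g h : bm f -> bm g -> bm h -> dst f h <= dst f g + dst g h.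
Proof.
move=> bf bg bh; have b1 := bm_abs (bmB bf bg); have b2 := bm_abs (bmB bg bh).
rewrite /dst -RintegralD//; [|exact: bm_integrable|exact: bm_integrable].
apply: bm_le_Rint; [exact/bm_abs/bmB|exact: bmD|] => z.
by rewrite (le_trans _ (ler_normD _ _))// addrA subrK.
Qed.

Lemma dst_cvg (f_ : nat -> T -> R) f B : (forall n, measurable_fun setT (f_ n)) ->
  (forall n z, `|f_ n z| <= B) -> (forall z, f_ ^~ z @ \oo --> f z) ->
  measurable_fun setT f -> forall e, 0 < e -> exists n, dst f (f_ n) <= e.
Proof.
move=> mf_ bf_ cf mf e e0.
have [] := @dominated_convergence _ _ _ P setT measurableT
  (fun n z => (f_ n z)%:E) (EFin \o f) (fun=> B%:E).
- by move=> n; exact/measurable_EFinP.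
- exact/measurable_EFinP.
- by apply: aeW => z _; apply/fine_cvgP; split; [exact: nearW|exact: cf].
- exact: (finite_measure_integrable_cst P B measurableT).
- by apply: aeW => z n _; rewrite lee_fin.
move=> _ /fine_cvgP[_] /cvgr0Pnorm_lt /(_ e e0) [n _ hn] _.
exists n; have := hn n (leqnn n); rewrite /= => /ltW; apply: le_trans.
rewrite (le_trans _ (ler_norm _))// /dst /Rintegral le_eqVlt; apply/orP; left.
apply/eqP; congr fine; apply: eq_integral => z _.
by rewrite distrC.
Qed.

End bounded_convergence.

(** * Polynomials converging to a step function *)

Section power_estimates.
Context {R : realType}.
Implicit Types (x y r : R).

Lemma bernoulli_ge x k : -1 <= x -> 1 + k%:R * x <= (1 + x) ^+ k.
Proof.
move=> x1; elim: k => [|k IH]; first by rewrite mul0r addr0 expr0.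
have := ler_wpM2l (_ : 0 <= 1 + x) IH; rewrite -lerBlDl sub0r => /(_ x1) h.
rewrite exprS (le_trans _ h)// -natr1.
have : 0 <= k%:R * (x * x) by rewrite mulr_ge0// -expr2 sqr_ge0.
lra.
Qed.

(** With r = q^2, the Bernoulli inequality for 1/q bounds k q^k, and the remaining factor q^k tends
    to 0. *)
Lemma cvg_natmul_expr r : 0 <= r < 1 -> (fun k : nat => k%:R * r ^+ k) @ \oo --> (0 : R).
Proof.
move=> /andP[r0 r1]; pose q := Num.sqrt r.
have q0 : 0 <= q := sqrtr_ge0 _.
have q1 : q < 1 by rewrite -sqrtr1 ltr_sqrt.
have rq : r = q * q by rewrite -expr2 sqr_sqrtr.
have bd (k : nat) : k%:R * q ^+ k <= (1 - q)^-1.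
  move: q0; rewrite le_eqVlt => /predU1P[<-|q0].
    case: k => [|k]; first by rewrite mul0r invr_ge0 subr0.
    by rewrite expr0n /= mulr0 invr_ge0 subr0.
  have h := @bernoulli_ge (q^-1 - 1) k _; have {h} : 1 + k%:R * (q^-1 - 1) <= q ^- k.
    have -> : q ^- k = (1 + (q^-1 - 1)) ^+ k by rewrite addrC subrK exprVn.
    by apply: h; rewrite lerBrDr addNr invr_ge0 ltW.
  have qk : 0 < q ^+ k by rewrite exprn_gt0.
  move=> /(ler_wpM2r (ltW qk)); rewrite mulVf ?gt_eqF// => h.
  rewrite -[leRHS]mul1r ler_pdivlMr ?subr_gt0//.
  have e : k%:R * (q^-1 - 1) * q = k%:R * (1 - q).
    by rewrite -mulrA mulrBl mulVf ?gt_eqF// mul1r.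
  have k0 : 0 <= k%:R * (q^-1 - 1) by rewrite mulr_ge0// subr_ge0 invf_ge1// ltW.
  have : k%:R * (q^-1 - 1) * q ^+ k <= 1.
    by apply: le_trans h; rewrite ler_wpM2r// ?(ltW qk)// lerDr.
  move=> h2; rewrite mulrAC -e; apply: le_trans h2.
  by rewrite ler_wpM2r ?(ltW qk)// -[leRHS]mulr1 ler_wpM2l// ltW.
apply: (@squeeze_cvgr _ _ _ _ (fun=> 0) (fun k => (1 - q)^-1 * q ^+ k)).
- near=> k; rewrite mulr_ge0 ?exprn_ge0//= rq exprMn mulrA.
  by rewrite ler_wpM2r ?exprn_ge0.
- exact: cvg_cst.
- by have := @cvg_geometric _ (1 - q)^-1 q; apply; rewrite ger0_norm.
Unshelve. all: by end_near. Qed.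

(* The weight k in the exponent makes the limit at the threshold 1/2 equal to 0. *)
Lemma cvg_step y : 0 <= y <= 1 ->
  (fun k => (1 - y ^+ k) ^+ (k * 2 ^ k)) @ \oo --> ((y < 2^-1)%R%:R : R).
Proof.
move=> /andP[y0 y1].
have p0 k : 0 <= 1 - y ^+ k by rewrite subr_ge0 exprn_ile1.
have p1 k : 1 - y ^+ k <= 1 by rewrite gerBl exprn_ge0.
have e k : (k * 2 ^ k)%:R * y ^+ k = k%:R * (2 * y) ^+ k.
  by rewrite natrM natrX exprMn mulrA.
case: ltP => y2 /=.
  have r1 : 0 <= 2 * y < 1 by rewrite mulr_ge0//=; lra.
  apply: (@squeeze_cvgr _ _ _ _ (fun k => 1 - k%:R * (2 * y) ^+ k) (fun=> 1)).
  - near=> k; rewrite exprn_ile1// andbT -e -mulrN.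
    apply: bernoulli_ge.
    by rewrite lerNr opprK exprn_ile1.
  - by rewrite -[X in _ --> X]subr0; apply: cvgB; [exact: cvg_cst|exact: cvg_natmul_expr].
  - exact: cvg_cst.
(* With e = k 2^k as exponent, (1 - y^k)^e (1 + y^k)^e <= 1, while the Bernoulli inequality gives (1
   + y^k)^e >= 1 + k (2 y)^k >= 1 + k. *)
apply: (@squeeze_cvgr _ _ _ _ (fun=> 0) (fun k : nat => (k%:R + 1)^-1)).
- near=> k; rewrite exprn_ge0//=.
  have k1 : 0 < k%:R + 1 :> R by rewrite ltr_wpDl.
  rewrite -[leRHS]mul1r ler_pdivlMr//.
  have yk : 0 <= y ^+ k by rewrite exprn_ge0.
  apply: (@le_trans _ _ ((1 - y ^+ k) ^+ (k * 2 ^ k) * (1 + y ^+ k) ^+ (k * 2 ^ k))).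
    rewrite ler_wpM2l ?exprn_ge0//.
    have := @bernoulli_ge (y ^+ k) (k * 2 ^ k); rewrite e => h.
    apply: le_trans (h _); last by rewrite (le_trans _ yk)// lerN10.
    rewrite addrC lerD2l -[leLHS]mulr1 ler_wpM2l// exprn_ege1//.
    by rewrite mulrC -ler_pdivrMr// mul1r.
  rewrite -exprMn exprn_ile1//.
    by rewrite mulr_ge0// addr_ge0.
  have : 0 <= y ^+ k * y ^+ k by rewrite mulr_ge0.
  by rewrite mulrDr mulrBl mulr1; lra.
- exact: cvg_cst.
- have := @cvg_harmonic R; rewrite /harmonic.
  by under eq_fun do rewrite -natr1.
Unshelve. all: by end_near. Qed.

End power_estimates.

(** * L^1 approximation by spherical polynomials with values in [0, 1] *)

Section density.
Context {R : realType} {n : nat}.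
Local Notation N := (n.+1 + n.+1)%N.
Local Notation S := (csphere R n).
Local Notation P := (@sphere_measure R n).
Implicit Types (z : S) (f g u : S -> R).

Definition unitv f : Prop := measurable_fun setT f /\ forall z, 0 <= f z <= 1.

Lemma unitv_bm f : unitv f -> bm f.
Proof.
move=> [mf h]; split => //; exists 1 => z; have /andP[f0 f1] := h z.
by rewrite ger0_norm.
Qed.

(** Keeping the approximants in [0, 1] makes products stable; it also upgrades L^1 closeness to
    every finite exponent and provides uniform bounds. *)
Definition appr f : Prop := unitv f /\ forall e, 0 < e ->
  exists u, [/\ spoly u, forall z, 0 <= u z <= 1 & dst P f u <= e].

Lemma spoly_unitv u : spoly u -> (forall z, 0 <= u z <= 1) -> unitv u.
Proof. by move=> su u1; split => //; exact: spoly_measurable. Qed.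

Lemma spoly_appr u : spoly u -> (forall z, 0 <= u z <= 1) -> appr u.
Proof.
move=> su u1; split; first exact: spoly_unitv.
move=> e e0; exists u; split => //; rewrite /dst.
under eq_Rintegral do rewrite subrr normr0.
by rewrite Rint_cst ltW.
Qed.

Lemma appr_lim f : unitv f ->
  (forall e, 0 < e -> exists2 g, appr g & dst P f g <= e) -> appr f.
Proof.
move=> uf h; split => // e e0; have e2 : 0 < e / 2 by rewrite divr_gt0.
have [g [ug ag] fg] := h _ e2; have [u [su u1 gu]] := ag _ e2.
exists u; split => //.
have := dst_triangle P (unitv_bm uf) (unitv_bm ug) (unitv_bm (spoly_unitv su u1)).
by move: fg gu; lra.
Qed.

Lemma appr_cvg (f_ : nat -> S -> R) f : (forall k, appr (f_ k)) -> measurable_fun setT f ->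
  (forall z, f_ ^~ z @ \oo --> f z) -> appr f.
Proof.
move=> af mf cf; have u1 z : 0 <= f z <= 1.
  apply/andP; split.
    by apply: (cvgr_to_ge (cf z)); apply: nearW => k; have [[_ /(_ z) /andP[]]] := af k.
  by apply: (cvgr_to_le (cf z)); apply: nearW => k; have [[_ /(_ z) /andP[]]] := af k.
apply: appr_lim => // e e0.
have [k hk] := @dst_cvg _ _ _ P f_ f 1 (fun k => (af k).1.1)
  (fun k z => let: conj B hB := unitv_bm (af k).1 in
     etrans (congr1 (fun y => y <= 1) (ger0_norm (andP ((af k).1.2 z)).1))
        (andP ((af k).1.2 z)).2) cf mf e e0.
by exists (f_ k).
Qed.

Lemma apprM f g : appr f -> appr g -> appr (fun z => f z * g z).
Proof.
move=> [uf af] [ug ag]; have bf := unitv_bm uf; have bg := unitv_bm ug.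
split.
  split; first by apply: measurable_funM; [case: uf|case: ug].
  move=> z; have [/andP[f0 f1] /andP[g0 g1]] := (uf.2 z, ug.2 z).
  by rewrite mulr_ge0//= mulr_ile1.
move=> e e0; have e2 : 0 < e / 2 by rewrite divr_gt0.
have [u [su u1 fu]] := af _ e2; have [v [sv v1 gv]] := ag _ e2.
have bu := unitv_bm (spoly_unitv su u1); have bv := unitv_bm (spoly_unitv sv v1).
exists (fun z => u z * v z); split; first exact: spolyM.
  move=> z; have [/andP[f0 f1] /andP[g0 g1]] := (u1 z, v1 z).
  by rewrite mulr_ge0//= mulr_ile1.
apply: (@le_trans _ _ (dst P f u + dst P g v)); last by move: fu gv; lra.
have b1 := bm_abs (bmB bf bu); have b2 := bm_abs (bmB bg bv).
rewrite /dst -RintegralD//; [|exact: bm_integrable|exact: bm_integrable].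
apply: bm_le_Rint; [by apply/bm_abs/bmB; exact: bmM|exact: bmD|] => z.
have -> : f z * g z - u z * v z = (f z - u z) * g z + u z * (g z - v z) by ring.
rewrite (le_trans (ler_normD _ _))// !normrM lerD//.
  have /andP[g0 g1] := ug.2 z.
  by rewrite -[leRHS]mulr1 ler_wpM2l// ger0_norm.
have /andP[u0 u1'] := u1 z.
by rewrite -[leRHS]mul1r ler_wpM2r// ger0_norm.
Qed.

Lemma apprC f : appr f -> appr (fun z => 1 - f z).
Proof.
move=> [uf af]; split.
  split; first by apply: measurable_funB => //; case: uf.
  by move=> z; have /andP[f0 f1] := uf.2 z; rewrite subr_ge0 f1 gerBl f0.
move=> e e0; have [u [su u1 fu]] := af _ e0.
exists (fun z => 1 - u z); split.
- have := spoly_lin 1 (-1) (spoly_cst 1) su.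
  rewrite [X in spoly X](_ : _ = fun z => 1 - u z)//.
  by apply/funext => z; rewrite mul1r mulN1r.
- by move=> z; have /andP[u0 u1'] := u1 z; rewrite subr_ge0 u1' gerBl u0.
apply: le_trans fu; rewrite le_eqVlt; apply/orP; left; apply/eqP.
apply: eq_Rintegral => z _; rewrite -normrN; congr (`|_|); ring.
Qed.

Lemma appr_conv f g c : 0 <= c <= 1 -> appr f -> appr g ->
  appr (fun z => c * f z + (1 - c) * g z).
Proof.
move=> /andP[c0 c1] [uf af] [ug ag].
have bf := unitv_bm uf; have bg := unitv_bm ug.
have d0 : 0 <= 1 - c by rewrite subr_ge0.
have conv01 (x y : R) : 0 <= x <= 1 -> 0 <= y <= 1 -> 0 <= c * x + (1 - c) * y <= 1.
  by move=> /andP[x0 x1] /andP[y0 y1]; apply/andP; split; nra.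
split.
  split.
    apply: measurable_funD; apply: measurable_funM => //; first by case: uf.
    by case: ug.
  by move=> z; apply: conv01; [exact: uf.2|exact: ug.2].
move=> e e0; have e2 : 0 < e / 2 by rewrite divr_gt0.
have [u [su u1 fu]] := af _ e2; have [v [sv v1 gv]] := ag _ e2.
have bu := unitv_bm (spoly_unitv su u1); have bv := unitv_bm (spoly_unitv sv v1).
exists (fun z => c * u z + (1 - c) * v z); split; first exact: spoly_lin.
  by move=> z; exact: conv01.
apply: (@le_trans _ _ (dst P f u + dst P g v)); last by move: fu gv; lra.
have b1 := bm_abs (bmB bf bu); have b2 := bm_abs (bmB bg bv).
rewrite /dst -RintegralD//; [|exact: bm_integrable|exact: bm_integrable].
apply: bm_le_Rint; [by apply/bm_abs/bmB; exact: bm_lin|exact: bmD|] => z.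
have -> : c * f z + (1 - c) * g z - (c * u z + (1 - c) * v z) =
  c * (f z - u z) + (1 - c) * (g z - v z) by ring.
rewrite (le_trans (ler_normD _ _))// !normrM (ger0_norm c0) (ger0_norm d0).
rewrite lerD//; first by rewrite -[leRHS]mul1r ler_wpM2r.
by rewrite -[leRHS]mul1r ler_wpM2r// gerBl.
Qed.

Definition apprset (A : set S) : Prop := measurable A /\ appr (\1_A : S -> R).

(** On indicators, complements and intersections become [1 - f] and products, and countable unions
    are pointwise limits of finite ones. *)
Lemma apprset_sigma_algebra : sigma_algebra setT apprset.
Proof.
have C A : apprset A -> apprset (~` A).
  move=> [mA aA]; split; first exact: measurableC.
  rewrite (_ : (\1_(~` A) : S -> R) = fun z => 1 - \1_A z); first exact: apprC.
  by apply/funext => z; rewrite !indicE in_setC; case: (z \in A); rewrite /= ?subrr ?subr0.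
have I A B : apprset A -> apprset B -> apprset (A `&` B).
  move=> [mA aA] [mB aB]; split; first exact: measurableI.
  rewrite (_ : (\1_(A `&` B) : S -> R) = fun z => \1_A z * \1_B z); first exact: apprM.
  by apply/funext => z; rewrite !indicE in_setI; case: (z \in A); rewrite /= ?mul1r ?mul0r.
have z0 : apprset set0.
  split => //; rewrite (_ : \1_set0 = fun=> 0); last first.
    by apply/funext => z; rewrite indicE in_set0.
  by apply: spoly_appr; [exact: spoly_cst|move=> z; rewrite lexx ler01].
have U A B : apprset A -> apprset B -> apprset (A `|` B).
  by move=> hA hB; rewrite -[A `|` B]setCK setCU; apply/C/I; exact: C.
split => //; first by move=> A hA; rewrite setTD; exact: C.
move=> F hF; have mU : measurable (\bigcup_k F k).
  by apply: bigcupT_measurable => k; case: (hF k).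
split => //.
pose G k := \big[setU/set0]_(i < k) F i.
have hG k : apprset (G k).
  by rewrite /G; elim/big_ind: _ => // i _; exact: hF.
apply: (@appr_cvg (fun k => \1_(G k))) => [k||z].
- by case: (hG k).
- exact: measurable_indic.
have [zU|zU] := pselect ((\bigcup_k F k) z).
  have [k _ Fk] := zU; apply: cvg_near_cst; exists k.+1 => // j /= kj.
  rewrite !indicE (mem_set zU) mem_set//.
  rewrite /G -bigcup_mkord; exists k => //.
apply: cvg_near_cst; apply: nearW => j.
have zG : ~ G j z.
  by rewrite /G -bigcup_mkord => -[i _ Fi]; apply: zU; exists i.
by rewrite !indicE (memNset zU) (memNset zG).
Qed.

Lemma apprset_ray (i : 'I_N) c : apprset [set z | c < co z i].
Proof.
have mA : measurable [set z : S | c < co z i].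
  have := @measurable_co R n i measurableT _ (measurable_itv `]c, +oo[).
  rewrite setTI; congr measurable; apply/seteqP.
  by split => z /=; rewrite in_itv /= andbT.
split => //.
(* Chosen so that |co z i - c| <= D/2: then [y] takes values in [0, 1], and [y z < 2^-1] holds
   exactly on the half space. *)
pose D := 2 * (1 + `|c|).
have D0 : 0 < D by rewrite mulr_gt0// ltr_pwDl.
pose y z := 2^-1 - (co z i - c) / D.
have y01 z : 0 <= y z <= 1.
  have : `|(co z i - c) / D| <= 2^-1.
    rewrite normrM [X in _ * X]ger0_norm ?invr_ge0 ?(ltW D0)// ler_pdivrMr//.
    rewrite /D mulrA mulVf// mul1r (le_trans (ler_normB _ _))// lerD2r.
    exact: norm_co_le1.
  by rewrite ler_norml /y => /andP[h1 h2]; apply/andP; split; lra.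
have sy : spoly y.
  have := spoly_lin 1 (- D^-1) (spoly_cst (2^-1 + c / D)) (spoly_co i).
  rewrite [X in spoly X](_ : _ = y)//; apply/funext => z; rewrite /y; ring.
apply: (@appr_cvg (fun k z => (1 - y z ^+ k) ^+ (k * 2 ^ k))) => [k||z].
- apply: spoly_appr.
    have := spoly_lin 1 (-1) (spoly_cst 1) (spolyX k sy) => h.
    have := spolyX (k * 2 ^ k) h.
    rewrite [X in spoly X](_ : _ = fun z => (1 - y z ^+ k) ^+ (k * 2 ^ k))//.
    by apply/funext => z; rewrite mul1r mulN1r.
  move=> z; have /andP[y0 y1] := y01 z.
  have h0 : 0 <= 1 - y z ^+ k by rewrite subr_ge0 exprn_ile1.
  by rewrite exprn_ge0//= exprn_ile1// gerBl exprn_ge0.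
- exact: measurable_indic.
have := cvg_step (y01 z).
rewrite (_ : (y z < 2^-1)%R = (z \in [set z | c < co z i])) ?indicE//.
rewrite /y gtrBl pmulr_lgt0 ?invr_gt0// subr_gt0.
by apply/idP/idP => [h|]; [exact/mem_set|rewrite inE].
Qed.

(** The sphere is retyped with [apprset] as its sigma-algebra. The half spaces make the coordinates
    measurable for it, and they generate the Borel sets. *)
Lemma measurable_apprset (A : set S) : measurable A -> apprset A.
Proof.
have sA := apprset_sigma_algebra; have iA := sigma_algebra_id sA.
pose S' := g_sigma_algebraType apprset.
have mco (i : 'I_N) : measurable_fun [set: S'] (fun z : S' => co (z : S) i).
  apply: (measurability _ (RGenOInfty.measurableE R)) => _ [_ [c ->] <-].
  rewrite setTI /measurable /= iA.
  have := apprset_ray i c; congr apprset; apply/seteqP.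
  by split => z /=; rewrite in_itv /= andbT.
have mrc : measurable_fun [set: S'] (fun z : S' => rcoord (z : S)).
  apply/measurable_fun_tnthP => i.
  rewrite [X in measurable_fun _ X](_ : _ = fun z : S' => co (z : S) i)//.
  by apply/funext => z /=; rewrite tnth_mktuple.
move=> [B mB <-]; rewrite setTI.
by have := mrc measurableT B mB; rewrite setTI /measurable /= iA.
Qed.

(** The sum counts the positive integers up to x, that is, it is the integer part of x. *)
Lemma floor_count (x : R) k : 0 <= x -> x <= k%:R ->
  x - 1 <= \sum_(j < k) (j.+1%:R <= x)%R%:R <= x.
Proof.
have full (y : R) j : j%:R <= y -> \sum_(i < j) (i.+1%:R <= y)%R%:R = j%:R :> R.
  elim: j => [|j IH] h; first by rewrite big_ord0.
  rewrite big_ord_recr /= IH ?h ?natr1//; apply: le_trans h; by rewrite ler_nat.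
move=> x0; elim: k => [|k IH] xk.
  by rewrite big_ord0; move: xk; rewrite -[0%:R]/(0:R) => xk; apply/andP; split; lra.
rewrite big_ord_recr /=; case: (leP k.+1%:R x) => h /=.
  rewrite full; last by apply: le_trans h; rewrite ler_nat.
  by rewrite natr1; apply/andP; split; lra.
rewrite addr0; have [/IH//|/ltW kx] := leP x k%:R.
by rewrite full//; move: h; rewrite -natr1 => h; apply/andP; split; lra.
Qed.

Lemma appr_avg (f : nat -> S -> R) k : (forall j, appr (f j)) ->
  appr (fun z => k.+1%:R^-1 * \sum_(j < k.+1) f j z).
Proof.
move=> af; elim: k => [|k IH].
  rewrite (_ : (fun z => _) = f 0%N)//.
  by apply/funext => z; rewrite big_ord_recl big_ord0 addr0 invr1 mul1r.
pose c : R := k.+1%:R / k.+2%:R.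
have k1 : k.+1%:R != 0 :> R by rewrite pnatr_eq0.
have k2 : k.+2%:R != 0 :> R by rewrite pnatr_eq0.
have c01 : 0 <= c <= 1.
  by rewrite divr_ge0//= ler_pdivrMr ?ltr0n// mul1r ler_nat.
have := appr_conv c01 IH (af k.+1); congr appr; apply/funext => z.
rewrite [in RHS]big_ord_recr /= /c.
have e : 1 - k.+1%:R / k.+2%:R = k.+2%:R^-1 :> R.
  by rewrite -{1}(mulfV k2) -mulrBl -[k.+2%:R]natr1 addrC addKr mul1r.
rewrite e mulrA [_ / _ / _]mulrAC mulfV// mul1r -mulrDr.
by [].
Qed.

(** [f] is within 1/(k+1) of the average of the indicators of the sets j + 1 <= (k+1) f, each of
    them approximable. *)
Lemma unitv_appr f : unitv f -> appr f.
Proof.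
move=> uf; apply: appr_lim => // e e0.
have [k ke] : exists k, k.+1%:R^-1 <= e.
  exists (Num.bound e^-1); rewrite invf_ple ?posrE ?ltr0n//.
  have := archi_boundP (_ : 0 <= e^-1); rewrite invr_ge0 => /(_ (ltW e0)) /ltW h.
  by rewrite (le_trans h)// ler_nat.
pose A j := [set z | j.+1%:R <= k.+1%:R * f z].
have aA j : appr (\1_(A j) : S -> R).
  have mA : measurable (A j).
    rewrite -[X in measurable X]setTI; apply: measurable_fun_le => //.
    by apply: measurable_funM => //; case: uf.
  exact: (measurable_apprset mA).2.
have ag := appr_avg k aA; eexists; first exact: ag.
apply: le_trans ke.
apply: (@le_trans _ _ (\int[P]_(z in setT) k.+1%:R^-1)); last by rewrite Rint_cst.
apply: bm_le_Rint; [|exact: bm_cst|].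
  by apply/bm_abs/bmB; [exact: unitv_bm|exact: (unitv_bm ag.1)].
move=> z; have /andP[f0 f1] := uf.2 z.
have k0 : 0 < k.+1%:R :> R by [].
have := @floor_count (k.+1%:R * f z) k.+1 _ _.
rewrite mulr_ge0// => /(_ isT); rewrite -[X in _ <= X]mulr1 ler_wpM2l// => /(_ isT).
set sm := \sum_(j < k.+1) _ => /andP[h1 h2].
have -> : \sum_(j < k.+1) \1_(A j) z = sm.
  apply: eq_bigr => j _; rewrite indicE; congr (nat_of_bool _)%:R.
  by apply/idP/idP => [|h]; [rewrite inE|exact/mem_set].
have -> : f z - k.+1%:R^-1 * sm = k.+1%:R^-1 * (k.+1%:R * f z - sm).
  by rewrite mulrBr mulrA mulVf ?gt_eqF// mul1r.
rewrite normrM ger0_norm ?invr_ge0// -[leRHS]mulr1 ler_wpM2l ?invr_ge0//.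
by rewrite ger0_norm ?subr_ge0//; lra.
Qed.

End density.

Section integrals_and_norms.
Context d (T : measurableType d) (R : realType) (P : probability T R).
Implicit Types (f G : T -> R).

(** Absolute continuity of the integral with weights instead of sets: |G| splits into its truncation
    at M and an integrable rest of small integral. *)
Lemma int_small G e : P.-integrable setT (EFin \o G) -> 0 < e ->
  exists2 de, 0 < de & forall h : T -> R, measurable_fun setT h ->
    (forall z, 0 <= h z <= 1) -> \int[P]_z h z <= de ->
    \int[P]_z (`|G z| * h z) <= e.
Proof.
move=> iG e0; have mG : measurable_fun setT G.
  exact/measurable_EFinP/(measurable_int P iG).
have mA : measurable_fun setT (fun z => `|G z|) by exact: measurableT_comp.
have iA : P.-integrable setT (EFin \o (fun z => `|G z|)) := integrable_norm iG.
pose t (k : nat) z := Num.min `|G z| k%:R.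
have mt k : measurable_fun setT (t k) by exact: measurable_minr.
have e2 : 0 < e / 2 by rewrite divr_gt0.
have [] := @dominated_convergence _ _ _ P setT measurableT
  (fun k z => (t k z)%:E) (EFin \o (fun z => `|G z|)) (EFin \o (fun z => `|G z|)).
- by move=> k; exact/measurable_EFinP.
- exact/measurable_EFinP.
- apply: aeW => z _; apply: cvg_near_cst.
  exists (Num.bound `|G z|) => // k /= hk; congr (_%:E); apply/min_idPl.
  by rewrite (le_trans (ltW (archi_boundP (normr_ge0 (G z)))))// ler_nat.
- exact: iA.
- apply: aeW => z k _; rewrite lee_fin ger0_norm; first by rewrite ge_min lexx.
  by rewrite le_min normr_ge0 ler0n.
move=> _ /fine_cvgP[_] /cvgr0Pnorm_lt /(_ _ e2) [M _ hM] _.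
have {hM} := hM M (leqnn M); rewrite /= => hM.
pose D z := `|G z| - t M z.
have D0 z : 0 <= D z by rewrite subr_ge0 ge_min lexx.
have bt : bm (t M).
  split => //; exists M%:R => z; rewrite ger0_norm ?ge_min ?lexx ?orbT//.
  by rewrite le_min normr_ge0 ler0n.
have iD : P.-integrable setT (EFin \o D).
  exact: (integrableB measurableT iA (bm_integrable P bt)).
have hD : \int[P]_z D z <= e / 2.
  apply: ltW; apply: le_lt_trans hM; rewrite (le_trans _ (ler_norm _))//.
  rewrite /Rintegral le_eqVlt; apply/orP; left; apply/eqP; congr fine.
  apply: eq_integral => z _; congr EFin.
  by rewrite distrC (ger0_norm (D0 z)).
exists (e / 2 / (M%:R + 1)); first by rewrite divr_gt0// ltr_wpDl.
move=> h mh uh hde; have bh : bm h.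
  by split => //; exists 1 => z; have /andP[h0 h1] := uh z; rewrite ger0_norm.
have iGh := integrable_bmM iA bh.
have iMh : P.-integrable setT (EFin \o (fun z => M%:R * h z)).
  by apply: integrableZ_EFin; exact: bm_integrable.
apply: (@le_trans _ _ (\int[P]_z (D z + M%:R * h z))).
  apply: le_Rintegral => //; first exact: (integrableD measurableT iD iMh).
  move=> z _; have /andP[h0 h1] := uh z.
  have -> : `|G z| * h z = D z * h z + t M z * h z by rewrite /D; ring.
  rewrite lerD//; first by rewrite -[leRHS]mulr1 ler_wpM2l.
  by rewrite ler_wpM2r// ge_min lexx orbT.
rewrite RintegralD// RintegralZl//; last exact: bm_integrable.
have : M%:R * \int[P]_z h z <= (M%:R + 1) * (e / 2 / (M%:R + 1)).
  by rewrite ler_pM ?lerDl// Rintegral_ge0// => z _; case/andP: (uh z).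
rewrite mulrCA mulfV ?gt_eqF ?ltr_wpDl// mulr1.
by move: hD; lra.
Qed.

Lemma nrm_powR (r : R) f : 1 <= r -> bm f ->
  nrm P r%:E f `^ r = \int[P]_z (`|f z| `^ r).
Proof.
move=> r1 bf; have r0 : r != 0 by rewrite gt_eqF// (lt_le_trans ltr01).
rewrite /nrm -fine_poweR powR_Lnorm//.
Qed.

Lemma bm_powR f (r : R) : 0 <= r -> bm f -> bm (fun z => `|f z| `^ r).
Proof.
move=> r0 [mf [B hB]]; split; first exact/measurable_EFinP/measurable_normpowR.
exists (B `^ r) => z; rewrite ger0_norm ?powR_ge0// ge0_ler_powR ?nnegrE//.
exact: le_trans (hB z).
Qed.

(** Because |f| <= 1 and r >= 1, |f|^r <= |f|. *)
Lemma nrm_le_dst (r : R) f e : 1 <= r -> 0 <= e -> bm f -> (forall z, `|f z| <= 1) ->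
  \int[P]_z `|f z| <= e `^ r -> nrm P r%:E f <= e.
Proof.
move=> r1 e0 bf f1 h; have r0 : 0 < r := lt_le_trans ltr01 r1.
rewrite leNgt; apply/negP => lt.
have : e `^ r < nrm P r%:E f `^ r by rewrite gt0_ltr_powR// nnegrE nrm_ge0.
rewrite nrm_powR// => lt2.
suff : \int[P]_z (`|f z| `^ r) <= e `^ r by rewrite leNgt lt2.
apply: le_trans h; apply: bm_le_Rint; [exact: bm_powR (ltW r0) bf|exact: bm_abs|].
move=> z; have := f1 z; have : 0 <= `|f z| by [].
rewrite le_eqVlt => /predU1P[<- _|f0 fz]; first by rewrite powR0 ?gt_eqF.
by rewrite -[leRHS](powRr1 (ltW f0)) ger_powR// f0.
Qed.

End integrals_and_norms.

(** * Recovering L^p norms by testing against spherical polynomials *)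

Section duality.
Context {R : realType} {n : nat}.
Local Notation S := (csphere R n).
Local Notation P := (@sphere_measure R n).
Local Notation Ln q f := ('N[P]_q[EFin \o f])%E.
Implicit Types (z : S) (f g u G : S -> R).

(** Closeness in L^1 alone does not control the pairing with an unbounded [G]; the bound |f - u| <=
    1 does, through [int_small]. *)
Lemma test_approx G f e : P.-integrable setT (EFin \o G) -> unitv f -> 0 < e ->
  exists u, [/\ spoly u, forall z, 0 <= u z <= 1, dst P f u <= e &
    `|\int[P]_z (G z * f z)| <= `|\int[P]_z (G z * u z)| + e].
Proof.
move=> iG uf e0; have [de de0 hde] := int_small iG e0.
have m0 : 0 < Num.min e de by rewrite lt_min e0 de0.
have [_ /(_ _ m0) [u [su u1 fu]]] := unitv_appr uf.
have [fue fud] : dst P f u <= e /\ dst P f u <= de.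
  by move: fu; rewrite le_min => /andP.
exists u; split => //.
have uu := spoly_unitv su u1; have bf := unitv_bm uf; have bu := unitv_bm uu.
have uh : unitv (fun z => `|f z - u z|).
  split; first by case: (bm_abs (bmB bf bu)).
  move=> z; rewrite normr_ge0 /=; have /andP[f0 f1] := uf.2 z.
  by have /andP[u0 u1'] := u1 z; rewrite ler_norml; apply/andP; split; lra.
have hs := hde _ uh.1 uh.2 fud.
have i1 := integrable_bmM iG bf; have i2 := integrable_bmM iG bu.
have i3 := integrable_bmM iG (bmB bf bu).
have -> : \int[P]_z (G z * f z) =
    \int[P]_z (G z * u z) + \int[P]_z (G z * (f z - u z)).
  rewrite -RintegralD//; apply: eq_Rintegral => z _; ring.
rewrite (le_trans (ler_normD _ _))// lerD2l.
apply: le_trans hs; rewrite (le_trans (le_normr_Rintegral measurableT i3))//.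
rewrite le_eqVlt; apply/orP; left; apply/eqP; apply: eq_Rintegral => z _.
by rewrite normrM.
Qed.

Lemma test_fin G (q C : R) f : 1 <= q -> 0 <= C -> P.-integrable setT (EFin \o G) ->
  (forall u, spoly u -> `|\int[P]_z (G z * u z)| <= C * nrm P q%:E u) -> unitv f ->
  `|\int[P]_z (G z * f z)| <= C * nrm P q%:E f.
Proof.
move=> q1 C0 iG hG uf; have q0 : 0 < q := lt_le_trans ltr01 q1.
apply/ler_addgt0Pr => e e0.
pose et := Num.min 1 (e / (C + 1)).
have C1 : 0 < C + 1 by rewrite ltr_wpDl.
have et0 : 0 < et by rewrite lt_min ltr01 divr_gt0.
have et1 : et <= 1 by rewrite ge_min lexx.
have [u [su u1 fu h]] := test_approx iG uf (powR_gt0 q et0).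
apply: (le_trans h); have bf := unitv_bm uf.
have bu := unitv_bm (spoly_unitv su u1).
have nu : nrm P q%:E u <= nrm P q%:E f + et.
  have -> : u = (fun z => f z + (u z - f z)) by apply/funext => z; ring.
  rewrite (le_trans (nrmD P (_ : (1 <= q%:E)%E) bf (bmB bu bf)))// lerD2l.
  apply: nrm_le_dst => //; [exact: ltW|exact: bmB| |].
    move=> z; have /andP[f0 f1] := uf.2 z; have /andP[u0 u1'] := u1 z.
    by rewrite ler_norml; apply/andP; split; lra.
  apply: le_trans fu; rewrite le_eqVlt; apply/orP; left; apply/eqP.
  by apply: eq_Rintegral => z _; rewrite distrC.
have etq : et `^ q <= et.
  by rewrite -[leRHS](powRr1 (ltW et0)) ger_powR// et0.
have : C * nrm P q%:E u <= C * (nrm P q%:E f + et) by rewrite ler_wpM2l.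
have : (C + 1) * et <= e.
  by rewrite mulrC -ler_pdivlMr// ge_min lexx orbT.
by have := hG u su; move: etq; lra.
Qed.

(** The form used for the exponent infinity: L^1 approximation does not bring the supremum norms of
    f and u close, but 0 <= u <= 1 still bounds that of u by 1. *)
Lemma test_inf G q C f : (1 <= q)%E -> 0 <= C -> P.-integrable setT (EFin \o G) ->
  (forall u, spoly u -> `|\int[P]_z (G z * u z)| <= C * nrm P q u) -> unitv f ->
  `|\int[P]_z (G z * f z)| <= C.
Proof.
move=> q1 C0 iG hG uf; apply/ler_addgt0Pr => e e0.
have [u [su u1 fu h]] := test_approx iG uf e0.
apply: (le_trans h); rewrite lerD2r (le_trans (hG u su))//.
rewrite -[leRHS]mulr1 ler_wpM2l// nrm_bd//; first exact: spoly_measurable.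
by move=> z; have /andP[u0 u1'] := u1 z; rewrite ger0_norm.
Qed.

(** Tests have values in [0, 1], hence see one sign of [G] at a time; treating [- G] likewise costs
    a factor 2 in [dual_bound]. *)
Definition pos G z : R := Num.max (G z) 0.

Lemma measurable_pos G : measurable_fun setT G -> measurable_fun setT (pos G).
Proof. by move=> mG; exact: measurable_maxr. Qed.

Lemma pos_ge0 G z : 0 <= pos G z.
Proof. by rewrite le_max lexx orbT. Qed.

Lemma unitv_indic (A : set S) : measurable A -> unitv (\1_A : S -> R).
Proof.
move=> mA; split; first exact: measurable_indic.
by move=> z; rewrite indicE; case: (z \in A); rewrite /= ?lexx ?ler01.
Qed.

Lemma dual_bound1 G C : 0 <= C -> measurable_fun setT G ->
  P.-integrable setT (EFin \o G) ->
  (forall u, spoly u -> `|\int[P]_z (G z * u z)| <= C * nrm P +oo%E u) ->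
  (Ln 1%E (pos G) <= C%:E)%E.
Proof.
move=> C0 mG iG hG.
pose A := [set z | 0 <= G z].
have mA : measurable A.
  by rewrite -[X in measurable X]setTI; exact: measurable_fun_le.
have := test_inf _ C0 iG hG (unitv_indic mA); rewrite leey => /(_ isT) h.
have e z : G z * \1_A z = pos G z.
  rewrite indicE /pos; case: (leP 0 (G z)) => G0.
    by rewrite mem_set// mulr1.
  by rewrite memNset ?mulr0// /A /= leNgt G0.
rewrite Lnorm1; apply: (@le_trans _ _ (\int[P]_z (pos G z))%:E).
  rewrite /Rintegral fineK; last first.
    have i := integrable_bmM iG (unitv_bm (unitv_indic mA)).
    apply: integrable_fin_num => //; move: i; congr (is_true (P.-integrable _ _)).
    by apply/funext => z /=; rewrite e.
  rewrite le_eqVlt; apply/orP; left; apply/eqP; apply: eq_integral => z _.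
  by rewrite /= ger0_norm ?pos_ge0.
rewrite lee_fin; apply: le_trans h; rewrite (le_trans _ (ler_norm _))//.
by rewrite le_eqVlt; apply/orP; left; apply/eqP; apply: eq_Rintegral => z _.
Qed.

(** Tested on the set A where C <= G, the hypothesis makes the integral of (G - C) 1_A nonpositive;
    the integrand being nonnegative, it vanishes almost everywhere. *)
Lemma dual_boundy G C : 0 <= C -> measurable_fun setT G ->
  P.-integrable setT (EFin \o G) ->
  (forall u, spoly u -> `|\int[P]_z (G z * u z)| <= C * nrm P 1%E u) ->
  (Ln +oo%E (pos G) <= C%:E)%E.
Proof.
move=> C0 mG iG hG; rewrite Lnorm_yE; apply/ess_supP.
pose A := [set z | C <= G z].
have mA : measurable A.
  by rewrite -[X in measurable X]setTI; exact: measurable_fun_le.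
have uA := unitv_indic mA; have bA := unitv_bm uA.
have := test_fin (lexx 1) C0 iG hG uA => h.
have iGA := integrable_bmM iG bA.
have n1 : nrm P 1%E \1_A = \int[P]_z \1_A z.
  rewrite /nrm Lnorm1 /Rintegral; congr fine; apply: eq_integral => z _ /=.
  by rewrite ger0_norm// (andP (uA.2 z)).1.
rewrite n1 in h.
pose f z := (G z - C) * \1_A z.
have f0 z : 0 <= f z.
  rewrite /f indicE; have [zA|zA] := boolP (z \in A); last by rewrite mulr0.
  by rewrite mulr1 subr_ge0; move: zA; rewrite inE.
have iCA : P.-integrable setT (EFin \o (fun z => C * \1_A z)).
  by apply: integrableZ_EFin; exact: bm_integrable.
have fE : f = (fun z => G z * \1_A z - C * \1_A z).
  by apply/funext => z; rewrite /f; ring.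
have iF : P.-integrable setT (EFin \o f).
  by rewrite fE; exact: (integrableB measurableT iGA iCA).
have F0 : \int[P]_z f z = 0.
  apply/eqP; rewrite eq_le Rintegral_ge0 ?andbT; last by move=> z _; exact: f0.
  rewrite fE RintegralB// RintegralZl//; last exact: bm_integrable.
  rewrite subr_le0; apply: le_trans h; exact: ler_norm.
have mf : measurable_fun setT (EFin \o f) := measurable_int P iF.
have : (\int[P]_z `|(EFin \o f) z|)%E = 0%E.
  transitivity (\int[P]_z (f z)%:E)%E.
    by apply: eq_integral => z _; rewrite /= ger0_norm.
  by rewrite -(fineK (integrable_fin_num measurableT iF)) -/(Rintegral _ _ _) F0.
move=> /(ae_eq_integral_abs P measurableT mf).
apply: filterS => z /(_ I) /= [fz]; rewrite lee_fin ger0_norm ?pos_ge0//.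
rewrite /pos ge_max C0 andbT leNgt; apply/negP => CG.
have := fz; rewrite /f indicE mem_set; last by rewrite /A /= ltW.
by rewrite mulr1 => /eqP; rewrite subr_eq0 gt_eqF.
Qed.

Definition clip G (M : R) z : R := Num.min (pos G z) M.

(* Testing G against min(G^+, M)^(r - 1) bounds min(G^+, M) independently of M. *)
Lemma clip_bound G (r C M : R) : 1 < r -> 0 <= C -> 0 < M -> measurable_fun setT G ->
  P.-integrable setT (EFin \o G) ->
  (forall u, spoly u -> `|\int[P]_z (G z * u z)| <= C * nrm P (r / (r - 1))%:E u) ->
  \int[P]_z (clip G M z `^ r) <= C `^ r.
Proof.
move=> r1 C0 M0 mG iG hG; pose s := r / (r - 1).
have r10 : 0 < r - 1 by rewrite subr_gt0.
have r0 : 0 < r by rewrite (lt_trans ltr01).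
have s1 : 1 <= s by rewrite /s ler_pdivlMr// mul1r gerBl.
have s0 : 0 < s := lt_le_trans ltr01 s1.
pose g := clip G M.
have g0 z : 0 <= g z by rewrite le_min pos_ge0 ltW.
have gM z : g z <= M by rewrite ge_min lexx orbT.
have mg : measurable_fun setT g.
  by apply: measurable_minr => //; exact: measurable_pos.
have bg : bm g by split => //; exists M => z; rewrite ger0_norm.
have bgr a : 0 <= a -> bm (fun z => g z `^ a).
  move=> a0; have := bm_powR a0 bg.
  by under eq_fun do rewrite ger0_norm//.
pose X := \int[P]_z (g z `^ r).
(* Normalization that brings the test function g^(r - 1) into [0, 1]. *)
pose c := (M `^ (r - 1))^-1.
have c0 : 0 < c by rewrite invr_gt0 powR_gt0.
have uf : unitv (fun z => c * g z `^ (r - 1)).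
  split; first by apply: measurable_funM => //; case: (bgr _ (ltW r10)).
  move=> z; rewrite mulr_ge0 ?powR_ge0 ?(ltW c0)//= /c mulrC ler_pdivrMr ?powR_gt0//.
  by rewrite mul1r ge0_ler_powR ?nnegrE// ltW.
have := test_fin s1 C0 iG hG uf.
rewrite (nrmZ P c (_ : (1 <= s%:E)%E) (bgr _ (ltW r10)))// (gtr0_norm c0).
set w := nrm P s%:E _ => h.
have w0 : 0 <= w := nrm_ge0 _ _ _.
have wX : w `^ s = X.
  rewrite (nrm_powR P s1 (bgr _ (ltW r10))).
  apply: eq_Rintegral => z _; rewrite ger0_norm ?powR_ge0// -powRrM.
  by rewrite /s mulrCA mulfV ?mulr1// gt_eqF.
have ib := bm_integrable P (bgr r (ltW r0)).
have low : c * X <= C * (c * w).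
  apply: le_trans h; rewrite (le_trans _ (ler_norm _))//.
  rewrite /X -RintegralZl//; apply: le_Rintegral => //.
  - exact: integrableZ_EFin.
  - by apply: integrable_bmM => //; exact: unitv_bm.
  move=> z _; rewrite [leRHS]mulrCA ler_wpM2l ?(ltW c0)//.
  have [G0|G0] := leP (G z) 0.
    have -> : g z = 0.
      rewrite /g /clip /pos (max_idPr G0); apply/min_idPl; exact: ltW.
    by rewrite !powR0 ?mulr0 ?gt_eqF.
  rewrite -(mulr_powRB1 (g0 z) r0) ler_wpM2r ?powR_ge0//.
  by rewrite /g /clip /pos (max_idPl (ltW G0)) ge_min lexx.
(* As X = w^s, the inequality X <= C w becomes w^(s - 1) <= C, and s = (s - 1) r concludes. Clipping
   made w finite, so that it can be cancelled. *)
have {}low : w * w `^ (s - 1) <= C * w.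
  rewrite -(ler_pM2l c0) [leRHS]mulrCA; apply: le_trans low.
  rewrite -wX ler_wpM2l ?(ltW c0)//.
  have [->|wn0] := eqVneq w 0; first by rewrite mul0r powR_ge0.
  by rewrite mulr_powRB1.
rewrite -/g -/X -wX; move: w0; rewrite le_eqVlt => /predU1P[<-|w0].
  by rewrite powR0 ?gt_eqF// powR_ge0.
have : w `^ (s - 1) <= C by rewrite -(ler_pM2l w0) [leRHS]mulrC.
move=> h2; have -> : s = (s - 1) * r by rewrite /s; field; rewrite gt_eqF.
by rewrite powRrM ge0_ler_powR ?nnegrE ?powR_ge0 ?(ltW r0).
Qed.

Lemma dual_boundr G (r C : R) : 1 < r -> 0 <= C -> measurable_fun setT G ->
  P.-integrable setT (EFin \o G) ->
  (forall u, spoly u -> `|\int[P]_z (G z * u z)| <= C * nrm P (r / (r - 1))%:E u) ->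
  (Ln r%:E (pos G) <= C%:E)%E.
Proof.
move=> r1 C0 mG iG hG; have r0 : 0 < r by rewrite (lt_trans ltr01).
pose g (k : nat) z := clip G k.+1%:R z.
have g0 k z : 0 <= g k z by rewrite le_min pos_ge0 ler0n.
have mg k : measurable_fun setT (fun z => (g k z `^ r)%:E).
  rewrite (_ : (fun z => _) = fun z => (`|g k z| `^ r)%:E).
    apply: measurable_normpowR; apply: measurable_minr => //; exact: measurable_pos.
  by apply/funext => z; rewrite ger0_norm.
have := @cvg_monotone_convergence _ _ _ P setT measurableT
  (fun k z => (g k z `^ r)%:E) mg.
move=> /(_ (fun k z _ => powR_ge0 _ _)) cv.
have {}cv : (\int[P]_z (g k z `^ r)%:E)%E @[k --> \oo] -->
    (\int[P]_z (`|pos G z| `^ r)%:E)%E.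
  have -> : (\int[P]_z (`|pos G z| `^ r)%:E =
      \int[P]_z limn (fun k => (g k z `^ r)%:E))%E.
    apply: eq_integral => z _; apply/esym/cvg_lim => //; apply: cvg_near_cst.
    exists (Num.bound (pos G z)) => // k /= hk; congr (_%:E).
    rewrite ger0_norm ?pos_ge0//; congr (_ `^ _); apply/min_idPl.
    rewrite (le_trans (ltW (archi_boundP (pos_ge0 G z))))// ler_nat.
    exact: leq_trans hk _.
  apply: cv => z _ k l kl; rewrite lee_fin ge0_ler_powR ?nnegrE ?(ltW r0)//.
  by rewrite le_min !ge_min lexx /= ler_nat ltnS kl orbT.
have bd : (\int[P]_z (`|pos G z| `^ r)%:E <= (C `^ r)%:E)%E.
  apply: (cvge_to_le cv); apply: nearW => k.
  have := clip_bound r1 C0 (_ : 0 < k.+1%:R) mG iG hG; rewrite ltr0n => /(_ isT).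
  rewrite -lee_fin /Rintegral fineK//.
  apply: integrable_fin_num => //; apply: bm_integrable.
  have bg : bm (g k).
    split; first by apply: measurable_minr => //; exact: measurable_pos.
    by exists k.+1%:R => z; rewrite ger0_norm// ge_min lexx orbT.
  by have := bm_powR (ltW r0) bg; under eq_fun do rewrite ger0_norm//.
rewrite (LnormE P _ erefl).
have -> : C%:E = ((C `^ r)%:E `^ r^-1)%E.
  by rewrite poweR_EFin -powRrM mulfV ?gt_eqF// powRr1.
apply: gt0_ler_poweR => //.
- by rewrite invr_ge0 ltW.
- by rewrite in_itv /= leey andbT integral_ge0// => z _; rewrite lee_fin powR_ge0.
- by rewrite in_itv /= leey andbT lee_fin powR_ge0.
Qed.

Lemma dual_bound p G C : (1 <= p)%E -> 0 <= C -> measurable_fun setT G ->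
  (Ln p G < +oo)%E ->
  (forall u, spoly u -> `|\int[P]_z (G z * u z)| <= C * nrm P (dexp p) u) ->
  (Ln p G <= (C + C)%:E)%E.
Proof.
move=> p1 C0 mG Gy hG.
have one (F : S -> R) : measurable_fun setT F -> (Ln p F < +oo)%E ->
    (forall u, spoly u -> `|\int[P]_z (F z * u z)| <= C * nrm P (dexp p) u) ->
    (Ln p (pos F) <= C%:E)%E.
  move=> mF Fy hF; have iF := Lp_integrable p1 mF Fy.
  move: p1 Fy hF; case: p {Gy hG} => [r| |//] /= p1 Fy.
    case: eqP => [->|/eqP rn1] hF; first exact: dual_bound1.
    by apply: dual_boundr => //; rewrite lt_neqAle eq_sym rn1 -lee_fin.
  exact: dual_boundy.
have mN : measurable_fun setT (fun z => - G z) by exact: measurable_funN.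
have Ny : Ln p (fun z => (- G z)%R) = Ln p G.
  exact: (oppe_Lnorm P (EFin \o G) p).
have hN u : spoly u -> `|\int[P]_z (- G z * u z)| <= C * nrm P (dexp p) u.
  move=> su; have iG := Lp_integrable p1 mG Gy.
  have bu : bm u.
    by split; [exact: spoly_measurable|exact: spoly_bounded].
  have -> : \int[P]_z (- G z * u z) = - 1 * \int[P]_z (G z * u z).
    rewrite -RintegralZl//; last exact: integrable_bmM.
    by apply: eq_Rintegral => z _; rewrite mulN1r mulNr.
  by rewrite mulN1r normrN hG.
have h1 := one G mG Gy hG; have h2 := one _ mN; rewrite Ny in h2; have {}h2 := h2 Gy hN.
have -> : G = (pos G \+ (fun z => - pos (fun z => - G z) z))%R.
  apply/funext => z; rewrite /pos /=.
  by case: (leP (G z) 0) => h; case: (leP (- G z) 0) => h'; lra.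
have mP := measurable_pos mG; have mP' := measurable_pos mN.
have := eminkowski P mP (measurable_funN mP') p1.
rewrite (_ : Ln p (\- pos (fun z => (- G z)%R))%R = Ln p (pos (fun z => (- G z)%R))).
  by move=> h; rewrite (le_trans h)// EFinD leeD.
exact: (oppe_Lnorm P (EFin \o _) p).
Qed.

End duality.

(** * Eigenfunctions and the interpolation inequality *)

Section smooth_functions.
Context {R : realType} {n : nat}.
Local Notation N := (n.+1 + n.+1)%N.
Local Notation E := 'rV[R]_N.
Local Notation S := (csphere R n).
Implicit Types (z : S) (g : S -> R).

Lemma sproj_rvec z : sproj (cvec ((rvec (cval z) : E) 0)) = z.
Proof. by apply: co_inj => l; rewrite co_sproj1// (sum_co z). Qed.

Lemma hext_rvec g z : hext g (rvec (cval z)) = g z.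
Proof. by rewrite /hext sproj_rvec. Qed.

Lemma norm_coord_le1 (x : E) l : sqn x = 1 -> `|x 0 l| <= 1.
Proof.
move=> x1; rewrite -(@ler_pXn2r _ 2)// ?nnegrE// expr1n real_normK ?num_real//.
by rewrite -x1 /sqn (bigD1 l) //= lerDl sumr_ge0// => *; exact: sqr_ge0.
Qed.

Lemma continuous_bounded g : (forall x : E, x != 0 -> {for x, continuous (hext g)}) ->
  exists B, forall z, `|g z| <= B.
Proof.
move=> cg; pose K := [set x : E | sqn x = 1].
have cK : compact K.
  apply: bounded_closed_compact.
    exists 1; split; first exact: num_real.
    move=> M M1 x /= x1; rewrite [leLHS]/Num.norm /= mx_normrE.
    apply/bigmax_leP; split; first by rewrite (le_trans ler01)// ltW.
    by move=> [i l] _ /=; rewrite ord1 (le_trans (norm_coord_le1 l x1))// ltW.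
  have -> : K = sqn @^-1` [set 1] by [].
  by apply: closed_comp => [x _|]; [exact: continuous_sqn|exact: closed_eq].
have : compact (hext g @` K).
  apply: continuous_compact => //; apply: continuous_in_subspaceT => x.
  rewrite inE /K /= => x1; apply: cg; apply/eqP => x0.
  move: x1; rewrite x0 /sqn big1; last by move=> l _; rewrite mxE expr0n.
  by move/eqP; rewrite eq_sym oner_eq0.
move=> /compact_bounded [M [_ hM]]; exists (M + 1) => z.
have := hM (M + 1); rewrite ltrDl ltr01 => /(_ isT (g z)); apply.
by exists (rvec (cval z)); [exact: sqn_rvec|exact: hext_rvec].
Qed.

(** A grid of mesh 1/(k+1) on the cube, used to show that continuous functions are measurable for
    the trace sigma-algebra. Grid points are in general off the sphere, hence [hext]; cells are
    half-open, so the coordinate 1 requires one extra cell per axis. *)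
Definition gridpt (k : nat) (v : {ffun 'I_N -> 'I_(k.+1 + k.+1).+1}) : E :=
  \row_l (-1 + (v l)%:R / k.+1%:R).

Definition gridind (k : nat) (v : {ffun 'I_N -> 'I_(k.+1 + k.+1).+1}) z : R :=
  \prod_l \1_(`[(v l)%:R, (v l).+1%:R[%classic) (k.+1%:R * (co z l + 1)).

Definition gridfun g k z : R := \sum_v hext g (gridpt v) * @gridind k v z.

Lemma measurable_gridfun g k : measurable_fun setT (gridfun g k).
Proof.
apply: measurable_sum => v; apply: measurable_funM => //.
apply: measurable_prod => l _.
have m1 : measurable_fun setT (\1_(`[(v l)%:R, (v l).+1%:R[%classic) : R -> R).
  by apply: measurable_indic; exact: measurable_itv.
have m2 : measurable_fun setT (fun z : S => k.+1%:R * (co z l + 1)).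
  by apply: measurable_funM => //; apply: measurable_funD => //; exact: measurable_co.
exact: (measurableT_comp m1 m2).
Qed.

Lemma gridfunE g k z : exists2 x : E, gridfun g k z = hext g x &
  forall l, `|x 0 l - co z l| <= k.+1%:R^-1.
Proof.
have k0 : 0 < k.+1%:R :> R by [].
pose y l := k.+1%:R * (co z l + 1).
have hz l := norm_co_le1 z l.
have y0 l : 0 <= y l.
  by have := hz l; rewrite ler_norml => /andP[h1 h2]; rewrite mulr_ge0//; lra.
have y2 l : y l <= (k.+1 + k.+1)%:R.
  have := hz l; rewrite ler_norml => /andP[h1 h2].
  by rewrite natrD /y; move: k0; set c := k.+1%:R => c0; nra.
have yt l := truncn_itv (y0 l).
have tl l : (Num.truncn (y l) < (k.+1 + k.+1).+1)%N.
  by rewrite ltnS -(ler_nat R); apply: le_trans (y2 l); case/andP: (yt l).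
pose v : {ffun 'I_N -> 'I_(k.+1 + k.+1).+1} := [ffun l => Ordinal (tl l)].
exists (gridpt v).
  rewrite /gridfun (bigD1 v) //= big1 ?addr0; last first.
    move=> w wv; have [l wl] : exists l, w l != v l.
      apply/existsP; rewrite -negb_forall; apply: contra wv => /forallP h.
      by apply/eqP/ffunP => l; apply/eqP.
    rewrite /gridind (bigD1 l) //= indicE memNset ?mul0r ?mulr0//.
    rewrite /= in_itv /= => /truncn_def e; move: wl; rewrite ffunE => /negP; apply.
    by apply/eqP/val_inj => /=; rewrite -e.
  rewrite /gridind big1 ?mulr1// => l _; rewrite indicE mem_set//= in_itv /= ffunE /=.
  exact: yt.
move=> l; rewrite mxE ffunE /=; have /andP[h1 h2] := yt l.
have -> : -1 + (Num.truncn (y l))%:R / k.+1%:R - co z l =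
    ((Num.truncn (y l))%:R - y l) / k.+1%:R.
  rewrite /y; move: (Num.truncn _)%:R k0 => q; set c := k.+1%:R => c0.
  by clearbody c; rewrite mulrBl [c * _]mulrC mulfK ?gt_eqF//; lra.
rewrite normrM [X in _ * X]ger0_norm ?invr_ge0// -[leRHS]mul1r ler_wpM2r ?invr_ge0//.
by move: h2; rewrite -natr1 => h2; rewrite ler_norml; apply/andP; split; lra.
Qed.

Lemma continuous_measurable g : (forall x : E, x != 0 -> {for x, continuous (hext g)}) ->
  measurable_fun setT g.
Proof.
move=> cg; apply: (measurable_fun_cvg (fun k => measurable_gridfun g k)) => z _.
apply/cvgrPdist_le => e e0.
have := cg _ (rvec_neq0 z) => /cvgrPdist_le /(_ e e0) /nbhs_ballP.
move=> [r /= r0]; rewrite mx_norm_ball => hr.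
have : (fun k => k.+1%:R^-1 : R) @ \oo --> (0 : R) by exact: cvg_harmonic.
move=> /cvgr0Pnorm_lt /(_ r r0) [M _ hM]; exists M => // k Mk.
have [x -> hx] := gridfunE g k z; rewrite -(hext_rvec g z).
apply: hr; rewrite /ball_ /=; apply: le_lt_trans (hM k Mk).
rewrite [leRHS]ger0_norm ?invr_ge0// [leLHS]/Num.norm /= mx_normrE.
apply/bigmax_leP; split; first by rewrite invr_ge0.
by move=> [i l] _ /=; rewrite ord1 mxE [(- x) _ _]mxE distrC; exact: hx.
Qed.

Lemma smooth_bm (Y : S -> R[i]) : smooth Y ->
  bm (fun z => complex.Re (Y z)) /\ bm (fun z => complex.Im (Y z)).
Proof.
move=> /(_ 0%N) [[cr _] [ci _]].
by split; split; [exact: continuous_measurable|exact: continuous_bounded|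
  exact: continuous_measurable|exact: continuous_bounded].
Qed.

(** The bridge to the statement: eigenfunctions in the sense of [eigen] can be expanded in the given
    basis [Y]. *)
Lemma eigen_LB k (u : S -> R) : eigen k u ->
  LB_eigenspace (theta (2 * n.+1 - 1) k) (fun z => (u z)%:C%C).
Proof.
move=> [_ _ ru lu _]; split.
  move=> j; split; first exact: radial_is_Ck.
  by apply: radial_is_Ck; exact: radial_cst.
move=> z; rewrite /laplace_beltrami.
have -> : laplacian (fun x => complex.Im (homog_ext (fun z => (u z)%:C%C) x))
    (rvec (cval z)) = 0.
  have e (i : 'I_N) : 'D_(delta_mx 0 i) (fun=> 0 : R) = (fun=> 0 : R) :> (E -> R).
    by apply/funext => x; exact: derive_cst.
  apply: big1 => i _; rewrite -[X in 'D_(_) X _ = _]/('D_(delta_mx 0 i) (fun=> 0 : R)).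
  by rewrite e; exact: derive_cst.
rewrite -rmorphM -(lu z) rmorphN.
by [].
Qed.

End smooth_functions.

(** * Optimization over the scale *)

Section moment_inequality.
Context {R : realType}.
Implicit Types a b t X D h f x r : R.

Lemma powR_inv_exp x r : 0 < x -> r != 0 -> (x `^ r^-1) `^ r = x.
Proof. by move=> x0 r0; rewrite -powRrM mulVf// powRr1// ltW. Qed.

(* The choice t = (f / h)^(1/b) equalizes the two terms. *)
Lemma optimize_scale a b X D h f : 0 < a -> a <= b -> 0 <= D -> 0 <= h -> 0 <= f ->
  (forall t, 0 < t -> X <= D * (t `^ (b - a) * h + t `^ (- a) * f)) ->
  X <= D *+ 2 * (h `^ (a / b) * f `^ (1 - a / b)).
Proof.
move=> a0 ab D0 h0 f0 H; have b0 : 0 < b := lt_le_trans a0 ab.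
have r0 : 0 < a / b by rewrite divr_gt0.
have := H 1 ltr01; rewrite !powR1 !mul1r => H1.
have [h00|hn0] := eqVneq h 0.
  rewrite h00 powR0 ?gt_eqF// mul0r mulr0 leNgt; apply/negP => X0.
  rewrite h00 add0r in H1; have Df : 0 < D * f := lt_le_trans X0 H1.
  (* If h = 0 the remaining term tends to 0 as t grows; with t^a = [y] it equals X/2, contradicting
     X > 0. *)
  pose y := D * f *+ 2 / X.
  have y0 : 0 < y by rewrite divr_gt0// mulrn_wgt0.
  have := H (y `^ a^-1) (powR_gt0 _ y0).
  rewrite h00 mulr0 add0r powRN powR_inv_exp// ?gt_eqF// mulrCA.
  rewrite /y invf_div mulr2n; move: Df; set c := D * f => c0.
  rewrite [X / (c + c)](_ : _ = X / 2 / c); last by field; rewrite !gt_eqF//; lra.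
  by rewrite divfK ?gt_eqF//; lra.
have hp : 0 < h by rewrite lt_neqAle eq_sym hn0.
have [f00|fn0] := eqVneq f 0.
  (* If f = 0 and a = b, the last factor is 0^0 = 1 and the bound at t = 1 suffices. If a < b that
     factor is 0, and t is taken small enough for the remaining term to be X/2. *)
  have [eab|nab] := eqVneq a b.
    rewrite f00 eab mulfV ?gt_eqF// subrr powRr1// powRr0 mulr1.
    move: H1; rewrite f00 addr0 => H1; rewrite (le_trans H1)// mulr2n mulrDl.
    by rewrite lerDl mulr_ge0.
  have ba : 0 < b - a by rewrite subr_gt0 lt_neqAle nab.
  rewrite f00 [0 `^ _]powR0; last by rewrite subr_eq0 eq_sym; apply: contra nab => /eqP e;
    rewrite -(divfK (lt0r_neq0 b0) a) e mul1r.
  rewrite !mulr0 leNgt; apply/negP => X0.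
  rewrite f00 addr0 in H1; have Dh : 0 < D * h := lt_le_trans X0 H1.
  pose y := X / (D * h *+ 2).
  have y0 : 0 < y by rewrite divr_gt0// mulrn_wgt0.
  have := H (y `^ (b - a)^-1) (powR_gt0 _ y0).
  rewrite f00 mulr0 addr0 powR_inv_exp// ?gt_eqF// mulrCA.
  rewrite /y mulr2n; move: Dh; set c := D * h => c0.
  rewrite [X / (c + c)](_ : _ = X / 2 / c); last by field; rewrite !gt_eqF//; lra.
  by rewrite divfK ?gt_eqF//; lra.
have fp : 0 < f by rewrite lt_neqAle eq_sym fn0.
pose y := f / h.
have y0 : 0 < y by rewrite divr_gt0.
have := H (y `^ b^-1) (powR_gt0 _ y0); rewrite -!powRrM.
have yE s : y `^ s = f `^ s * h `^ (- s).
  by rewrite /y powRM ?invr_ge0// -powR_inv1// -powRrM mulN1r.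
have pD x s u : 0 < x -> x `^ s * x `^ u = x `^ (s + u).
  by move=> x0; rewrite powRD//; apply/implyP => _; rewrite gt_eqF.
have e1 : b^-1 * (b - a) = 1 - a / b by field; rewrite gt_eqF.
have e2 : b^-1 * (- a) = - (a / b) by field; rewrite gt_eqF.
rewrite e1 e2 !yE opprK opprB.
have -> : f `^ (1 - a / b) * h `^ (a / b - 1) * h = h `^ (a / b) * f `^ (1 - a / b).
  by rewrite -[X in _ * X = _](powRr1 (ltW hp)) -mulrA pD// subrK mulrC.
have -> : f `^ (- (a / b)) * h `^ (a / b) * f = h `^ (a / b) * f `^ (1 - a / b).
  by rewrite -[X in _ * X = _](powRr1 (ltW fp)) mulrAC pD// [- _ + 1]addrC mulrC.
by rewrite -mulr2n mulrnAr -mulrnAl.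
Qed.

End moment_inequality.

(** * The multiplicative inequality for real functions *)

Section real_interpolation.
Context {R : realType} {n : nat}.
Local Notation S := (csphere R n).
Local Notation th := (theta (2 * n.+1 - 1) : nat -> R).
Local Notation P := (@sphere_measure R n).
Local Notation Ln q f := ('N[P]_q[EFin \o f])%E.
Implicit Types (p : \bar R) (z : S) (F G H u : S -> R).

Lemma Rintegral_decomp p F (l : nat -> R) K (v : nat -> S -> R) : (1 <= p)%E ->
  measurable_fun setT F -> (Ln p F < +oo)%E -> (forall k, eigen k (v k)) ->
  \int[P]_z (F z * msum l K v z) = \sum_(k < K) l k * \int[P]_z (F z * v k z).
Proof.
move=> p1 mF Fy hv; have iF := Lp_integrable p1 mF Fy.
have [_ <-] := @Rintegral_sum _ S R P 'I_K (index_enum 'I_K) (fun k => l k)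
  (fun k z => F z * v k z) (fun k => integrable_bmM iF (eigen_bm (hv k))).
by apply: eq_Rintegral => z _; rewrite mulr_sumr; apply: eq_bigr => k _; rewrite mulrCA.
Qed.

Lemma msum1 K (v : nat -> S -> R) : msum (fun=> 1) K v =1 fun z => \sum_(k < K) v k z.
Proof. by move=> z; apply: eq_bigr => k _; rewrite mul1r. Qed.

(** The operators act on the sum of the [v k]: each resolvent is a contraction for the conjugate
    exponent, each factor [1 - resolvent] costs 2, and the Hoelder inequality pairs the result with
    [F]. *)
Lemma resb_Rintegral p F K (v : nat -> S -> R) : (1 <= p)%E ->
  measurable_fun setT F -> (Ln p F < +oo)%E -> (forall k, eigen k (v k)) ->
  resb K th (fun k => \int[P]_z (F z * v k z))
    (nrm P p F * nrm P (dexp p) (fun z => \sum_(k < K) v k z)).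
Proof.
move=> p1 mF Fy hv a b i j a0 b0; have q1 := dexp_ge1 p1.
pose m k := (1 - (1 + a * th k)^-1) ^+ i * ((1 + b * th k)^-1) ^+ j.
rewrite -(Rintegral_decomp m K p1 mF Fy hv).
have mm : @mult R n (dexp p) m (2 ^+ i * 1 ^+ j).
  apply: multM; first by rewrite exprn_ge0.
    have -> : 2 = 1 + 1 :> R by [].
    by apply: multX => //; apply: multB1 => //; apply: mult_res => //; exact: ltW.
  by apply: multX => //; apply: mult_res => //; exact: ltW.
apply: le_trans (Rint_bd p1 mF Fy (msum_bm m K hv)) _.
rewrite mulrCA ler_wpM2l ?nrm_ge0//.
by have := mm K v hv; rewrite expr1n mulr1.
Qed.

Lemma real_interpolation (a b : R) : 0 < a -> a <= b ->
  exists2 C, 0 <= C & forall p F G H, (1 <= p)%E ->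
    measurable_fun setT F -> measurable_fun setT G -> measurable_fun setT H ->
    (Ln p F < +oo)%E -> (Ln p G < +oo)%E -> (Ln p H < +oo)%E ->
    (forall k u, eigen k u -> \int[P]_z (G z * u z) = th k `^ a * \int[P]_z (F z * u z)) ->
    (forall k u, eigen k u -> \int[P]_z (H z * u z) = th k `^ b * \int[P]_z (F z * u z)) ->
    nrm P p G <= C * (nrm P p H `^ (a / b) * nrm P p F `^ (1 - a / b)).
Proof.
move=> a0 ab; have [C C0 hC] := moment_bound a0 ab.
(* One doubling comes from the positive and negative parts in [dual_bound], the other from the
   optimization over t. *)
exists (C *+ 2 *+ 2); first by rewrite !mulrn_wge0.
move=> p F G H p1 mF mG mH Fy Gy Hy hG hH.
apply: optimize_scale => //; rewrite ?nrm_ge0 ?mulrn_wge0// => t t0.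
rewrite -lee_fin -nrmE// mulr2n mulrDl.
apply: (dual_bound p1) => //.
  by rewrite mulr_ge0// addr_ge0// mulr_ge0 ?powR_ge0 ?nrm_ge0.
move=> u /spoly_decomp [K [v hv uE]].
have -> : u = fun z => \sum_(k < K) v k z by exact/funext.
set q := nrm P (dexp p) _.
have -> : \int[P]_z (G z * \sum_(k < K) v k z) =
    \sum_(k < K) th k `^ a * \int[P]_z (F z * v k z).
  transitivity (\int[P]_z (G z * msum (fun=> 1) K v z)).
    by apply: eq_Rintegral => z _; rewrite msum1.
  rewrite (Rintegral_decomp (fun=> 1) K p1 mG Gy hv).
  by apply: eq_bigr => k _; rewrite mul1r; exact: hG.
have rF := resb_Rintegral K p1 mF Fy hv.
have rH := resb_Rintegral K p1 mH Hy hv.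
have {}rH : resb K th (fun k => th k `^ b * \int[P]_z (F z * v k z)) (nrm P p H * q).
  have e : (fun k => \int[P]_z (H z * v k z)) =
      (fun k => th k `^ b * \int[P]_z (F z * v k z)) by apply/funext => k; exact: hH.
  by rewrite e in rH.
have q0 : 0 <= q := nrm_ge0 _ _ _.
have := hC K th _ _ _ t (mulr_ge0 (nrm_ge0 P p F) q0) (mulr_ge0 (nrm_ge0 P p H) q0)
  t0 (@theta_ge0 R n) rF rH.
by rewrite !mulrA -mulrDl mulrA.
Qed.

End real_interpolation.

(** * Complex functions and the given orthonormal bases *)

Section complex_functions.
Context {R : realType} {n : nat}.
Local Notation S := (csphere R n).
Local Notation th := (theta (2 * n.+1 - 1) : nat -> R).
Local Notation P := (@sphere_measure R n).
Local Notation Ln q f := ('N[P]_q[EFin \o f])%E.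
Local Notation Re := complex.Re.
Local Notation Im := complex.Im.
Implicit Types (p : \bar R) (z : S) (f g h : S -> R[i]).

Lemma normr_Re_le (c : R[i]) : `|Re c| <= Normc.normc c.
Proof. by case: c => x y /=; rewrite -sqrtr_sqr ler_wsqrtr// lerDl sqr_ge0. Qed.

Lemma normr_Im_le (c : R[i]) : `|Im c| <= Normc.normc c.
Proof. by case: c => x y /=; rewrite -sqrtr_sqr ler_wsqrtr// lerDr sqr_ge0. Qed.

Lemma normc_le_ReIm (c : R[i]) : Normc.normc c <= `|Re c| + `|Im c|.
Proof.
case: c => x y /=; rewrite -(ger0_norm (addr_ge0 (normr_ge0 x) (normr_ge0 y))) -sqrtr_sqr.
rewrite ler_wsqrtr// sqrrD !real_normK ?num_real//.
by rewrite addrAC lerDl mulrn_wge0// mulr_ge0.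
Qed.

Lemma measurable_normc f : measurable_fun setT (fun z => Re (f z)) ->
  measurable_fun setT (fun z => Im (f z)) ->
  measurable_fun setT (fun z => Normc.normc (f z)).
Proof.
move=> mr mi; have -> : (fun z => Normc.normc (f z)) =
    (fun z => Num.sqrt (Re (f z) ^+ 2 + Im (f z) ^+ 2)).
  by apply/funext => z; case: (f z).
apply: (@measurableT_comp _ _ _ _ _ _ (@Num.sqrt R)).
  exact: (continuous_measurable_fun (@sqrt_continuous R)).
by apply: measurable_funD; exact: measurable_funX.
Qed.

Lemma normc_ge0 (c : R[i]) : 0 <= Normc.normc c.
Proof. by case: c => x y; exact: sqrtr_ge0. Qed.

Lemma Lnorm_Re_le p f : (1 <= p)%E -> in_Lp p f -> (Ln p (fun z => Re (f z)) <= Lpnorm p f)%E.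
Proof.
move=> p1 [mr mi _]; apply: Lnorm_le => //; first exact: measurable_normc.
by move=> z; rewrite (ger0_norm (normc_ge0 _)); exact: normr_Re_le.
Qed.

Lemma Lnorm_Im_le p f : (1 <= p)%E -> in_Lp p f -> (Ln p (fun z => Im (f z)) <= Lpnorm p f)%E.
Proof.
move=> p1 [mr mi _]; apply: Lnorm_le => //; first exact: measurable_normc.
by move=> z; rewrite (ger0_norm (normc_ge0 _)); exact: normr_Im_le.
Qed.

Lemma Lpnorm_le_ReIm p f : (1 <= p)%E -> in_Lp p f ->
  (Lpnorm p f <= Ln p (fun z => Re (f z)) + Ln p (fun z => Im (f z)))%E.
Proof.
move=> p1 [mr mi _].
have ar : measurable_fun setT (fun z => `|Re (f z)|) by exact: measurableT_comp.
have ai : measurable_fun setT (fun z => `|Im (f z)|) by exact: measurableT_comp.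
have eN (u : S -> R) : measurable_fun setT u -> (Ln p (fun z => `|u z|%R) <= Ln p u)%E.
  move=> mu; apply: Lnorm_le => //; first exact: measurableT_comp.
  by move=> z; rewrite normr_id.
apply: le_trans (leeD (eN _ mr) (eN _ mi)).
apply: le_trans (eminkowski P ar ai p1).
apply: Lnorm_le => //; first exact: measurable_normc.
  exact: measurable_funD.
move=> z; rewrite (ger0_norm (normc_ge0 _)) ger0_norm; first exact: normc_le_ReIm.
by rewrite addr_ge0.
Qed.

Definition cint h : Prop := P.-integrable setT (EFin \o (fun z => Re (h z))) /\
  P.-integrable setT (EFin \o (fun z => Im (h z))).

Lemma cintegral_lin (c : R[i]) g h : cint g -> cint h ->
  cint (fun z => c * g z + h z) /\
  cintegral (fun z => c * g z + h z) = c * cintegral g + cintegral h.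
Proof.
move=> [gr gi] [hr hi]; case: c => a b.
have er : (fun z => Re ((a +i* b)%C * g z + h z)) =
    (fun z => a * Re (g z) + - b * Im (g z) + Re (h z)).
  by apply/funext => z; case: (g z) (h z) => [x y] [x' y'] /=; ring.
have ei : (fun z => Im ((a +i* b)%C * g z + h z)) =
    (fun z => a * Im (g z) + b * Re (g z) + Im (h z)).
  by apply/funext => z; case: (g z) (h z) => [x y] [x' y'] /=; ring.
have i1 := integrableZ_EFin a gr; have i2 := integrableZ_EFin (- b) gi.
have i3 := integrableZ_EFin a gi; have i4 := integrableZ_EFin b gr.
have i12 := integrableD measurableT i1 i2; have i34 := integrableD measurableT i3 i4.
split.
  by rewrite /cint er ei; split; [exact: (integrableD measurableT i12 hr)|
    exact: (integrableD measurableT i34 hi)].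
rewrite /cintegral er ei.
rewrite (RintegralD measurableT i12 hr) (RintegralD measurableT i1 i2).
rewrite (RintegralD measurableT i34 hi) (RintegralD measurableT i3 i4).
have Z c (u : S -> R) : P.-integrable setT (EFin \o u) ->
    \int[P]_z (c * u z) = c * \int[P]_z u z by move=> iu; rewrite RintegralZl.
rewrite (Z _ _ gr) (Z _ _ gi) (Z _ _ gi) (Z _ _ gr) {Z}.
move: (\int[_]_(_ in _) _) (\int[_]_(_ in _) _) (\int[_]_(_ in _) _) (\int[_]_(_ in _) _) => x y x' y'.
by apply/eqP; rewrite eq_complex /=; apply/andP; split; apply/eqP; ring.
Qed.

Lemma cintegral_sum (I : Type) (r : seq I) (c : I -> R[i]) (h : I -> S -> R[i]) :
  (forall i, cint (h i)) ->
  cint (fun z => \sum_(i <- r) c i * h i z) /\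
  cintegral (fun z => \sum_(i <- r) c i * h i z) = \sum_(i <- r) c i * cintegral (h i).
Proof.
move=> ih; elim: r => [|i r [IH1 IH2]].
  rewrite big_nil (_ : (fun z => _) = fun=> 0); last first.
    by apply/funext => z; rewrite big_nil.
  split; first by split; exact: integrable0.
  by rewrite /cintegral /Rintegral integral0.
rewrite big_cons (_ : (fun z => \sum_(j <- i :: r) c j * h j z) =
    (fun z => c i * h i z + \sum_(j <- r) c j * h j z)); last first.
  by apply/funext => z; rewrite big_cons.
by have [? ->] := cintegral_lin (c i) (ih i) IH1; rewrite IH2.
Qed.

Lemma in_Lp_cint p f : (1 <= p)%E -> in_Lp p f -> cint f.
Proof.
move=> p1 fp; have [mr mi fy] := fp.
by split; apply: (Lp_integrable p1) => //; [exact: le_lt_trans (Lnorm_Re_le p1 fp) fy|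
  exact: le_lt_trans (Lnorm_Im_le p1 fp) fy].
Qed.

Lemma cint_conjM f (Y : S -> R[i]) : cint f -> bm (fun z => Re (Y z)) ->
  bm (fun z => Im (Y z)) -> cint (fun z => f z * conjc (Y z)).
Proof.
move=> [fr fi] br bi.
have er : (fun z => Re (f z * conjc (Y z))) =
    (fun z => Re (f z) * Re (Y z) + Im (f z) * Im (Y z)).
  by apply/funext => z; case: (f z) (Y z) => [x y] [x' y'] /=; ring.
have ei : (fun z => Im (f z * conjc (Y z))) =
    (fun z => Im (f z) * Re (Y z) + -1 * (Re (f z) * Im (Y z))).
  by apply/funext => z; case: (f z) (Y z) => [x y] [x' y'] /=; ring.
rewrite /cint er ei; split.
  exact: (integrableD measurableT (integrable_bmM fr br) (integrable_bmM fi bi)).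
exact: (integrableD measurableT (integrable_bmM fi br)
  (integrableZ_EFin (-1) (integrable_bmM fr bi))).
Qed.

Lemma inner_sumr m f (Y : 'I_m -> S -> R[i]) (c : 'I_m -> R[i]) : cint f ->
  (forall i, smooth (Y i)) ->
  inner f (fun z => \sum_(i < m) c i * Y i z) = \sum_(i < m) conjc (c i) * inner f (Y i).
Proof.
move=> fi sY; have hi i : cint (fun z => f z * conjc (Y i z)).
  by have [? ?] := smooth_bm (sY i); exact: cint_conjM.
rewrite -(cintegral_sum (index_enum 'I_m) (fun i => conjc (c i)) hi).2.
rewrite /inner; congr (cintegral _); apply/funext => z.
rewrite rmorph_sum mulr_sumr; apply: eq_bigr => i _.
by rewrite rmorphM mulrCA.
Qed.

Lemma inner_real f (u : S -> R) : inner f (fun z => (u z)%:C%C) =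
  ((\int[P]_z (Re (f z) * u z)) +i* (\int[P]_z (Im (f z) * u z)))%C.
Proof.
rewrite /inner /cintegral; congr (_ +i* _)%C; apply: eq_Rintegral => z _.
  by case: (f z) => x y /=; ring.
by case: (f z) => x y /=; ring.
Qed.

(** The coefficient relation extends from the basis to all of the eigenspace by conjugate linearity;
    a real [u] then separates real and imaginary parts. *)
Lemma fracderiv_eigen d (dk : nat -> nat) (Y : forall k, 'I_(dk k) -> S -> R[i])
    (gamma : R) f g k (u : S -> R) : d = (2 * n.+1 - 1)%N ->
  (forall k, orthonormal_basis (LB_eigenspace (theta d k)) (Y k)) ->
  gamma != 0 -> cint f -> cint g -> is_fracderiv d Y gamma f g -> eigen k u ->
  \int[P]_z (Re (g z) * u z) = th k `^ (gamma / 2) * \int[P]_z (Re (f z) * u z) /\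
  \int[P]_z (Im (g z) * u z) = th k `^ (gamma / 2) * \int[P]_z (Im (f z) * u z).
Proof.
move=> -> hY g0 fi gi fd eu; have [hYE _ hYs] := hY k.
have [c uE] := hYs _ (eigen_LB eu).
have {}uE : (fun z => (u z)%:C%C) = (fun z => \sum_(i < dk k) c i * Y k i z).
  exact/funext.
have sY i : smooth (Y k i) by case: (hYE i).
have : inner g (fun z => (u z)%:C%C) =
    (th k `^ (gamma / 2))%:C%C * inner f (fun z => (u z)%:C%C).
  rewrite uE !inner_sumr// mulr_sumr; apply: eq_bigr => i _.
  (* For k = 0 the prescribed coefficient is 0; it agrees with theta_0^(gamma/2) because theta_0 = 0
     and gamma is nonzero. *)
  rewrite mulrCA; congr (_ * _); rewrite fd; case: eqP => // k0.
  have -> : th k = 0 by rewrite /theta k0 mul0n.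
  by rewrite powR0 ?mul0r// mulf_neq0// invr_neq0.
rewrite !inner_real.
move: (\int[_]_(_ in _) _) (\int[_]_(_ in _) _) (\int[_]_(_ in _) _) (\int[_]_(_ in _) _) => x y x' y'.
by move=> /eqP; rewrite eq_complex /= !mul0r subr0 addr0 => /andP[/eqP -> /eqP ->].
Qed.

End complex_functions.

Theorem mainTheorem2 (R : realType) (n d : nat)
    (hd : d = (2 * n.+1 - 1)%N) (hd3 : (3 <= d)%N)
    (dk : nat -> nat) (Y : forall k : nat, 'I_(dk k) -> csphere R n -> R[i])
    (hY : forall k : nat, orthonormal_basis (LB_eigenspace (theta d k)) (Y k))
    (p : \bar R) (hp : (1 <= p)%E)
    (alpha beta : R) (halpha : (d%:R - 1) / 2 <= alpha)
    (hbeta : alpha <= beta) :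
  exists C : R, 0 < C /\
    forall f falpha fbeta : csphere R n -> R[i],
      in_Lp p f -> in_Lp p falpha -> in_Lp p fbeta ->
      is_fracderiv d Y alpha f falpha -> is_fracderiv d Y beta f fbeta ->
      (Lpnorm p falpha <=
        C%:E * Lpnorm p fbeta `^ (alpha / beta)
             * Lpnorm p f `^ (1 - alpha / beta))%E.
Proof.
have a0 : 0 < alpha.
  apply: lt_le_trans halpha; rewrite divr_gt0// subr_gt0 ltr1n.
  exact: leq_trans hd3.
have b0 : 0 < beta := lt_le_trans a0 hbeta.
have a20 : 0 < alpha / 2 by rewrite divr_gt0.
have ab2 : alpha / 2 <= beta / 2 by rewrite ler_wpM2r// invr_ge0.
have [C C0 hC] := @real_interpolation R n _ _ a20 ab2.
(* One [C] each for the real and the imaginary part; the 1 makes the constant positive. *)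
exists (C + C + 1); split; first by rewrite ltr_wpDl// addr_ge0.
move=> f fa fb fL aL bL hfa hfb.
have rE : alpha / 2 / (beta / 2) = alpha / beta by field; rewrite gt_eqF.
rewrite rE in hC.
have r0 : 0 <= alpha / beta by rewrite divr_ge0// ltW.
have r1 : 0 <= 1 - alpha / beta by rewrite subr_ge0 ler_pdivrMr// mul1r.
have an0 : alpha != 0 by rewrite gt_eqF.
have bn0 : beta != 0 by rewrite gt_eqF.
have ci g := @in_Lp_cint R n p g hp.
have ea k u := @fracderiv_eigen R n d dk Y alpha f fa k u hd hY an0 (ci _ fL) (ci _ aL) hfa.
have eb k u := @fracderiv_eigen R n d dk Y beta f fb k u hd hY bn0 (ci _ fL) (ci _ bL) hfb.
have fin (g : csphere R n -> R[i]) : in_Lp p g -> Lpnorm p g = (fine (Lpnorm p g))%:E.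
  by move=> [_ _ gy]; apply: nrmE.
have fin0 (g : csphere R n -> R[i]) : 0 <= fine (Lpnorm p g) by apply: nrm_ge0.
have Ry (g : csphere R n -> R[i]) (gL : in_Lp p g) : ('N[sphere_measure]_p[EFin \o (fun z => complex.Re (g z))] < +oo)%E.
  by apply: le_lt_trans (Lnorm_Re_le hp gL) _; case: gL.
have Iy (g : csphere R n -> R[i]) (gL : in_Lp p g) : ('N[sphere_measure]_p[EFin \o (fun z => complex.Im (g z))] < +oo)%E.
  by apply: le_lt_trans (Lnorm_Im_le hp gL) _; case: gL.
have Rn (g : csphere R n -> R[i]) : in_Lp p g -> nrm sphere_measure p (fun z => complex.Re (g z)) <= fine (Lpnorm p g).
  by move=> gL; rewrite -lee_fin -nrmE ?Ry// -fin//; exact: Lnorm_Re_le.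
have In (g : csphere R n -> R[i]) : in_Lp p g -> nrm sphere_measure p (fun z => complex.Im (g z)) <= fine (Lpnorm p g).
  by move=> gL; rewrite -lee_fin -nrmE ?Iy// -fin//; exact: Lnorm_Im_le.
have mR (g : csphere R n -> R[i]) : in_Lp p g -> measurable_fun setT (fun z => complex.Re (g z)) by case.
have mI (g : csphere R n -> R[i]) : in_Lp p g -> measurable_fun setT (fun z => complex.Im (g z)) by case.
set X := fine (Lpnorm p fb) `^ (alpha / beta) * fine (Lpnorm p f) `^ (1 - alpha / beta).
have X0 : 0 <= X by rewrite mulr_ge0 ?powR_ge0.
have mono x y : 0 <= x -> 0 <= y -> x <= fine (Lpnorm p fb) -> y <= fine (Lpnorm p f) ->
    C * (x `^ (alpha / beta) * y `^ (1 - alpha / beta)) <= C * X.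
  move=> x0 y0 hx hy; rewrite ler_wpM2l// ler_pM ?powR_ge0//.
    by rewrite ge0_ler_powR// nnegrE.
  by rewrite ge0_ler_powR// nnegrE.
have hR := le_trans (hC p _ _ _ hp (mR _ fL) (mR _ aL) (mR _ bL) (Ry _ fL) (Ry _ aL) (Ry _ bL)
  (fun k u e => (ea k u e).1) (fun k u e => (eb k u e).1))
  (mono _ _ (nrm_ge0 _ _ _) (nrm_ge0 _ _ _) (Rn _ bL) (Rn _ fL)).
have hI := le_trans (hC p _ _ _ hp (mI _ fL) (mI _ aL) (mI _ bL) (Iy _ fL) (Iy _ aL) (Iy _ bL)
  (fun k u e => (ea k u e).2) (fun k u e => (eb k u e).2))
  (mono _ _ (nrm_ge0 _ _ _) (nrm_ge0 _ _ _) (In _ bL) (In _ fL)).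
apply: le_trans (Lpnorm_le_ReIm hp aL) _.
rewrite (nrmE (Ry _ aL)) (nrmE (Iy _ aL)) (fin _ bL) (fin _ fL) !poweR_EFin -!EFinM -EFinD lee_fin.
rewrite -mulrA -/X mulrDl mul1r mulrDl.
by rewrite (le_trans (lerD hR hI))// lerDl.
Qed.
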